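(* Let $F,G:\mathscr A\to\mathscr B$ be two cohomologically unital $A_\infty$-functors between strictly unital $A_\infty$-categories. If $F\sim G$ (homotopic), then $F\approx G$ (weakly equivalent) and $[F]=[G]$ in $\mathrm{Ho}(A_\infty\mathrm{Cat})$.
   Context: $R$ is a commutative ring; categories are small. A non unital $A_\infty$-category $\mathscr A$ is a graded $R$-linear quiver (a set of objects and graded $R$-modules $\mathrm{Hom}(x,y)$) with $R$-linear maps $m^n_{\mathscr A}:\mathrm{Hom}(x_{n-1},x_n)\otimes\cdots\otimes\mathrm{Hom}(x_0,x_1)\to\mathrm{Hom}(x_0,x_n)[2-n]$ ($n\ge1$) such that $\sum_{m=1}^n\sum_{d=0}^{n-m}(-1)^{\dagger_d}m^{n-m+1}(f_n,\dots,f_{d+m+1},m^m(f_{d+m},\dots,f_{d+1}),f_d,\dots,f_1)=0$, with $\dagger_d=\sum_{i\le d}\deg f_i-d$. It is strictly unital if every $x$ has a closed degree $0$ morphism $1_x$ with $m^2(f,1_x)=f=(-1)^{\deg f}m^2(1_y,f)$ for $f:x\to y$, and $m^n(\dots,1_x,\dots)=0$ for $n\ge3$. $H(\mathscr A)$ has the same objects, morphisms the $m^1$-cohomology, composition $[g][f]=(-1)^{\deg f}[m^2(g,f)]$; $\mathscr A$ is cohomologically unital if $H(\mathscr A)$ is unital. A non unital $A_\infty$-functor $F:\mathscr A\to\mathscr B$ is a map $F^0$ on objects and $R$-linear maps $F^n:\mathrm{Hom}_{\mathscr A}(x_{n-1},x_n)\otimes\cdots\otimes\mathrm{Hom}_{\mathscr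 A}(x_0,x_1)\to\mathrm{Hom}_{\mathscr B}(F^0x_0,F^0x_n)[1-n]$, $n\ge1$, with $\sum_r\sum_{s_1+\dots+s_r=n}m^r_{\mathscr B}(F^{s_r}(f_n,\dots),\dots,F^{s_1}(f_{s_1},\dots,f_1))=\sum_{m,k}(-1)^{\dagger_k}F^{n-m+1}(f_n,\dots,m^m_{\mathscr A}(f_{k+m},\dots,f_{k+1}),f_k,\dots,f_1)$. It is cohomologically unital if it induces a unital functor on cohomology; strictly unital if $F^1(1_x)=1_{F^0x}$ and $F^n(\dots,1_x,\dots)=0$ for $n\ge2$; a quasi-equivalence if each $F^1$ is a quasi-isomorphism and $H^0(F)$ is essentially surjective. $A_\infty\mathrm{Cat}$ (resp. $A_\infty\mathrm{Cat}^{\mathrm{cu}}$) is the category of strictly unital (resp. cohomologically unital) $A_\infty$-categories and functors; $\mathrm{Ho}$ denotes localization at quasi-equivalences. The inclusion induces an equivalence $\mathrm{Ho}(A_\infty\mathrm{Cat})\simeq\mathrm{Ho}(A_\infty\mathrm{Cat}^{\mathrm{cu}})$ (known), through which the class $[F]$ of a cohomologically unital functor between strictly unital categories is regarded as a morphism of $\mathrm{Ho}(A_\infty\mathrm{Cat})$. A prenatural transformation $T:F\Rightarrow G$ of degree $g$ consists of $T^0(x)\in\mathrm{Hom}_{\mathscr B}(F^0x,G^0x)$ of degree $g$ and $R$-linear maps $T^n:\mathrm{Hom}_{\mathscr A}(x_{n-1},x_n)\otimes\cdots\otimes\mathrm{Hom}_{\mathscr A}(x_0,x_1)\to\mathrm{Hom}_{\mathscr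 B}(F^0x_0,G^0x_n)[g-n]$, $n\ge1$. Differential: $\mathfrak M^1(T)^n(f_n,\dots,f_1)=\sum_{r,i}\sum_{s_1+\dots+s_r=n}(-1)^{\dagger}m^r_{\mathscr B}(G^{s_r}(f_n,\dots),\dots,G^{s_{i+1}}(\dots),T^{s_i}(\dots),F^{s_{i-1}}(\dots),\dots,F^{s_1}(\dots,f_1))-\sum_{m,k}(-1)^{\dagger_k+g-1}T^{n-m+1}(f_n,\dots,m^m_{\mathscr A}(f_{k+m},\dots,f_{k+1}),f_k,\dots,f_1)$ with $s_i\ge0$, other $s_j\ge1$, $\dagger=(g-1)\sum_{l\le s_1+\dots+s_{i-1}}(\deg f_l-1)$. Composition of $T_1:F\Rightarrow G$, $T_2:G\Rightarrow K$: $\mathfrak M^2(T_2,T_1)^n(f_n,\dots,f_1)=\sum(-1)^{\circ}m^r_{\mathscr B}(K^{s_r},\dots,T_2^{s_j},G^{s_{j-1}},\dots,G^{s_{i+1}},T_1^{s_i},F^{s_{i-1}},\dots,F^{s_1})$, $\circ=(\deg T_1-1)\sum_{l\le s_1+\dots+s_{i-1}}(\deg f_l-1)+(\deg T_2-1)\sum_{l\le s_1+\dots+s_{j-1}}(\deg f_l-1)$ (arguments inserted in order). $F\sim G$ (homotopic): $F^0=G^0$ and there is a prenatural transformation $H:F\Rightarrow G$ of degree $0$ with $H^0(x)=0$ for all $x$ and $F-G=\mathfrak M^1(H)$, where $F-G$ is the degree $1$ prenatural transformation with $0$-component zero and $n$-th component $F^n-G^n$. $F\approx G$ (weakly equivalent):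 there are $\mathfrak M^1$-closed degree $0$ transformations $T:F\Rightarrow G$, $S:G\Rightarrow F$ with $\mathfrak M^2(S,T)-\mathrm{Id}_F$ and $\mathfrak M^2(T,S)-\mathrm{Id}_G$ in the image of $\mathfrak M^1$, where $\mathrm{Id}_F^0(x)=1_{F^0x}$ and $\mathrm{Id}_F^n=0$ for $n>0$. *)

(* Defs.v *)
From mathcomp Require Import all_boot all_order all_algebra.
From mathcomp Require Import boolp zify.

Set Implicit Arguments.
Unset Strict Implicit.
Unset Printing Implicit Defensive.

Import GRing.Theory.
Local Open Scope ring_scope.

(* Composable sequences.  A chain lists its entries in the order in which they
   are applied: [ccons f1 (ccons f2 ... (cnil _))] with [f1 : x0 -> x1],
   [f2 : x1 -> x2], ... is the sequence usually written (fn, ..., f2, f1). *)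
Inductive chain (O : Type) (E : O -> O -> Type) : O -> O -> Type :=
| cnil x : chain E x x
| ccons x y z (f : E x y) (c : chain E y z) : chain E x z.
Arguments cnil {O E} x.
Arguments ccons {O E x y z} f c.

Section Chains.
Variables (O : Type) (E : O -> O -> Type).

Definition cone x y (f : E x y) : chain E x y := ccons f (cnil y).

Fixpoint ccat x y z (c : chain E x y) : chain E y z -> chain E x z :=
  match c in chain _ x y return chain E y z -> chain E x z with
  | cnil _ => id
  | ccons _ _ _ f c => fun c' => ccons f (ccat c c')
  end.

Fixpoint csize x y (c : chain E x y) : nat :=
  if c is ccons _ _ _ _ c' then (csize c').+1 else 0.

Record cut x y := Cut { cmid : O; cfst : chain E x cmid; csnd : chain E cmid y }.

(* All ways of writing [c] as a concatenation [ccat a b]. *)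
Fixpoint cuts x y (c : chain E x y) : seq (cut x y) :=
  match c in chain _ x y return seq (cut x y) with
  | cnil x => [:: Cut (cnil x) (cnil x)]
  | ccons _ _ _ f c' => Cut (cnil _) (ccons f c')
                     :: [seq Cut (ccons f (cfst t)) (csnd t) | t <- cuts c']
  end.

(* The ways of adding [f] in front of a sequence of blocks: either as a new
   block, or inside the first block. *)
Definition addhd x y z (f : E x y) (p : chain (chain E) y z) :
    seq (chain (chain E) x z) :=
  match p in chain _ y z return E x y -> seq (chain (chain E) x z) with
  | cnil _ => fun f => [:: ccons (cone f) (cnil _)]
  | ccons _ _ _ b p' => fun f =>
      [:: ccons (cone f) (ccons b p'); ccons (ccons f b) p']
  end f.

(* All ways of cutting [c] into consecutive nonempty blocks.  If [csize c = n],
   these correspond to the (s_1, ..., s_r) with s_i >= 1 and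
   s_1 + ... + s_r = n, the i-th block having size s_i; for n = 0 only r = 0
   occurs. *)
Fixpoint parts x y (c : chain E x y) : seq (chain (chain E) x y) :=
  match c in chain _ x y return seq (chain (chain E) x y) with
  | cnil x => [:: cnil x]
  | ccons _ _ _ f c' => flatten [seq addhd f p | p <- parts c']
  end.

Lemma ccatA w x y z (a : chain E w x) (b : chain E x y) (c : chain E y z) :
  ccat (ccat a b) c = ccat a (ccat b c).
Proof. by elim: a b => //= {}w x' x0 f a IHa b; rewrite IHa. Qed.

Lemma ccats0 x y (a : chain E x y) : ccat a (cnil y) = a.
Proof. by elim: a => //= {}x y' z f a ->. Qed.

Lemma csize_cat x y z (a : chain E x y) (b : chain E y z) :
  csize (ccat a b) = (csize a + csize b)%N.
Proof. by elim: a b => //= {}x y' z' f a IHa b; rewrite IHa. Qed.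

Section Sums.
Variable V : nmodType.

Lemma sum_cuts_cons x y z (f : E x y) (c : chain E y z) (psi : cut x z -> V) :
  \sum_(t <- cuts (ccons f c)) psi t =
  psi (Cut (cnil x) (ccons f c)) +
  \sum_(t <- cuts c) psi (Cut (ccons f (cfst t)) (csnd t)).
Proof. by rewrite /= big_cons big_map. Qed.

Lemma sum_parts_cons x y z (f : E x y) (c : chain E y z)
    (psi : chain (chain E) x z -> V) :
  \sum_(p <- parts (ccons f c)) psi p =
  \sum_(p <- parts c) \sum_(q <- addhd f p) psi q.
Proof. by rewrite /= big_flatten big_map. Qed.

End Sums.
End Chains.

Fixpoint cmap (O O' : Type) (E : O -> O -> Type) (E' : O' -> O' -> Type)
    (o : O -> O') (h : forall x y, E x y -> E' (o x) (o y))
    x y (c : chain E x y) : chain E' (o x) (o y) :=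
  match c in chain _ x y return chain E' (o x) (o y) with
  | cnil x => cnil (o x)
  | ccons _ _ _ f c' => ccons (h _ _ f) (cmap h c')
  end.

Section Combinatorics.
Variables (O : Type) (E : O -> O -> Type) (V : nmodType).

Lemma cmap_cat (O' : Type) (E' : O' -> O' -> Type) (o : O -> O')
    (h : forall x y, E x y -> E' (o x) (o y)) x y z (a : chain E x y)
    (b : chain E y z) : cmap h (ccat a b) = ccat (cmap h a) (cmap h b).
Proof. by elim: a b => //= {}x y' z' f a IHa b; rewrite IHa. Qed.

Lemma sum_cuts_map (O' : Type) (E' : O' -> O' -> Type) (o : O -> O')
    (h : forall x y, E x y -> E' (o x) (o y)) x y (c : chain E x y)
    (psi : cut E' (o x) (o y) -> V) :
  \sum_(t <- cuts (cmap h c)) psi t =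
  \sum_(t <- cuts c) psi (Cut (cmap h (cfst t)) (cmap h (csnd t))).
Proof.
elim: c psi => [{}x|{}x y' z f c IHc] psi; first by rewrite /= !big_seq1.
by rewrite /= !big_cons !big_map IHc.
Qed.

Lemma sum_cuts_coassoc x y (c : chain E x y)
    (psi : forall u v, chain E x u -> chain E u v -> chain E v y -> V) :
  \sum_(t <- cuts c) \sum_(s <- cuts (csnd t))
     psi _ _ (cfst t) (cfst s) (csnd s) =
  \sum_(t <- cuts c) \sum_(s <- cuts (cfst t))
     psi _ _ (cfst s) (csnd s) (csnd t).
Proof.
elim: c psi => [{}x|{}x y' z f c IHc] psi; first by rewrite /= !big_seq1 /= ?big_seq1.
rewrite !sum_cuts_cons /= big_seq1 /= -!addrA; congr (_ + _).
rewrite (IHc (fun u v a b d => psi u v (ccons f a) b d)) -big_split /=.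
by apply: eq_bigr => t _; rewrite big_cons big_map.
Qed.

Let glue x y z (p : chain (chain E) y z) : E x y ->
    (chain (chain E) x z -> V) -> V :=
  match p in chain _ y z return E x y -> (chain (chain E) x z -> V) -> V with
  | cnil _ => fun _ _ => 0
  | ccons _ _ _ b p' => fun f psi => psi (ccons (ccons f b) p')
  end.

Let glue_nil x y y' z (p : chain (chain E) y y') :
    E x y -> chain (chain E) y' z -> (chain (chain E) x z -> V) -> V :=
  match p in chain _ y y'
  return E x y -> chain (chain E) y' z -> (chain (chain E) x z -> V) -> V with
  | cnil _ => fun f r psi => glue r f psi
  | ccons _ _ _ _ _ => fun _ _ _ => 0
  end.

Lemma addhdE x y z (f : E x y) (p : chain (chain E) y z)
    (psi : chain (chain E) x z -> V) :
  \sum_(q <- addhd f p) psi q = psi (ccons (cone f) p) + glue p f psi.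
Proof.
by case: p f psi => [{}y|{}y y' {}z b p'] f psi; rewrite /= !(big_cons, big_nil) ?addr0.
Qed.

Lemma sum_addhd_cuts x y z (f : E x y) (p : chain (chain E) y z)
    (psi : cut (chain E) x z -> V) :
  \sum_(q <- addhd f p) \sum_(t <- cuts q) psi t =
  \sum_(q <- addhd f p) psi (Cut (cnil x) q) +
  \sum_(t <- cuts p) \sum_(q <- addhd f (cfst t)) psi (Cut q (csnd t)).
Proof.
case: p f psi => [{}y|{}y y' {}z b p'] f psi.
  by rewrite /= ?(big_cons, big_nil) /= ?(big_cons, big_nil) /= ?(big_cons, big_nil) /= ?addr0.
rewrite /= !(big_cons, big_nil, big_map) /= -!/(cuts p') !addr0 addrACA.
congr (_ + _); rewrite -addrA; congr (_ + _); rewrite -big_split /=.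
by apply: eq_bigr => t _; rewrite !(big_cons, big_nil) addr0.
Qed.

Lemma sum_parts_cuts x y (c : chain E x y) (psi : cut (chain E) x y -> V) :
  \sum_(p <- parts c) \sum_(t <- cuts p) psi t =
  \sum_(t <- cuts c) \sum_(p1 <- parts (cfst t)) \sum_(p2 <- parts (csnd t))
     psi (Cut p1 p2).
Proof.
elim: c psi => [{}x|{}x y' z f c IHc] psi; first by rewrite /= !big_seq1 /= ?big_seq1.
rewrite sum_parts_cons sum_cuts_cons /= big_seq1.
under eq_bigr do rewrite sum_addhd_cuts.
rewrite big_split /=; congr (_ + _); first by rewrite big_flatten big_map.
rewrite (IHc (fun t => \sum_(q <- addhd f (cfst t)) psi (Cut q (csnd t)))).
apply: eq_bigr => t _ /=.
rewrite big_flatten big_map; apply: eq_bigr => p1 _.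
by rewrite exchange_big.
Qed.

Lemma sum_parts_first x y (c : chain E x y) (psi : chain (chain E) x y -> V) :
  (0 < csize c)%N ->
  \sum_(p <- parts c) psi p =
  \sum_(t <- cuts c | (0 < csize (cfst t))%N)
     \sum_(p <- parts (csnd t)) psi (ccons (cfst t) p).
Proof.
elim: c psi => [//|{}x y' z f c IHc] psi _.
rewrite sum_parts_cons /= big_cons big_map /=.
under eq_bigr do rewrite addhdE.
rewrite big_split /=.
case: c f IHc psi => [{}y'|{}y' y'' {}z g c] f IHc psi.
  by rewrite /= !big_seq1 /= addr0 ?big_seq1.
rewrite (IHc (fun p => glue p f psi)) //.
by rewrite /= !big_cons !big_map /=; congr (_ + _).
Qed.

Let addhd_cat x y y' z (f : E x y) (p : chain (chain E) y y')
    (r : chain (chain E) y' z) (psi : chain (chain E) x z -> V) :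
  \sum_(q <- addhd f (ccat p r)) psi q =
  \sum_(q <- addhd f p) psi (ccat q r) + glue_nil p f r psi.
Proof.
case: p f r psi => [{}y|{}y y0 y1 b p] f r psi.
  by rewrite /= addhdE big_seq1.
by rewrite /= !(big_cons, big_nil) addr0.
Qed.

Let sum_addhd_glue w x y u z (g : E w x) (f : E x y)
    (p : chain (chain E) y u) (k : chain (chain E) x u ->
      (chain (chain E) u z -> V) -> V) (psi : chain (chain E) w z -> V) :
  \sum_(q <- addhd f p) k q (fun r => glue_nil q g r psi) =
  \sum_(q <- addhd f p) k q (fun=> 0).
Proof. by case: p f k => [y0|y0 y1 y2 b p] f k; rewrite /= !(big_cons, big_nil). Qed.

Let sum_glue_nil w x z (g : E w x) (c : chain E x z) z'
    (n : forall u, chain E x u -> chain E u z -> chain (chain E) x u ->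
     (chain (chain E) u z' -> V) -> V) (psi : chain (chain E) w z' -> V) :
  \sum_(t <- cuts c) \sum_(p <- parts (cfst t))
     n _ (cfst t) (csnd t) p (fun r => glue_nil p g r psi) =
  n _ (cnil x) c (cnil x) (fun r => glue r g psi) +
  \sum_(t <- cuts c | (0 < csize (cfst t))%N) \sum_(p <- parts (cfst t))
     n _ (cfst t) (csnd t) p (fun=> 0).
Proof.
case: c g n psi => [{}x|{}x y {}z f c] g n psi.
  by rewrite /= ?(big_cons, big_nil) /= ?(big_cons, big_nil) ?addr0.
rewrite /= !big_cons !big_map /= !(big_cons, big_nil) addr0; congr (_ + _).
apply: eq_bigr => t _; rewrite !big_flatten !big_map; apply: eq_bigr => p _.
exact: (sum_addhd_glue _ _ _ (n _ _ _)).
Qed.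

Lemma sum_parts_cat1 w x y z (c : chain E w x) (f : E x y) (c' : chain E y z)
    (psi : chain (chain E) w z -> V) :
  \sum_(p <- parts (ccat c (ccons f c'))) psi p =
  \sum_(t <- cuts c) \sum_(p <- parts (cfst t))
    \sum_(t' <- cuts c') \sum_(p' <- parts (csnd t'))
      psi (ccat p (ccons (ccat (csnd t) (ccons f (cfst t'))) p')).
Proof.
elim: c f c' psi => [{}x|{}w x' {}x g c IHc] f c' psi.
  rewrite /= big_seq1 /= big_flatten big_map big_seq1.
  case: c' f psi => [{}y|{}y y' {}z h c'] f psi.
    by rewrite /= !big_seq1 /= ?big_seq1.
  under eq_bigr do rewrite addhdE.
  rewrite big_split /= big_cons big_map /=; congr (_ + _).
  rewrite (@sum_parts_first _ _ (ccons h c') (fun p => glue p f psi)) //.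
  by rewrite /= big_cons big_map.
rewrite /= big_flatten big_map big_cons big_map /= big_seq1.
rewrite (IHc _ _ (fun q => \sum_(p <- addhd g q) psi p)).
pose n u (a : chain E x' u) (b : chain E u x) (p : chain (chain E) x' u)
  (k : chain (chain E) u z -> V) :=
  \sum_(t' <- cuts c') \sum_(p' <- parts (csnd t'))
     k (ccons (ccat b (ccons f (cfst t'))) p').
transitivity (\sum_(t <- cuts c) \sum_(p <- parts (cfst t))
   n _ (cfst t) (csnd t) p (fun r => glue_nil p g r psi) +
  \sum_(t <- cuts c) \sum_(p <- parts (cfst t)) \sum_(q <- addhd g p)
   \sum_(t' <- cuts c') \sum_(p' <- parts (csnd t'))
      psi (ccat q (ccons (ccat (csnd t) (ccons f (cfst t'))) p'))).
  rewrite -big_split; apply: eq_bigr => t _ /=.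
  rewrite -big_split; apply: eq_bigr => p _ /=.
  rewrite exchange_big -big_split; apply: eq_bigr => t' _ /=.
  rewrite exchange_big -big_split; apply: eq_bigr => p' _ /=.
  by rewrite addhd_cat addrC.
congr (_ + _).
  rewrite sum_glue_nil [X in _ + X]big1 ?addr0 // => t _.
  by rewrite big1 // => p _; rewrite /n big1 // => t' _; rewrite big1.
by apply: eq_bigr => t _; rewrite big_flatten big_map.
Qed.

End Combinatorics.

(* A graded quiver: [A x y d] is the degree d part of Hom(x, y). *)
Record quiver (R : comPzRingType) :=
  Quiver { qob :> Type; qhom : qob -> qob -> int -> lmodType R }.
Coercion qhom : quiver >-> Funclass.

(* Homogeneous elements together with their degree. *)
Definition helt (R : comPzRingType) (A : quiver R) (x y : A) : Type :=
  {d : int & A x y d}.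
Definition hel (R : comPzRingType) (A : quiver R) (x y : A) (d : int)
  (f : A x y d) : helt x y := existT _ d f.

Definition hchain (R : comPzRingType) (A : quiver R) : A -> A -> Type :=
  chain (@helt R A).

(* The reduced degree, i.e. the sum of the deg f_i - 1. *)
Fixpoint rdeg (R : comPzRingType) (A : quiver R) (x y : A) (c : hchain x y) :
    int :=
  if c is ccons _ _ _ f c' then (tag f - 1) + rdeg c' else 0.

Definition sgn (R : comPzRingType) (k : int) : R := (-1) ^+ `|k|%N.
Arguments sgn {R} k.

(* R-multilinear maps Hom(x_{n-1}, x_n) (x) ... (x) Hom(x_0, x_1) ->
   Hom(p x_0, q x_n)[g - n] for all n >= 0.  The value of [T] on [c] lies in
   degree [rdeg c + g]; [ev T c e] is its component of degree [e], so that it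
   vanishes for every other [e].  This avoids casts between degrees. *)
Record multimap (R : comPzRingType) (A B : quiver R) (p q : A -> B) (g : int) :=
  Multimap {
    ev : forall x y : A, hchain x y -> forall e : int, B (p x) (q y) e;
    ev_lin : forall (w x y z : A) (c : hchain w x) (d : int) (a : R)
        (f f' : A x y d) (c' : hchain y z) (e : int),
      ev (ccat c (ccons (hel (a *: f + f')) c')) e =
      a *: ev (ccat c (ccons (hel f) c')) e +
      ev (ccat c (ccons (hel f') c')) e;
    ev_deg : forall (x y : A) (c : hchain x y) (e : int),
      e != rdeg c + g -> ev c e = 0 }.

(* The value of a multimap, as a homogeneous element. *)
Definition mhel (R : comPzRingType) (A B : quiver R) (p q : A -> B) (g : int)
    (T : multimap p q g) (x y : A) (c : hchain x y) : helt (p x) (q y) :=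
  hel (ev T c (rdeg c + g)).

(* The sequence F^{s_r}(..), ..., F^{s_1}(..) for a sequence of blocks. *)
Definition bar (R : comPzRingType) (A B : quiver R) (p : A -> B) (g : int)
    (F : multimap p p g) (x y : A) (b : chain (@hchain R A) x y) :
    hchain (p x) (p y) :=
  cmap (fun x y => @mhel R A B p p g F x y) b.

(* The sum of the (-1)^{dagger_k} T(f_n, .., m(f_{k+m}, .., f_{k+1}), f_k, .., f_1)
   over 1 <= m <= n and 0 <= k <= n - m. *)
Definition insert (R : comPzRingType) (A B : quiver R) (p q : A -> B)
    (g g' : int) (T : multimap p q g) (m : multimap id id g')
    (x y : A) (c : hchain x y) (e : int) : B (p x) (q y) e :=
  \sum_(t <- cuts c) \sum_(s <- cuts (csnd t) | (0 < csize (cfst s))%N)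
    sgn (rdeg (cfst t)) *:
      ev T (ccat (cfst t) (ccons (mhel m (cfst s)) (csnd s))) e.

(* Non unital A-infinity categories.  The operations m^n, n >= 1, are collected
   in one multimap, which is required to vanish on empty sequences. *)
Record ainf_cat (R : comPzRingType) := AInfCat {
  aquiver :> quiver R;
  aop : @multimap R aquiver aquiver id id 2;
  aop_nil : forall (x : aquiver) (e : int), ev aop (cnil x) e = 0;
  aop_rel : forall (x y : aquiver) (c : hchain x y) (e : int),
    insert aop aop c e = 0 }.
Arguments aop {R} a.

(* Non unital A-infinity functors, with the same convention on empty
   sequences. *)
Record ainf_functor (R : comPzRingType) (A B : ainf_cat R) := AInfFunctor {
  fob :> A -> B;
  fmap : multimap fob fob 1;
  fmap_nil : forall (x : A) (e : int), ev fmap (cnil x) e = 0;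
  fmap_rel : forall (x y : A) (c : hchain x y) (e : int),
    \sum_(b <- parts c) ev (aop B) (bar fmap b) e = insert fmap (aop A) c e }.

Section Signs.
Variable R : comPzRingType.

Lemma sgnD (j k : int) : sgn (j + k) = sgn j * sgn k :> R.
Proof.
have sgnE (l : int) : sgn l = (-1) ^+ odd `|l|%N :> R by rewrite /sgn signr_odd.
rewrite !sgnE -signr_addb; congr (_ ^+ nat_of_bool _); lia.
Qed.

Lemma sgn0 : sgn 0 = 1 :> R. Proof. by rewrite /sgn absz0 expr0. Qed.

End Signs.

Section Multimaps.
Variables (R : comPzRingType) (A B : quiver R) (p q : A -> B) (g : int).
Implicit Type T : multimap p q g.

Lemma ev0 T w x y z (c : hchain w x) d (c' : hchain y z) e :
  ev T (ccat c (ccons (@hel _ A x y d 0) c')) e = 0.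
Proof.
have := ev_lin T c (-1) (0 : A x y d) 0 c' e.
by rewrite scaler0 addr0 scaleN1r addNr.
Qed.

Lemma evD T w x y z (c : hchain w x) d (f f' : A x y d) (c' : hchain y z) e :
  ev T (ccat c (ccons (hel (f + f')) c')) e =
  ev T (ccat c (ccons (hel f) c')) e + ev T (ccat c (ccons (hel f') c')) e.
Proof. by have := ev_lin T c 1 f f' c' e; rewrite !scale1r. Qed.

Lemma evZ T w x y z (c : hchain w x) d a (f : A x y d) (c' : hchain y z) e :
  ev T (ccat c (ccons (hel (a *: f)) c')) e =
  a *: ev T (ccat c (ccons (hel f) c')) e.
Proof. by have := ev_lin T c a f 0 c' e; rewrite ev0 !addr0. Qed.

Lemma ev_sum T w x y z (c : hchain w x) d (c' : hchain y z) e I (r : seq I)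
    (P : pred I) (F : I -> A x y d) :
  ev T (ccat c (ccons (hel (\sum_(i <- r | P i) F i)) c')) e =
  \sum_(i <- r | P i) ev T (ccat c (ccons (hel (F i)) c')) e.
Proof.
apply: (big_morph (fun f => ev T (ccat c (ccons (hel f) c')) e)).
  by move=> f f'; rewrite evD.
by rewrite ev0.
Qed.

Lemma mhelE T x y (c : hchain x y) e :
  e = rdeg c + g -> hel (ev T c e) = mhel T c.
Proof. by move->. Qed.

End Multimaps.

Section Degrees.
Variables (R : comPzRingType) (A B : quiver R).

Lemma rdeg_cat x y z (a : hchain x y) (b : @hchain R A y z) :
  rdeg (ccat a b) = rdeg a + rdeg b.
Proof. by elim: a b => [{}x|{}x y' z' f a IHa] b /=; rewrite ?add0r ?IHa ?addrA. Qed.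

Fixpoint rdegs x y (b : chain (@hchain R A) x y) : int :=
  if b is ccons _ _ _ c b' then rdeg c + rdegs b' else 0.

Lemma rdeg_bar (p : A -> B) (F : multimap p p 1) x y
  (b : chain (@hchain R A) x y) : rdeg (bar F b) = rdegs b.
Proof. by elim: b => //= {}x y' z c b ->; rewrite addrK. Qed.

End Degrees.

Section PartsDegree.
Variables (R : comPzRingType) (A : quiver R) (V : nmodType).

Lemma eq_sum_parts x y (c : @hchain R A x y)
    (psi psi' : chain (@hchain R A) x y -> V) :
  (forall b, rdegs b = rdeg c -> (0 < csize b)%N = (0 < csize c)%N -> psi b = psi' b) ->
  \sum_(b <- parts c) psi b = \sum_(b <- parts c) psi' b.
Proof.
elim: c psi psi' => [{}x|{}x y' z f c IHc] psi psi' H.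
  by rewrite /= !big_seq1 H.
rewrite !sum_parts_cons; apply: IHc => b degb _.
have {}H q : rdegs q = tag f - 1 + rdeg c -> (0 < csize q)%N -> psi q = psi' q.
  by move=> degq szq; rewrite H ?szq.
move: (rdeg c) degb H => n {c}.
case: b f psi psi' => [y0|y0 y1 y2 b0 b] f psi psi' degb H;
  rewrite /= !(big_cons, big_nil) !H //= -?degb /= ?addr0 ?addrA //.
Qed.

Lemma eq_sum_cuts x y (c : @hchain R A x y) (psi psi' : cut (@helt R A) x y -> V) :
  (forall t, rdeg (cfst t) + rdeg (csnd t) = rdeg c ->
     (csize (cfst t) + csize (csnd t) = csize c)%N -> psi t = psi' t) ->
  \sum_(t <- cuts c) psi t = \sum_(t <- cuts c) psi' t.
Proof.
elim: c psi psi' => [{}x|{}x y' z f c IHc] psi psi' H.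
  by rewrite /= !big_seq1 H.
rewrite !sum_cuts_cons H /= ?add0r //; congr (_ + _).
by apply: IHc => t degt szt; apply: H; rewrite /= -?degt -?szt ?addrA.
Qed.

Lemma sum_parts_eq0 x y (c : @hchain R A x y)
    (psi : chain (@hchain R A) x y -> V) :
  (forall b, rdegs b = rdeg c -> (0 < csize b)%N = (0 < csize c)%N -> psi b = 0) ->
  \sum_(b <- parts c) psi b = 0.
Proof. by move/eq_sum_parts->; rewrite big1_eq. Qed.

Lemma sum_cuts_eq0 x y (c : @hchain R A x y) (psi : cut (@helt R A) x y -> V) :
  (forall t, rdeg (cfst t) + rdeg (csnd t) = rdeg c ->
     (csize (cfst t) + csize (csnd t) = csize c)%N -> psi t = 0) ->
  \sum_(t <- cuts c) psi t = 0.
Proof. by move/eq_sum_cuts->; rewrite big1_eq. Qed.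

End PartsDegree.

Lemma csize_bar (R : comPzRingType) (A B : quiver R) (p : A -> B) g
    (F : multimap p p g) x y (b : chain (@hchain R A) x y) :
  csize (bar F b) = csize b.
Proof. by elim: b => //= {}x y' z c b ->. Qed.

Lemma bar_cat (R : comPzRingType) (A B : quiver R) (p : A -> B) g
    (F : multimap p p g) x y z (a : chain (@hchain R A) x y)
    (b : chain (@hchain R A) y z) :
  bar F (ccat a b) = ccat (bar F a) (bar F b).
Proof. exact: cmap_cat. Qed.

Lemma bar_cons (R : comPzRingType) (A B : quiver R) (p : A -> B) g
    (F : multimap p p g) x y z (c : @hchain R A x y)
    (b : chain (@hchain R A) y z) :
  bar F (ccons c b) = ccons (mhel F c) (bar F b).
Proof. by []. Qed.

Lemma sum_parts0 (R : comPzRingType) (A : quiver R) (V : nmodType) (x : A)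
  (psi : chain (@hchain R A) x x -> V) :
  \sum_(b <- parts (cnil x)) psi b = psi (cnil x).
Proof. exact: big_seq1. Qed.

Section Composition.
Variables (R : comPzRingType) (A B C : quiver R) (p : A -> B) (q : B -> C).
Variables (F : multimap p p 1) (G : multimap q q 1).

Let gf x y (c : hchain x y) e : C (q (p x)) (q (p y)) e :=
  \sum_(b <- parts c) ev G (bar F b) e.

Fact mcomp_lin w x y z (c : hchain w x) d a (f f' : A x y d) (c' : hchain y z) e :
  gf (ccat c (ccons (hel (a *: f + f')) c')) e =
  a *: gf (ccat c (ccons (hel f) c')) e + gf (ccat c (ccons (hel f') c')) e.
Proof.
rewrite /gf !sum_parts_cat1 scaler_sumr -big_split; apply: eq_bigr => t _ /=.
rewrite scaler_sumr -big_split; apply: eq_bigr => b _ /=.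
rewrite scaler_sumr -big_split; apply: eq_bigr => t' _ /=.
rewrite scaler_sumr -big_split; apply: eq_bigr => b' _ /=.
rewrite !bar_cat !bar_cons.
set e0 := rdeg (csnd t) + (d - 1 + rdeg (cfst t')) + 1.
by rewrite -!(@mhelE _ _ _ _ _ _ _ _ _ _ e0) ?rdeg_cat //= ev_lin ev_lin.
Qed.

Fact mcomp_deg x y (c : hchain x y) e : e != rdeg c + 1 -> gf c e = 0.
Proof.
move=> ne; transitivity (\sum_(b <- parts c) (0 : C (q (p x)) (q (p y)) e)).
  2: by rewrite big1_eq.
by apply: eq_sum_parts => b degb _; rewrite ev_deg // rdeg_bar degb.
Qed.

(* The n-th component is the sum of the G^r(F^{s_r}, ..., F^{s_1}). *)
Definition mcomp : multimap (fun x => q (p x)) (fun x => q (p x)) 1 :=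
  Multimap mcomp_lin mcomp_deg.

Lemma mcompE x y (c : hchain x y) e :
  ev mcomp c e = \sum_(b <- parts c) ev G (bar F b) e.
Proof. by []. Qed.

Lemma mhel_comp x y (c : hchain x y) :
  mhel mcomp c = hel (\sum_(b <- parts c) ev G (bar F b) (rdeg c + 1)).
Proof. by []. Qed.

Lemma sum_parts_comp (D : quiver R) (u v : C -> D) g (T : multimap u v g)
    x y (c : hchain x y) w (pre : hchain w (q (p x))) e :
  \sum_(b <- parts c) ev T (ccat pre (bar mcomp b)) e =
  \sum_(b <- parts c) \sum_(b' <- parts (bar F b)) ev T (ccat pre (bar G b')) e.
Proof.
have [n] := ubnP (csize c); elim: n => // n IHn in x y c w pre e *.
move=> szc; case: (posnP (csize c)) => [c0|c_gt0].
  by case: c c0 {szc} pre => // {}x _ pre; rewrite !sum_parts0.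
rewrite sum_parts_first //.
transitivity (\sum_(t <- cuts c) \sum_(b1 <- parts (cfst t))
    \sum_(b2 <- parts (csnd t)) if (0 < csize b1)%N then
   \sum_(b' <- parts (bar F b2))
     ev T (ccat pre (ccons (mhel G (bar F b1)) (bar G b'))) e else 0); last first.
  rewrite -(sum_parts_cuts c (fun t => if (0 < csize (cfst t))%N then
   \sum_(b' <- parts (bar F (csnd t)))
     ev T (ccat pre (ccons (mhel G (bar F (cfst t))) (bar G b'))) e else 0)).
  apply: eq_sum_parts => b _; rewrite c_gt0 => szb.
  rewrite sum_parts_first ?csize_bar // [RHS]big_mkcond sum_cuts_map /=.
  by apply: eq_bigr => t _; rewrite csize_bar.
rewrite big_mkcond; apply: eq_sum_cuts => t _ szt.
transitivity (\sum_(b1 <- parts (cfst t)) if (0 < csize (cfst t))%N then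
    \sum_(b2 <- parts (csnd t))
     \sum_(b' <- parts (bar F b2))
     ev T (ccat pre (ccons (mhel G (bar F b1)) (bar G b'))) e else 0); last first.
  apply: eq_sum_parts => b1 _ ->; case: ifP => // _; by rewrite big1.
case: posnP => [_|szt0]; first by rewrite big1.
have szt1 : (csize (csnd t) < n)%N.
  by move: szc; rewrite -szt ltnS; apply: leq_trans; rewrite -addn1 addnC leq_add2r.
transitivity (\sum_(b1 <- parts (cfst t)) \sum_(b2 <- parts (csnd t))
   ev T (ccat pre (ccons (mhel G (bar F b1)) (bar mcomp b2))) e).
  rewrite exchange_big; apply: eq_bigr => b2 _ /=.
  rewrite bar_cons mhel_comp ev_sum; apply: eq_sum_parts => b1 deg1 _.
  by rewrite -(@mhelE _ _ _ _ _ _ _ _ _ _ (rdeg (cfst t) + 1)) // rdeg_bar deg1.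
apply: eq_bigr => b1 _.
have := IHn _ _ (csnd t) _ (ccat pre (cone (mhel G (bar F b1)))) e szt1.
under eq_bigr do rewrite ccatA /=.
move->; apply: eq_bigr => b2 _; apply: eq_bigr => b' _.
by rewrite ccatA.
Qed.

End Composition.

Lemma sum_cuts5 (O : Type) (E : O -> O -> Type) (V : nmodType) x y
    (c : chain E x y)
    (psi : forall u1 u2 u3 u4, chain E x u1 -> chain E u1 u2 -> chain E u2 u3 ->
       chain E u3 u4 -> chain E u4 y -> V) :
  \sum_(t <- cuts c) \sum_(s <- cuts (csnd t)) \sum_(t' <- cuts (cfst s))
    \sum_(s' <- cuts (csnd t'))
      psi _ _ _ _ (cfst t) (cfst t') (cfst s') (csnd s') (csnd s) =
  \sum_(t <- cuts c) \sum_(s <- cuts (csnd t)) \sum_(t' <- cuts (cfst t))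
    \sum_(s' <- cuts (csnd s))
      psi _ _ _ _ (cfst t') (csnd t') (cfst s) (cfst s') (csnd s').
Proof.
under [RHS]eq_bigr do rewrite exchange_big.
rewrite -(sum_cuts_coassoc c (fun u v a b d => \sum_(s <- cuts d)
  \sum_(s' <- cuts (csnd s)) psi _ _ _ _ a b (cfst s) (cfst s') (csnd s'))).
apply: eq_bigr => t _.
rewrite -(sum_cuts_coassoc (csnd t) (fun u v a b d => \sum_(s' <- cuts b)
  psi _ _ _ _ (cfst t) a (cfst s') (csnd s') d)).
apply: eq_bigr => s _.
by rewrite -(sum_cuts_coassoc (csnd s) (fun u v a b d =>
  psi _ _ _ _ (cfst t) (cfst s) a b d)).
Qed.

Section FunctorComposition.
Variables (R : comPzRingType) (A B C : ainf_cat R).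
Variables (G : ainf_functor B C) (F : ainf_functor A B).

Lemma aop_size0 (D : ainf_cat R) (x y : D) (c : hchain x y) e : csize c = 0%N -> ev (aop D) c e = 0.
Proof. by case: c => // z _; rewrite aop_nil. Qed.

Fact fcomp_nil (x : A) e : ev (mcomp (fmap F) (fmap G)) (cnil x) e = 0.
Proof. by rewrite /= sum_parts0 fmap_nil. Qed.

Fact fcomp_rel (x y : A) (c : hchain x y) e :
  \sum_(b <- parts c) ev (aop C) (bar (mcomp (fmap F) (fmap G)) b) e =
  insert (mcomp (fmap F) (fmap G)) (aop A) c e.
Proof.
rewrite (sum_parts_comp (fmap F) (fmap G) (aop C) c (cnil _)) /=.
under eq_bigr do rewrite fmap_rel /insert sum_cuts_map /=.
rewrite (sum_parts_cuts c (fun t => \sum_(s <- cuts (bar (fmap F) (csnd t)) |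
   (0 < csize (cfst s))%N) sgn (rdeg (bar (fmap F) (cfst t))) *:
   ev (fmap G) (ccat (bar (fmap F) (cfst t))
      (ccons (mhel (aop B) (cfst s)) (csnd s))) e)) /=.
transitivity (\sum_(t <- cuts c) \sum_(s <- cuts (csnd t))
  \sum_(t' <- cuts (cfst s)) \sum_(s' <- cuts (csnd t'))
  if (0 < csize (cfst s'))%N then
  (sgn (rdeg (cfst t)) * sgn (rdeg (cfst t'))) *:
  (\sum_(b1 <- parts (cfst t)) \sum_(b3 <- parts (csnd s))
   ev (fmap G) (ccat (bar (fmap F) b1) (ccons
     (mhel (fmap F) (ccat (cfst t') (ccons (mhel (aop A) (cfst s')) (csnd s'))))
     (bar (fmap F) b3))) e) else 0).
  apply: eq_bigr => t _.
  transitivity (\sum_(s <- cuts (csnd t)) \sum_(b1 <- parts (cfst t))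
    \sum_(b3 <- parts (csnd s)) sgn (rdeg (cfst t)) *:
    ev (fmap G) (ccat (bar (fmap F) b1)
      (ccons (hel (insert (fmap F) (aop A) (cfst s) (rdeg (cfst s) + 2)))
        (bar (fmap F) b3))) e).
    rewrite [RHS]exchange_big; apply: eq_sum_parts => b1 deg1 _ /=.
    under eq_bigr do rewrite big_mkcond sum_cuts_map /=.
    rewrite (sum_parts_cuts (csnd t) (fun s => if (0 < csize (bar (fmap F) (cfst s)))%N then
      sgn (rdeg (bar (fmap F) b1)) *: ev (fmap G) (ccat (bar (fmap F) b1)
      (ccons (mhel (aop B) (bar (fmap F) (cfst s))) (bar (fmap F) (csnd s)))) e else 0)) /=.
    apply: eq_bigr => s _; rewrite exchange_big; apply: eq_bigr => b3 _ /=.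
    rewrite -fmap_rel ev_sum scaler_sumr; apply: eq_sum_parts => b2 deg2 sz2.
    rewrite csize_bar rdeg_bar deg1 -(@mhelE _ _ _ _ _ _ _ _ _ _ (rdeg (cfst s) + 2)).
      by case: posnP => // sz0; rewrite aop_size0 ?csize_bar // ev0 scaler0.
    by rewrite rdeg_bar deg2.
  apply: eq_bigr => s _.
  transitivity (\sum_(b1 <- parts (cfst t)) \sum_(b3 <- parts (csnd s))
    \sum_(t' <- cuts (cfst s)) \sum_(s' <- cuts (csnd t'))
    if (0 < csize (cfst s'))%N then
    (sgn (rdeg (cfst t)) * sgn (rdeg (cfst t'))) *:
    ev (fmap G) (ccat (bar (fmap F) b1) (ccons
     (mhel (fmap F) (ccat (cfst t') (ccons (mhel (aop A) (cfst s')) (csnd s'))))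
     (bar (fmap F) b3))) e else 0).
    apply: eq_bigr => b1 _; apply: eq_bigr => b3 _.
    rewrite ev_sum scaler_sumr; apply: eq_sum_cuts => t' degt _.
    rewrite ev_sum scaler_sumr big_mkcond; apply: eq_sum_cuts => s' degs _.
    case: ifP => // _; rewrite evZ scalerA -(@mhelE _ _ _ _ _ _ (fmap F) _ _ _ (rdeg (cfst s) + 2)) //.
    rewrite rdeg_cat /= -degt -degs; lia.
  under eq_bigr do rewrite exchange_big.
  rewrite exchange_big; apply: eq_bigr => t' _ /=.
  under eq_bigr do rewrite exchange_big.
  rewrite exchange_big; apply: eq_bigr => s' _ /=.
  case: ifP => _; last by rewrite big1 // => b1 _; rewrite big1.
  by rewrite scaler_sumr; apply: eq_bigr => b1 _; rewrite scaler_sumr.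
rewrite (sum_cuts5 c (fun u1 u2 u3 u4 a1 a2 a3 a4 a5 =>
  if (0 < csize a3)%N then (sgn (rdeg a1) * sgn (rdeg a2)) *:
  (\sum_(b1 <- parts a1) \sum_(b3 <- parts a5)
   ev (fmap G) (ccat (bar (fmap F) b1) (ccons
     (mhel (fmap F) (ccat a2 (ccons (mhel (aop A) a3) a4)))
     (bar (fmap F) b3))) e) else 0)).
apply: eq_bigr => t _; rewrite [RHS]big_mkcond; apply: eq_bigr => s _.
case: ifP => _; last by rewrite big1 // => t' _; rewrite big1.
rewrite mcompE sum_parts_cat1 scaler_sumr; apply: eq_sum_cuts => t' degt _.
under [X in _ = _ *: X]eq_bigr do under eq_bigr do under eq_bigr do rewrite bar_cat bar_cons.
rewrite [in RHS]exchange_big /= scaler_sumr; apply: eq_bigr => s' _.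
by rewrite -sgnD degt.
Qed.

Definition fcomp : ainf_functor A C := AInfFunctor fcomp_nil fcomp_rel.

End FunctorComposition.

Lemma multimap_eq (R : comPzRingType) (A B : quiver R) (p q : A -> B) g
    (T T' : multimap p q g) :
  (forall x y (c : hchain x y) e, ev T c e = ev T' c e) -> T = T'.
Proof.
case: T T' => [T lT dT] [T' lT' dT'] /= eqT.
have {}eqT : T = T'.
  by apply: functional_extensionality_dep => x; apply: functional_extensionality_dep => y;
     apply: functional_extensionality_dep => c; apply: functional_extensionality_dep => e.
case: _ / eqT in lT' dT' *.
by rewrite (Prop_irrelevance lT lT') (Prop_irrelevance dT dT').
Qed.

Lemma ainf_functor_eq (R : comPzRingType) (A B : ainf_cat R) (p : A -> B)
    (T T' : multimap p p 1) nT nT' rT rT' :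
  (forall x y (c : hchain x y) e, ev T c e = ev T' c e) ->
  @AInfFunctor R A B p T nT rT = @AInfFunctor R A B p T' nT' rT'.
Proof.
move=> /multimap_eq eqT; case: _ / eqT in nT' rT' *.
by rewrite (Prop_irrelevance nT nT') (Prop_irrelevance rT rT').
Qed.

Lemma sum_cuts_first (O : Type) (E : O -> O -> Type) (V : nmodType) x y
    (c : chain E x y) (psi : cut E x y -> V) :
  (forall t, (0 < csize (cfst t))%N -> psi t = 0) ->
  \sum_(t <- cuts c) psi t = psi (Cut (cnil x) c).
Proof.
case: c psi => [{}x|{}x y' z f c] psi psi0; first exact: big_seq1.
by rewrite sum_cuts_cons big1 ?addr0 // => t _; rewrite psi0.
Qed.

Lemma sum_cuts_last (O : Type) (E : O -> O -> Type) (V : nmodType) x y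
    (c : chain E x y) (psi : cut E x y -> V) :
  (forall t, (0 < csize (csnd t))%N -> psi t = 0) ->
  \sum_(t <- cuts c) psi t = psi (Cut c (cnil y)).
Proof.
elim: c psi => [{}x|{}x y' z f c IHc] psi psi0; first exact: big_seq1.
by rewrite sum_cuts_cons psi0 // add0r IHc // => t szt; rewrite psi0.
Qed.

Definition hpart (R : comPzRingType) (A : quiver R) (x y : A) (f : helt x y)
  (e : int) : A x y e := untag 0 (fun g : A x y e => g) f.

Lemma hpart_hel (R : comPzRingType) (A : quiver R) (x y : A) d (f : A x y d) :
  hpart (hel f) d = f.
Proof. by rewrite /hpart (untagE _ _ (erefl : tag (hel f) = d)). Qed.

Lemma hpart_neq (R : comPzRingType) (A : quiver R) (x y : A) (f : helt x y) e :
  tag f != e -> hpart f e = 0.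
Proof. by move=> ne; rewrite /hpart untag_dflt. Qed.

Lemma hel_hpart (R : comPzRingType) (A : quiver R) (x y : A) (f : helt x y) e :
  tag f = e -> hel (hpart f e) = f.
Proof. by case: f => d f /= <-; rewrite hpart_hel. Qed.

Section Identity.
Variables (R : comPzRingType).

(* The identity functor: f |-> f on sequences of length 1, 0 on the others. *)
Definition idval (A : quiver R) (x y : A) (c : hchain x y) (e : int) :
    A x y e :=
  match c in chain _ x y return A x y e with
  | cnil _ => 0
  | ccons x y z f c' =>
      match c' in chain _ y z return helt x y -> A x z e with
      | cnil _ => fun f => hpart f e
      | ccons _ _ _ _ _ => fun _ => 0
      end f
  end.

Lemma idval1 (A : quiver R) x y (c : @hchain R A x y) e :
  csize c <> 1%N -> idval c e = 0.
Proof. by case: c => // {}x y' z f c; case: c f => [{}y'|y0 y1 y2 g c] f. Qed.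

Lemma idval_cone (A : quiver R) x y (f : @helt R A x y) e :
  idval (cone f) e = hpart f e.
Proof. by []. Qed.

Fact idval_lin (A : quiver R) w x y z (c : @hchain R A w x) d a (f f' : A x y d)
    (c' : hchain y z) e :
  idval (ccat c (ccons (hel (a *: f + f')) c')) e =
  a *: idval (ccat c (ccons (hel f) c')) e + idval (ccat c (ccons (hel f') c')) e.
Proof.
case: c f f' => [{}x|{}w w' {}x g c] f f'; last first.
  by rewrite !idval1 ?scaler0 ?addr0 //= csize_cat /= addnS.
case: c' f f' => [{}y|{}y y' {}z h c'] f f'; last first.
  by rewrite !idval1 ?scaler0 ?addr0.
rewrite /=; have [->|ne] := eqVneq e d; first by rewrite !hpart_hel.
by rewrite !hpart_neq 1?eq_sym // scaler0 addr0.
Qed.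

Fact idval_deg (A : quiver R) x y (c : @hchain R A x y) e :
  e != rdeg c + 1 -> idval c e = 0.
Proof.
case: c => // {}x y' z f c; case: c f => [{}y'|y0 y1 y2 g c] f //=.
by rewrite addr0 subrK eq_sym => ne; rewrite hpart_neq.
Qed.

Arguments idval : simpl never.

Definition mid (A : quiver R) : @multimap R A A id id 1 :=
  Multimap (@idval_lin A) (@idval_deg A).

Lemma mhel_id (A : quiver R) x y (f : @helt R A x y) :
  mhel (mid A) (cone f) = f.
Proof. by rewrite /mhel /= idval_cone hel_hpart // addr0 subrK. Qed.

Lemma mhel_id0 (A : quiver R) x y (c : @hchain R A x y) :
  csize c <> 1%N -> mhel (mid A) c = hel (0 : A x y (rdeg c + 1)).
Proof. by move=> szc; rewrite /mhel /= idval1. Qed.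

Lemma sum_parts_id (A B : quiver R) (p q : A -> B) g (T : multimap p q g) w x y
    (pre : hchain w x) (c : hchain x y) e :
  \sum_(b <- parts c) ev T (ccat pre (bar (mid A) b)) e = ev T (ccat pre c) e.
Proof.
elim: c pre => [{}x|{}x y' z f c IHc] pre; first by rewrite sum_parts0.
rewrite sum_parts_first // big_mkcond sum_cuts_cons /= add0r.
rewrite sum_cuts_first => [|t szt] /=.
  have -> : ccat pre (ccons f c) = ccat (ccat pre (cone f)) c by rewrite ccatA.
  rewrite -IHc; apply: eq_bigr => b _.
  by rewrite -/(cone f) bar_cons mhel_id ccatA.
rewrite big1 // => b _; rewrite bar_cons mhel_id0 ?ev0 //=.
by case: (csize _) szt.
Qed.

Fact fid_nil (A : ainf_cat R) (x : A) e : ev (mid A) (cnil x) e = 0.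
Proof. by []. Qed.

Fact fid_rel (A : ainf_cat R) (x y : A) (c : hchain x y) e :
  \sum_(b <- parts c) ev (aop A) (bar (mid A) b) e = insert (mid A) (aop A) c e.
Proof.
rewrite (sum_parts_id (aop A) (cnil x)) /insert sum_cuts_first => [|t szt] /=.
  rewrite big_mkcond sum_cuts_last /= => [|t szt] /=.
    rewrite scale1r; case: posnP => [/aop_size0->//|szc].
    rewrite idval_cone /mhel; have [->|ne] := eqVneq e (rdeg c + 2); first by rewrite hpart_hel.
    by rewrite ev_deg // hpart_neq // eq_sym.
  case: ifP => // _; rewrite idval1 ?scaler0 //=; by case: (csize _) szt.
rewrite big1 // => s _; rewrite idval1 ?scaler0 // csize_cat /= addnS => -[].
by case: (csize _) szt.
Qed.

Definition fid (A : ainf_cat R) : ainf_functor A A :=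
  AInfFunctor (@fid_nil A) (@fid_rel A).

Lemma fcompf1 (A B : ainf_cat R) (F : ainf_functor A B) : fcomp F (fid A) = F.
Proof.
case: F => p T nT rT; apply: ainf_functor_eq => x y c e.
by rewrite mcompE; apply: (sum_parts_id T (cnil x)).
Qed.

Lemma fcomp1f (A B : ainf_cat R) (F : ainf_functor A B) : fcomp (fid B) F = F.
Proof.
case: F => p T nT rT; apply: ainf_functor_eq => x y c e.
rewrite mcompE; case: (posnP (csize c)) => [c0|szc].
  by case: c c0 => // z _; rewrite sum_parts0 nT.
rewrite sum_parts_first // big_mkcond sum_cuts_last /= => [|t szt].
  rewrite szc big_seq1 /= idval_cone /mhel.
  have [->|ne] := eqVneq e (rdeg c + 1); first by rewrite hpart_hel.
  have ne' : rdeg c + 1 != e by rewrite eq_sym.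
  by rewrite hpart_neq // ev_deg.
case: ifP => // _; transitivity (\sum_(b <- parts (csnd t)) (0 : B (p x) (p y) e)).
  apply: eq_sum_parts => b _; rewrite szt => szb.
  by rewrite idval1 //= csize_bar; case: (csize _) szb.
by rewrite big1_eq.
Qed.

Lemma fcompA (A B C D : ainf_cat R) (H : ainf_functor C D)
    (G : ainf_functor B C) (F : ainf_functor A B) :
  fcomp (fcomp H G) F = fcomp H (fcomp G F).
Proof.
apply: ainf_functor_eq => x y c e.
exact: (esym (sum_parts_comp (fmap F) (fmap G) (fmap H) c (cnil _) e)).
Qed.

End Identity.

Section Cohomology.
Variables (R : comPzRingType) (A : ainf_cat R).

Definition closed (x y : A) (d : int) (f : A x y d) : Prop :=
  ev (aop A) (cone (hel f)) (d + 1) = 0.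

Definition exact (x y : A) (d : int) (f : A x y d) : Prop :=
  exists h : A x y (d - 1), f = ev (aop A) (cone (hel h)) d.

(* Equality of the classes [f] and [f'] in H(A), for closed f and f'. *)
Definition cohomologous (x y : A) (d : int) (f f' : A x y d) : Prop :=
  exact (f - f').

(* The component of degree [e] of a representative of [g][f]; it is nonzero
   only if e = deg f + deg g. *)
Definition hcomp (x y z : A) (d d' : int) (g : A y z d') (f : A x y d)
    (e : int) : A x z e :=
  sgn d *: ev (aop A) (ccons (hel f) (cone (hel g))) e.

(* [u] is the identity of [x] in H(A). *)
Definition is_cunit (x : A) (u : A x x 0) : Prop :=
  [/\ closed u,
      forall (y : A) (d : int) (f : A x y d),
        closed f -> cohomologous (hcomp f u d) f
    & forall (y : A) (d : int) (f : A y x d),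
        closed f -> cohomologous (hcomp u f d) f].

Definition cohomologically_unital : Prop :=
  forall x : A, exists u : A x x 0, is_cunit u.

(* Isomorphism in H^0(A). *)
Definition H0_iso (x y : A) : Prop :=
  exists (f : A x y 0) (g : A y x 0),
    [/\ closed f, closed g, is_cunit (hcomp g f 0) & is_cunit (hcomp f g 0)].

Lemma exact0 (x y : A) d : exact (0 : A x y d).
Proof. by exists 0; symmetry; apply: (ev0 (aop A) (cnil x) _ (cnil y)). Qed.

Lemma exactD (x y : A) d (f f' : A x y d) : exact f -> exact f' -> exact (f + f').
Proof.
by move=> [h ->] [h' ->]; exists (h + h'); symmetry; apply: (evD (aop A) (cnil x) _ _ (cnil y)).
Qed.

Lemma exactZ (x y : A) d a (f : A x y d) : exact f -> exact (a *: f).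
Proof. by move=> [h ->]; exists (a *: h); symmetry; apply: (evZ (aop A) (cnil x) _ _ (cnil y)). Qed.

Lemma exactN (x y : A) d (f : A x y d) : exact f -> exact (- f).
Proof. by move=> exf; rewrite -scaleN1r; apply: exactZ. Qed.

Lemma insert1 (B : quiver R) (p q : A -> B) g (T : multimap p q g) x y
    (f : helt x y) e :
  insert T (aop A) (cone f) e = ev T (cone (mhel (aop A) (cone f))) e.
Proof.
by rewrite /insert /= !(big_cons, big_nil) /= sgn0 scale1r !addr0.
Qed.

Lemma aop1_aop1 x y (f : @helt R A x y) e :
  ev (aop A) (cone (mhel (aop A) (cone f))) e = 0.
Proof. by rewrite -insert1 aop_rel. Qed.

Lemma aop2_rel x y z (f : @helt R A x y) (g : @helt R A y z) e :
  ev (aop A) (ccons (mhel (aop A) (cone f)) (cone g)) e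
  + ev (aop A) (cone (mhel (aop A) (ccons f (cone g)))) e
  + sgn (tag f - 1) *: ev (aop A) (ccons f (cone (mhel (aop A) (cone g)))) e = 0.
Proof.
rewrite -[RHS](aop_rel (ccons f (cone g)) e) /insert /=.
rewrite !(big_cons, big_nil) /= sgn0.
by rewrite !scale1r !addr0.
Qed.

End Cohomology.

Section CohomologicalUnits.
Variables (R : comPzRingType) (A : ainf_cat R).

Lemma cohomologous_refl (x y : A) d (f : A x y d) : cohomologous f f.
Proof. by rewrite /cohomologous subrr; apply: exact0. Qed.

Lemma cohomologous_sym (x y : A) d (f f' : A x y d) :
  cohomologous f f' -> cohomologous f' f.
Proof. by rewrite /cohomologous -[f' - f]opprB; apply: exactN. Qed.

Lemma cohomologous_trans (x y : A) d (f f' f'' : A x y d) :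
  cohomologous f f' -> cohomologous f' f'' -> cohomologous f f''.
Proof.
by rewrite /cohomologous => e e'; rewrite -(subrK f' f) -addrA; apply: exactD.
Qed.

Lemma exact_closed (x y : A) d (f : A x y d) : exact f -> closed f.
Proof.
move=> [h ->]; rewrite /closed (@mhelE _ _ _ _ _ _ (aop A)) ?aop1_aop1 //=; lia.
Qed.

Lemma hcompBl (x y z : A) d d' (g g' : A y z d') (f : A x y d) e :
  hcomp (g - g') f e = hcomp g f e - hcomp g' f e.
Proof.
rewrite /hcomp -scalerBr (evD (aop A) (cone (hel f)) _ _ (cnil z)) -scaleN1r.
by rewrite (evZ (aop A) (cone (hel f)) _ _ (cnil z)) scaleN1r.
Qed.

Lemma hcompBr (x y z : A) d d' (g : A y z d') (f f' : A x y d) e :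
  hcomp g (f - f') e = hcomp g f e - hcomp g f' e.
Proof.
rewrite /hcomp -scalerBr (evD (aop A) (cnil x) _ _ (cone (hel g))) -scaleN1r.
by rewrite (evZ (aop A) (cnil x) _ _ (cone (hel g))) scaleN1r.
Qed.

Lemma hcomp_exactr (x y z : A) d d' (g : A y z d') (f : A x y d) e :
  e = d + d' -> closed g -> exact f -> exact (hcomp g f e).
Proof.
move=> de clg [h ->]; apply: exactZ.
have := aop2_rel (hel h) (hel g) e.
rewrite /= -(@mhelE _ _ _ _ _ _ (aop A) _ _ (cone (hel h)) d); last by rewrite /=; lia.
rewrite -(@mhelE _ _ _ _ _ _ (aop A) _ _ (cone (hel g)) (d' + 1)); last by rewrite /=; lia.
rewrite clg (ev0 (aop A) (cone (hel h)) _ (cnil z)) scaler0 addr0.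
move/eqP; rewrite addr_eq0 => /eqP ->; apply: exactN.
rewrite -(@mhelE _ _ _ _ _ _ (aop A) _ _ _ (e - 1)); last by rewrite /=; lia.
by exists (ev (aop A) (ccons (hel h) (cone (hel g))) (e - 1)).
Qed.

Lemma hcomp_exactl (x y z : A) d d' (g : A y z d') (f : A x y d) e :
  e = d + d' -> closed f -> exact g -> exact (hcomp g f e).
Proof.
move=> de clf [h ->]; apply: exactZ.
have := aop2_rel (hel f) (hel h) e.
rewrite /= -(@mhelE _ _ _ _ _ _ (aop A) _ _ (cone (hel f)) (d + 1)); last by rewrite /=; lia.
rewrite -(@mhelE _ _ _ _ _ _ (aop A) _ _ (cone (hel h)) d'); last by rewrite /=; lia.
rewrite clf (ev0 (aop A) (cnil x) _ (cone (hel h))) add0r.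
rewrite -(@mhelE _ _ _ _ _ _ (aop A) _ _ _ (e - 1)); last by rewrite /=; lia.
set m1 := ev _ (cone _) e; set m2 := ev _ _ e => E.
have -> : m2 = - (sgn (d - 1) *: m1).
  have sq : sgn (d - 1) * sgn (d - 1) = 1 :> R.
    by rewrite /sgn -expr2 -exprM mulnC exprM sqrrN expr1n expr1n.
  have {}E : m1 = - (sgn (d - 1) *: m2) by apply/eqP; rewrite -addr_eq0 E.
  by rewrite E scalerN opprK scalerA sq scale1r.
apply: exactN; apply: exactZ.
by exists (ev (aop A) (ccons (hel f) (cone (hel h))) (e - 1)).
Qed.

Lemma is_cunit_cohomologous (x : A) (u v : A x x 0) :
  cohomologous v u -> is_cunit u -> is_cunit v.
Proof.
move=> uv [clu ul ur]; split=> [|y d f clf|y d f clf].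
- rewrite -(subrK u v) /closed (evD (aop A) (cnil x) _ _ (cnil x)).
  have := exact_closed uv; move: clu; rewrite /closed /= => E E'.
  by rewrite [LHS](congr2 +%R E' E) addr0.
- apply: (cohomologous_trans _ (ul _ _ _ clf)).
  by rewrite /cohomologous -hcompBr; apply: hcomp_exactr => //; rewrite add0r.
- apply: (cohomologous_trans _ (ur _ _ _ clf)).
  by rewrite /cohomologous -hcompBl; apply: hcomp_exactl => //; rewrite addr0.
Qed.

Lemma is_cunit_unique (x : A) (u v : A x x 0) :
  is_cunit u -> is_cunit v -> cohomologous u v.
Proof.
move=> [clu ul ur] [clv vl vr].
exact: cohomologous_trans (cohomologous_sym (vl _ _ _ clu)) (ur _ _ _ clv).
Qed.

End CohomologicalUnits.

Definition fmap1 (R : comPzRingType) (A B : ainf_cat R) (F : ainf_functor A B)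
    (x y : A) (d : int) (f : A x y d) : B (fob F x) (fob F y) d :=
  ev (fmap F) (cone (hel f)) d.

Definition cu_functor (R : comPzRingType) (A B : ainf_cat R)
    (F : ainf_functor A B) : Prop :=
  forall (x : A) (u : A x x 0), is_cunit u -> is_cunit (fmap1 F u).

(* F^1 : Hom(x, y) -> Hom(F x, F y) is bijective on cohomology classes. *)
Definition quasi_iso (R : comPzRingType) (A B : ainf_cat R)
    (F : ainf_functor A B) (x y : A) : Prop :=
  forall d : int,
    (forall f f' : A x y d, closed f -> closed f' ->
       cohomologous (fmap1 F f) (fmap1 F f') -> cohomologous f f') /\
    (forall g : B (fob F x) (fob F y) d, closed g ->
       exists2 f : A x y d, closed f & cohomologous (fmap1 F f) g).

Definition quasi_equivalence (R : comPzRingType) (A B : ainf_cat R)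
    (F : ainf_functor A B) : Prop :=
  (forall x y : A, quasi_iso F x y) /\
  (forall y : B, exists x : A, H0_iso (fob F x) y).

(* Strictly unital A-infinity categories; units are unique when they exist. *)
Record su_cat (R : comPzRingType) := SUCat {
  sucat :> ainf_cat R;
  one : forall x : sucat, sucat x x 0;
  one_closed : forall x : sucat, closed (one x);
  one_r : forall (x y : sucat) (d : int) (f : sucat x y d),
    ev (aop sucat) (ccons (hel (one x)) (cone (hel f))) d = f;
  one_l : forall (x y : sucat) (d : int) (f : sucat x y d),
    sgn d *: ev (aop sucat) (ccons (hel f) (cone (hel (one y)))) d = f;
  one_n : forall (w x y : sucat) (a : hchain w x) (b : hchain x y) (e : int),
    (2 <= csize a + csize b)%N ->
    ev (aop sucat) (ccat a (ccons (hel (one x)) b)) e = 0 }.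
Arguments one {R s} x.

Definition su_functor (R : comPzRingType) (A B : su_cat R)
    (F : ainf_functor A B) : Prop :=
  (forall x : A, fmap1 F (one x) = one (fob F x)) /\
  (forall (w x y : A) (a : hchain w x) (b : hchain x y) (e : int),
     (1 <= csize a + csize b)%N ->
     ev (fmap F) (ccat a (ccons (hel (one x)) b)) e = 0).

Section Functoriality.
Variable R : comPzRingType.

Lemma fmap1_exact (A B : ainf_cat R) (F : ainf_functor A B) (x y : A) d
    (f : A x y d) : exact f -> exact (fmap1 F f).
Proof.
move=> [h ->]; have := fmap_rel F (cone (hel h)) d.
rewrite insert1 /= !big_seq1 /= => E; exists (fmap1 F h).
rewrite /fmap1 (@mhelE _ _ _ _ _ _ (aop A)) /=; last by lia.
rewrite (@mhelE _ _ _ _ _ _ (fmap F)) /=; last by lia.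
exact: esym E.
Qed.

Lemma fmap1B (A B : ainf_cat R) (F : ainf_functor A B) (x y : A) d
    (f f' : A x y d) : fmap1 F (f - f') = fmap1 F f - fmap1 F f'.
Proof.
rewrite /fmap1 (evD (fmap F) (cnil x) _ _ (cnil y)) -scaleN1r.
by rewrite (evZ (fmap F) (cnil x) _ _ (cnil y)) scaleN1r.
Qed.

Lemma fmap1_comp (A B C : ainf_cat R) (G : ainf_functor B C)
    (F : ainf_functor A B) (x y : A) d (f : A x y d) :
  fmap1 (fcomp G F) f = fmap1 G (fmap1 F f).
Proof.
rewrite /fmap1 mcompE /= !big_seq1 bar_cons.
by rewrite -(@mhelE _ _ _ _ _ _ (fmap F) _ _ _ d) //=; lia.
Qed.

Lemma fmap1_id (A : ainf_cat R) (x y : A) d (f : A x y d) : fmap1 (fid A) f = f.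
Proof. exact: hpart_hel. Qed.

Lemma cu_id (A : ainf_cat R) : cu_functor (fid A).
Proof. by move=> x u; rewrite fmap1_id. Qed.

Lemma cu_comp (A B C : ainf_cat R) (G : ainf_functor B C)
    (F : ainf_functor A B) : cu_functor G -> cu_functor F -> cu_functor (fcomp G F).
Proof. by move=> cuG cuF x u cu; rewrite fmap1_comp; apply/cuG/cuF. Qed.

Lemma one_cunit (A : su_cat R) (x : A) : is_cunit (one x).
Proof.
split=> [|y d f _|y d f _]; first exact: one_closed.
- by rewrite /hcomp sgn0 scale1r one_r; apply: cohomologous_refl.
- by rewrite /hcomp one_l; apply: cohomologous_refl.
Qed.

Lemma su_cu (A : su_cat R) : cohomologically_unital A.
Proof. by move=> x; exists (one x); apply: one_cunit. Qed.

Lemma su_functor_cu (A B : su_cat R) (F : ainf_functor A B) :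
  su_functor F -> cu_functor F.
Proof.
move=> [F1 _] x u cu; apply: (is_cunit_cohomologous _ (one_cunit _)).
rewrite /cohomologous -F1 -fmap1B; apply: fmap1_exact.
exact: is_cunit_unique cu (one_cunit x).
Qed.

Lemma su_id (A : su_cat R) : su_functor (fid A).
Proof.
split=> [x|w x y a b e sz]; first exact: fmap1_id.
by rewrite [LHS]idval1 // csize_cat /= addnS => -[]; case: (_ + _)%N sz.
Qed.

Lemma su_comp (A B C : su_cat R) (G : ainf_functor B C)
    (F : ainf_functor A B) : su_functor G -> su_functor F -> su_functor (fcomp G F).
Proof.
move=> [G1 Gn] [F1 Fn]; split=> [x|w x y a b e sz].
  by rewrite fmap1_comp F1 G1.
rewrite mcompE sum_parts_cat1; apply: sum_cuts_eq0 => -[u a1 a2] _ /= sza.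
apply: sum_parts_eq0 => p _ szp; apply: sum_cuts_eq0 => -[v b1 b2] _ /= szb.
apply: sum_parts_eq0 => p' _ szp'; rewrite bar_cat bar_cons.
case: (posnP (csize a2 + csize b1)) => [/eqP|sz1]; last first.
  by rewrite /mhel Fn // ev0.
rewrite addn_eq0 => /andP[/eqP a20 /eqP b10].
have sz' : (1 <= csize (bar (fmap F) p) + csize (bar (fmap F) p'))%N.
  move: sz; rewrite -sza -szb a20 b10 addn0 add0n !csize_bar !addn_gt0 szp szp'.
  by [].
move: p p' sz' {sza szb szp szp' sz} => p p' sz'; clear a b a1 b2.
case: a2 a20 b1 b10 p sz' => // {}x _ b1 b10 p sz'.
case: b1 b10 p' p sz' => // {}x _ p' p sz'.
rewrite /= -(@mhelE _ _ _ _ _ _ (fmap F) _ _ _ 0) // [ev (fmap F) _ _]F1.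
exact: Gn.
Qed.

End Functoriality.

Lemma sval_eq (T : Type) (P : T -> Prop) (u v : {x : T | P x}) :
  sval u = sval v -> u = v.
Proof.
case: u v => [x Px] [y Py] /= E; case: _ / E in Py *.
by rewrite (Prop_irrelevance Px Py).
Qed.

Record category := Category {
  cob :> Type;
  chom : cob -> cob -> Type;
  cidm : forall a : cob, chom a a;
  ccomp : forall a b c : cob, chom b c -> chom a b -> chom a c;
  ccomp1f : forall (a b : cob) (f : chom a b), ccomp (cidm b) f = f;
  ccompf1 : forall (a b : cob) (f : chom a b), ccomp f (cidm a) = f;
  ccompA : forall (a b c d : cob) (h : chom c d) (g : chom b c) (f : chom a b),
    ccomp (ccomp h g) f = ccomp h (ccomp g f) }.
Coercion chom : category >-> Funclass.

Record functor (C D : category) := Functor {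
  fobj :> C -> D;
  farr : forall a b : C, C a b -> D (fobj a) (fobj b);
  farr_id : forall a : C, farr (cidm a) = cidm (fobj a);
  farr_comp : forall (a b c : C) (g : C b c) (f : C a b),
    farr (ccomp g f) = ccomp (farr g) (farr f) }.

Definition isomorphic (C : category) (a b : C) : Prop :=
  exists (f : C a b) (g : C b a), ccomp g f = cidm a /\ ccomp f g = cidm b.

Record equivalence (C D : category) (I : functor C D) : Prop := Equivalence {
  eq_faithful : forall (a b : C) (f g : C a b), farr I f = farr I g -> f = g;
  eq_full : forall (a b : C) (g : D (I a) (I b)), exists f : C a b, farr I f = g;
  eq_surj : forall d : D, exists c : C, isomorphic (I c) d }.

(* The localization C[W^-1]: morphisms are words in the morphisms of C and the
   formal inverses of the morphisms of W, modulo the congruence generated by the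
   composition of C and the inverse laws. *)
Section Localization.
Variables (C : category) (W : forall a b : C, C a b -> Prop).

Inductive zigzag : C -> C -> Type :=
| zarr a b (f : C a b) : zigzag a b
| zinv a b (w : C a b) : W w -> zigzag b a
| zcomp a b c (v : zigzag b c) (u : zigzag a b) : zigzag a c.

Inductive zeq : forall a b : C, zigzag a b -> zigzag a b -> Prop :=
| zrefl a b (u : zigzag a b) : zeq u u
| zsym a b (u v : zigzag a b) : zeq u v -> zeq v u
| ztrans a b (u v w : zigzag a b) : zeq u v -> zeq v w -> zeq u w
| zcongr a b c (v v' : zigzag b c) (u u' : zigzag a b) :
    zeq v v' -> zeq u u' -> zeq (zcomp v u) (zcomp v' u')
| zassoc a b c d (w : zigzag c d) (v : zigzag b c) (u : zigzag a b) :
    zeq (zcomp (zcomp w v) u) (zcomp w (zcomp v u))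
| zunitl a b (u : zigzag a b) : zeq (zcomp (zarr (cidm b)) u) u
| zunitr a b (u : zigzag a b) : zeq (zcomp u (zarr (cidm a))) u
| zfunct a b c (g : C b c) (f : C a b) :
    zeq (zcomp (zarr g) (zarr f)) (zarr (ccomp g f))
| zinvl a b (w : C a b) (Ww : W w) :
    zeq (zcomp (zinv Ww) (zarr w)) (zarr (cidm a))
| zinvr a b (w : C a b) (Ww : W w) :
    zeq (zcomp (zarr w) (zinv Ww)) (zarr (cidm b)).

(* Equivalence classes for [zeq]. *)
Definition lochom (a b : C) : Type :=
  {P : zigzag a b -> Prop | exists u : zigzag a b, P = zeq u}.

Definition loccls a b (u : zigzag a b) : lochom a b :=
  exist _ (zeq u) (ex_intro _ u erefl).

Definition locrep a b (f : lochom a b) : zigzag a b := projT1 (boolp.cid (proj2_sig f)).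

Lemma loccls_eq a b (u v : zigzag a b) : loccls u = loccls v <-> zeq u v.
Proof.
split=> [/(congr1 (@proj1_sig _ _)) /= -> | uv]; first exact: zrefl.
apply: sval_eq => /=; apply: functional_extensionality_dep => w.
by apply/propext; split; apply: ztrans => //; apply: zsym.
Qed.

Lemma locrepK a b (f : lochom a b) : loccls (locrep f) = f.
Proof.
rewrite /locrep; case: boolp.cid => u /= uE; apply: sval_eq => /=.
by rewrite uE.
Qed.

Lemma zeq_rep a b (u : zigzag a b) : zeq (locrep (loccls u)) u.
Proof. by apply/loccls_eq; rewrite locrepK. Qed.

Definition loccomp a b c (g : lochom b c) (f : lochom a b) : lochom a c :=
  loccls (zcomp (locrep g) (locrep f)).

Lemma loccompE a b c (v : zigzag b c) (u : zigzag a b) :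
  loccomp (loccls v) (loccls u) = loccls (zcomp v u).
Proof. by apply/loccls_eq; apply: zcongr; apply: zeq_rep. Qed.

Lemma loc1f a b (f : lochom a b) : loccomp (loccls (zarr (cidm b))) f = f.
Proof. by rewrite -(locrepK f) loccompE; apply/loccls_eq/zunitl. Qed.

Lemma locf1 a b (f : lochom a b) : loccomp f (loccls (zarr (cidm a))) = f.
Proof. by rewrite -(locrepK f) loccompE; apply/loccls_eq/zunitr. Qed.

Lemma locA a b c d (h : lochom c d) (g : lochom b c) (f : lochom a b) :
  loccomp (loccomp h g) f = loccomp h (loccomp g f).
Proof.
rewrite -(locrepK f) -(locrepK g) -(locrepK h) !loccompE.
exact/loccls_eq/zassoc.
Qed.

Definition localization : category :=
  @Category C lochom (fun a => loccls (zarr (cidm a))) loccomp loc1f locf1 locA.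

Lemma loc_functor_comp a b c (g : C b c) (f : C a b) :
  loccls (zarr (ccomp g f)) = loccomp (loccls (zarr g)) (loccls (zarr f)).
Proof. by rewrite loccompE; apply/loccls_eq/zsym/zfunct. Qed.

Definition loc_functor : functor C localization :=
  @Functor C localization id (fun a b f => loccls (zarr f)) (fun=> erefl)
    loc_functor_comp.

End Localization.

(* The functor C[W^-1] -> D[W'^-1] induced by a functor mapping W into W'. *)
Section LocalizationMap.
Variables (C D : category) (W : forall a b : C, C a b -> Prop).
Variables (W' : forall a b : D, D a b -> Prop) (I : functor C D).
Hypothesis IW : forall (a b : C) (w : C a b), W w -> W' (farr I w).

Fixpoint zmap a b (u : zigzag W a b) : zigzag W' (I a) (I b) :=
  match u in zigzag _ a b return zigzag W' (I a) (I b) with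
  | zarr _ _ f => zarr W' (farr I f)
  | zinv _ _ w Ww => zinv (IW Ww)
  | zcomp _ _ _ v u => zcomp (zmap v) (zmap u)
  end.

Lemma zmap_eq a b (u v : zigzag W a b) : zeq u v -> zeq (zmap u) (zmap v).
Proof.
elim=> {a b u v} /=.
- by move=> a b u; apply: zrefl.
- by move=> a b u v _; apply: zsym.
- by move=> a b u v w _ uv _; apply: ztrans.
- by move=> a b c v v' u u' _ vv _; apply: zcongr.
- by move=> a b c d w v u; apply: zassoc.
- by move=> a b u; rewrite farr_id; apply: zunitl.
- by move=> a b u; rewrite farr_id; apply: zunitr.
- by move=> a b c g f; rewrite farr_comp; apply: zfunct.
- by move=> a b w Ww; rewrite farr_id; apply: zinvl.
- by move=> a b w Ww; rewrite farr_id; apply: zinvr.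
Qed.

Definition locmap a b (f : lochom W a b) : lochom W' (I a) (I b) :=
  loccls (zmap (locrep f)).

Lemma locmapE a b (u : zigzag W a b) : locmap (loccls u) = loccls (zmap u).
Proof. by apply/loccls_eq/zmap_eq/zeq_rep. Qed.

Lemma locmap_id a :
  locmap (loccls (zarr W (cidm a))) = loccls (zarr W' (cidm (I a))).
Proof. by rewrite locmapE /= farr_id. Qed.

Lemma locmap_comp a b c (g : lochom W b c) (f : lochom W a b) :
  locmap (loccomp g f) = loccomp (locmap g) (locmap f).
Proof. by rewrite -(locrepK f) -(locrepK g) loccompE !locmapE loccompE. Qed.

Definition loc_map : functor (localization W) (localization W') :=
  @Functor (localization W) (localization W') I locmap locmap_id locmap_comp.

End LocalizationMap.

Record cu_cat (R : comPzRingType) := CUCat {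
  cucat :> ainf_cat R;
  cucatP : cohomologically_unital cucat }.

Section CategoriesOfAInfCategories.
Variable R : comPzRingType.

Definition su_hom (A B : su_cat R) := {F : ainf_functor A B | su_functor F}.
Definition cu_hom (A B : cu_cat R) := {F : ainf_functor A B | cu_functor F}.

Definition su_hom_id (A : su_cat R) : su_hom A A := exist _ (fid A) (su_id A).
Definition su_hom_comp (A B C : su_cat R) (G : su_hom B C) (F : su_hom A B) :
    su_hom A C :=
  exist _ (fcomp (sval G) (sval F)) (su_comp (svalP G) (svalP F)).
Definition cu_hom_id (A : cu_cat R) : cu_hom A A := exist _ (fid A) (@cu_id R A).
Definition cu_hom_comp (A B C : cu_cat R) (G : cu_hom B C) (F : cu_hom A B) :
    cu_hom A C :=
  exist _ (fcomp (sval G) (sval F)) (cu_comp (svalP G) (svalP F)).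

Fact su_hom1f (A B : su_cat R) (F : su_hom A B) : su_hom_comp (su_hom_id B) F = F.
Proof. by apply: sval_eq; apply: fcomp1f. Qed.
Fact su_homf1 (A B : su_cat R) (F : su_hom A B) : su_hom_comp F (su_hom_id A) = F.
Proof. by apply: sval_eq; apply: fcompf1. Qed.
Fact su_homA (A B C D : su_cat R) (H : su_hom C D) (G : su_hom B C) (F : su_hom A B) :
  su_hom_comp (su_hom_comp H G) F = su_hom_comp H (su_hom_comp G F).
Proof. by apply: sval_eq; apply: fcompA. Qed.

Fact cu_hom1f (A B : cu_cat R) (F : cu_hom A B) : cu_hom_comp (cu_hom_id B) F = F.
Proof. by apply: sval_eq; apply: fcomp1f. Qed.
Fact cu_homf1 (A B : cu_cat R) (F : cu_hom A B) : cu_hom_comp F (cu_hom_id A) = F.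
Proof. by apply: sval_eq; apply: fcompf1. Qed.
Fact cu_homA (A B C D : cu_cat R) (H : cu_hom C D) (G : cu_hom B C) (F : cu_hom A B) :
  cu_hom_comp (cu_hom_comp H G) F = cu_hom_comp H (cu_hom_comp G F).
Proof. by apply: sval_eq; apply: fcompA. Qed.

Definition AInfCat_su : category := Category su_hom1f su_homf1 su_homA.
Definition AInfCat_cu : category := Category cu_hom1f cu_homf1 cu_homA.

Definition su_to_cu (A : su_cat R) : cu_cat R := CUCat (@su_cu R A).

Definition incl_arr (A B : su_cat R) (F : su_hom A B) : cu_hom (su_to_cu A) (su_to_cu B) :=
  exist _ (sval F) (su_functor_cu (svalP F)).

Fact incl_id (A : su_cat R) : incl_arr (su_hom_id A) = cu_hom_id (su_to_cu A).
Proof. exact: sval_eq. Qed.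

Fact incl_comp (A B C : su_cat R) (G : su_hom B C) (F : su_hom A B) :
  incl_arr (su_hom_comp G F) = cu_hom_comp (incl_arr G) (incl_arr F).
Proof. exact: sval_eq. Qed.

Definition AInfCat_incl : functor AInfCat_su AInfCat_cu :=
  @Functor AInfCat_su AInfCat_cu su_to_cu incl_arr incl_id incl_comp.

Definition qe_su (A B : AInfCat_su) (F : AInfCat_su A B) : Prop :=
  quasi_equivalence (sval F).
Definition qe_cu (A B : AInfCat_cu) (F : AInfCat_cu A B) : Prop :=
  quasi_equivalence (sval F).

Definition Ho_su : category := localization qe_su.
Definition Ho_cu : category := localization qe_cu.

Definition Ho_incl : functor Ho_su Ho_cu :=
  @loc_map _ _ qe_su qe_cu AInfCat_incl (fun _ _ _ qF => qF).

(* The class of a cohomologically unital functor between strictly unital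
   categories: in Ho_cu, and then in Ho_su as its unique preimage when the functor
   induced by the inclusion is an equivalence (see [Ho_su_classP]). *)
Definition Ho_cu_class (A B : su_cat R) (F : ainf_functor A B)
    (cuF : cu_functor F) : Ho_cu (su_to_cu A) (su_to_cu B) :=
  farr (loc_functor qe_cu) (exist _ F cuF : AInfCat_cu (su_to_cu A) (su_to_cu B)).

Definition Ho_su_class (E : equivalence Ho_incl) (A B : su_cat R)
    (F : ainf_functor A B) (cuF : cu_functor F) : Ho_su A B :=
  projT1 (boolp.cid (eq_full E (Ho_cu_class cuF))).

Lemma Ho_su_classP (E : equivalence Ho_incl) (A B : su_cat R)
    (F : ainf_functor A B) (cuF : cu_functor F) (f : Ho_su A B) :
  farr Ho_incl f = Ho_cu_class cuF <-> f = Ho_su_class E cuF.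
Proof.
rewrite /Ho_su_class; case: boolp.cid => f' /= f'E.
split=> [fE|->//]; apply: (eq_faithful E); exact: etrans fE (esym f'E).
Qed.

End CategoriesOfAInfCategories.

Section Prenatural.
Variables (R : comPzRingType) (A B : ainf_cat R).

(* The differential of T : F => G.  The sum over r, i and s_1, ..., s_r is
   written as a sum over the decompositions of [c] into a part cut into nonempty
   blocks for F, one possibly empty block for T, and a part cut into nonempty
   blocks for G. *)
Definition M1 (p q : A -> B) (F : multimap p p 1) (G : multimap q q 1) (g : int)
    (T : multimap p q g) (x y : A) (c : hchain x y) (e : int) : B (p x) (q y) e :=
  \sum_(t <- cuts c) \sum_(s <- cuts (csnd t))
    \sum_(b <- parts (cfst t)) \sum_(b' <- parts (csnd s))
      sgn ((g - 1) * rdeg (cfst t)) *: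
        ev (aop B) (ccat (bar F b) (ccons (mhel T (cfst s)) (bar G b'))) e
  - sgn (g - 1) *: insert T (aop A) c e.

(* The composition of T1 : F => G and T2 : G => K, as a sum over the
   decompositions of [c] into parts for F, T1, G, T2, K. *)
Definition M2 (p q r : A -> B) (F : multimap p p 1) (G : multimap q q 1)
    (K : multimap r r 1) (g1 g2 : int) (T2 : multimap q r g2)
    (T1 : multimap p q g1) (x y : A) (c : hchain x y) (e : int) :
    B (p x) (r y) e :=
  \sum_(t <- cuts c) \sum_(s1 <- cuts (csnd t)) \sum_(t' <- cuts (csnd s1))
    \sum_(s2 <- cuts (csnd t'))
    \sum_(b <- parts (cfst t)) \sum_(b' <- parts (cfst t'))
    \sum_(b'' <- parts (csnd s2))
      sgn ((g1 - 1) * rdeg (cfst t) +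
           (g2 - 1) * (rdeg (cfst t) + rdeg (cfst s1) + rdeg (cfst t'))) *:
        ev (aop B)
          (ccat (bar F b) (ccons (mhel T1 (cfst s1))
            (ccat (bar G b') (ccons (mhel T2 (cfst s2)) (bar K b''))))) e.

Definition prenat (F G : ainf_functor A B) (g : int) : Type :=
  multimap (fob F) (fob G) g.

Definition nat_closed (F G : ainf_functor A B) (g : int) (T : prenat F G g) :
    Prop :=
  forall (x y : A) (c : hchain x y) (e : int), M1 (fmap F) (fmap G) T c e = 0.

(* [E] states F^0 = G^0, and [G'] is G seen with the object map of F; H^0 = 0
   and F - G = M1(H), both sides vanishing on empty sequences. *)
Definition homotopic (F G : ainf_functor A B) : Prop :=
  exists E : fob G = fob F,
    let G' := ecast o (multimap o o 1) E (fmap G) in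
    exists H : multimap (fob F) (fob F) 0,
      (forall (x : A) (e : int), ev H (cnil x) e = 0) /\
      (forall (x y : A) (c : hchain x y) (e : int),
         ev (fmap F) c e - ev G' c e = M1 (fmap F) G' H c e).

End Prenatural.

(* The transformation Id_F. *)
Definition idnat (R : comPzRingType) (A : ainf_cat R) (B : su_cat R)
    (F : ainf_functor A B) (x y : A) (c : hchain x y) (e : int) :
    B (fob F x) (fob F y) e :=
  match c in chain _ x y return B (fob F x) (fob F y) e with
  | cnil x => hpart (hel (one (fob F x))) e
  | ccons _ _ _ _ _ => 0
  end.

Definition weakly_equivalent (R : comPzRingType) (A : ainf_cat R) (B : su_cat R)
    (F G : ainf_functor A B) : Prop :=
  exists (T : prenat F G 0) (S : prenat G F 0),
    [/\ nat_closed T, nat_closed S,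
        exists U : prenat F F (-1), forall (x y : A) (c : hchain x y) (e : int),
          M2 (fmap F) (fmap G) (fmap F) S T c e - idnat F c e =
          M1 (fmap F) (fmap F) U c e
      & exists V : prenat G G (-1), forall (x y : A) (c : hchain x y) (e : int),
          M2 (fmap G) (fmap F) (fmap G) T S c e - idnat G c e =
          M1 (fmap G) (fmap G) V c e].

(* Main.v *)
(* Both halves rest on one formalism: for functors F_0, ..., F_k and
   transformations T_i : F_{i-1} => F_i, the words F_0..T_1 F_1..T_k F_k.. in the
   morphisms of B.  Inserting the operations of B into such words, and those of A
   into their arguments, yields the A-infinity relations of the category of
   functors, with M1, M2, M3 given by evaluating the operations of B on words.

   If F - G = M1(H), then T = Id + H is closed.  Since H vanishes on empty
   sequences, T has a strict left inverse S_l and a strict right inverse S_r, found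
   by recursion on the length of the arguments.  They are closed by the Leibniz
   rule, and M3(S_r, T, S_l) shows that S_r - S_l is exact.

   For the second half, let P be the tensor product of B with the cochains of an
   interval.  Constant paths give a quasi-equivalence B -> P, of which evaluation at
   either end is a left inverse; so the two evaluations become equal after
   localization.  The homotopy H is a functor A -> P with ends F and G. *)

Require Import Defs.
From mathcomp Require Import all_boot all_order all_algebra.
From mathcomp Require Import zify.

Set Implicit Arguments.
Unset Strict Implicit.
Unset Printing Implicit Defensive.

Import GRing.Theory.
Local Open Scope ring_scope.

(** The composition M2 is associative only up to M3, so the strict one-sided inverses of T need not
    coincide; this is why a third order operation enters. The left inverse is kept, and only the
    homotopy on the other side has to be constructed.

    For the path category, checking the A-infinity relations by hand would repeat all the sign
    computations. Instead the interval component of its operations is solved from the demand that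
    the two evaluations be homotopic functors. The formalism is set up for an arbitrary multimap [D]
    on the source that vanishes on empty chains, so it can be applied over the path category while
    its relations are still to be proved, and these then come out as instances. With this choice the
    functor equation for the triple (F, G, H) is exactly the two functor equations together with F -
    G = M1(H).

    Lists of words are never compared. Every identity is one between sums of values of a multilinear
    functional on words, so that reordering and cancellation take place in a module. Since homotopic
    functors agree on objects, one object map serves for all functors in a word. *)

(** * Signs and multilinear functionals on chains *)

Lemma sum_cuts_cat1 (O : Type) (E : O -> O -> Type) (V : nmodType) w x y z
    (a : chain E w x) (f : E x y) (b : chain E y z) (psi : cut E w z -> V) :
  \sum_(t <- cuts (ccat a (ccons f b))) psi t =
  \sum_(t <- cuts a) psi (Cut (cfst t) (ccat (csnd t) (ccons f b))) +
  \sum_(t <- cuts b) psi (Cut (ccat a (ccons f (cfst t))) (csnd t)).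
Proof.
elim: a f b psi => [{}x|{}w x' {}x g a IHa] f b psi /=.
  by rewrite big_cons big_map big_seq1.
by rewrite !big_cons !big_map IHa addrA.
Qed.

Lemma sgn_sqr (R : comPzRingType) (k : int) : sgn k * sgn k = 1 :> R.
Proof. by rewrite /sgn -expr2 -exprM mulnC exprM sqrrN !expr1n. Qed.

Lemma sgn_eqmod2 (R : comPzRingType) (k l : int) :
  (exists n : int, k = l + n *+ 2) -> sgn k = sgn l :> R.
Proof.
by case=> n ->; rewrite sgnD mulr2n sgnD sgn_sqr mulr1.
Qed.

Section Multilinear.
Variables (R : comPzRingType) (B : quiver R) (V : lmodType R).

(** Linearity in each entry at a fixed degree of that entry. Such functionals take the place of
    linear maps out of the tensor coalgebra, which is never formed. *)
Definition multilinear (u v : B) (psi : hchain u v -> V) : Prop :=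
  forall (x y : B) (a : hchain u x) (b : hchain y v) d k (f f' : B x y d),
    psi (ccat a (ccons (hel (k *: f + f')) b)) =
    k *: psi (ccat a (ccons (hel f) b)) + psi (ccat a (ccons (hel f') b)).

Lemma multilinear_catr u v v' (b : hchain v v') (psi : hchain u v' -> V) :
  multilinear psi -> multilinear (fun w : hchain u v => psi (ccat w b)).
Proof. by move=> lin x y a' b' d k f f'; rewrite !ccatA /= lin. Qed.

Lemma multilinear_catl u u' v (a : hchain u u') (psi : hchain u v -> V) :
  multilinear psi -> multilinear (fun w => psi (ccat a w)).
Proof. by move=> lin x y a' b' d k f f'; rewrite -!ccatA lin. Qed.

Section Letter.
Variables (u v x y : B) (a : hchain u x) (b : hchain y v) (psi : hchain u v -> V).
Hypothesis lin : multilinear psi.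

Lemma multilinear0 d : psi (ccat a (ccons (@hel _ B x y d 0) b)) = 0.
Proof.
have := lin a b (-1) (0 : B x y d) 0.
by rewrite scaler0 addr0 scaleN1r addNr.
Qed.

Lemma multilinearZ d k (f : B x y d) :
  psi (ccat a (ccons (hel (k *: f)) b)) = k *: psi (ccat a (ccons (hel f) b)).
Proof. by rewrite -[k *: f]addr0 lin multilinear0 addr0. Qed.

Lemma multilinearD d (f f' : B x y d) :
  psi (ccat a (ccons (hel (f + f')) b)) =
  psi (ccat a (ccons (hel f) b)) + psi (ccat a (ccons (hel f') b)).
Proof. by rewrite -[f]scale1r lin !scale1r. Qed.

Lemma multilinear_sum d I (r : seq I) (P : pred I) (F : I -> B x y d) :
  psi (ccat a (ccons (hel (\sum_(i <- r | P i) F i)) b)) =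
  \sum_(i <- r | P i) psi (ccat a (ccons (hel (F i)) b)).
Proof.
apply: (big_morph (fun f => psi (ccat a (ccons (hel f) b)))).
  by move=> f f'; rewrite multilinearD.
by rewrite multilinear0.
Qed.

End Letter.
End Multilinear.

Lemma ev_multilinear (R : comPzRingType) (A B : quiver R) (p q : A -> B) g
    (T : multimap p q g) (x y : A) e :
  multilinear (fun c : hchain x y => ev T c e).
Proof. by move=> *; apply: ev_lin. Qed.

(** * Words *)

Section Words.
Variables (R : comPzRingType) (A B : quiver R) (o : A -> B).

(** A transformation together with its target functor: a functor followed by a list of layers is a
    sequence of composable transformations. The degree is a field, so that transformations of
    different degrees fit in one list. *)
Record layer := Layer {
  ldeg : int; ltrans : multimap o o ldeg; lfun : multimap o o 1 }.

Definition lrdeg (L : seq layer) : int := foldr (fun l k => ldeg l - 1 + k) 0 L.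

Lemma lrdeg_cat L L' : lrdeg (L ++ L') = lrdeg L + lrdeg L'.
Proof. by elim: L => [|l L IHL]; rewrite ?add0r //= IHL addrA. Qed.

Definition llast (F : multimap o o 1) (L : seq layer) := last F (map lfun L).

(* For [L] listing (T_1, F_1), ..., (T_k, F_k), the words obtained by applying
   F, T_1, F_1, ..., T_k, F_k, in this order, to consecutive parts of [c]; each
   sign is the Koszul sign of moving the T_i past the entries preceding them. *)
Fixpoint words (F : multimap o o 1) (L : seq layer) x y (c : hchain x y) :
    seq (R * hchain (o x) (o y)) :=
  if L is l :: L' then
    flatten [seq flatten [seq
      [seq (sgn (lrdeg L * rdeg (cfst t) + lrdeg L' * rdeg (cfst s)) * w.1,
            ccat (bar F b) (ccons (mhel (ltrans l) (cfst s)) w.2))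
         | b <- parts (cfst t), w <- words (lfun l) L' (csnd s)]
      | s <- cuts (csnd t)] | t <- cuts c]
  else [seq (1, bar F b) | b <- parts c].

Section Sum.
Variable V : lmodType R.

Definition wsum F L x y (c : hchain x y) (psi : hchain (o x) (o y) -> V) : V :=
  \sum_(w <- words F L c) w.1 *: psi w.2.

Lemma wsum_nil F x y (c : hchain x y) psi :
  wsum F [::] c psi = \sum_(b <- parts c) psi (bar F b).
Proof. by rewrite /wsum /= big_map; apply: eq_bigr => b _; rewrite scale1r. Qed.

Lemma wsum_cons F l L x y (c : hchain x y) psi :
  wsum F (l :: L) c psi =
  \sum_(t <- cuts c) \sum_(s <- cuts (csnd t))
    sgn (lrdeg (l :: L) * rdeg (cfst t) + lrdeg L * rdeg (cfst s)) *:
    \sum_(b <- parts (cfst t)) wsum (lfun l) L (csnd s)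
      (fun w => psi (ccat (bar F b) (ccons (mhel (ltrans l) (cfst s)) w))).
Proof.
rewrite /wsum /= big_flatten big_map; apply: eq_bigr => t _.
rewrite big_flatten big_map; apply: eq_bigr => s _.
rewrite big_allpairs_dep scaler_sumr; apply: eq_bigr => b _.
by rewrite scaler_sumr; apply: eq_bigr => w _; rewrite scalerA.
Qed.

Lemma wsumD F L x y (c : hchain x y) psi psi' :
  wsum F L c (fun w => psi w + psi' w) = wsum F L c psi + wsum F L c psi'.
Proof. by rewrite -big_split; apply: eq_bigr => w _; rewrite scalerDr. Qed.

Lemma wsumZ F L x y (c : hchain x y) k psi :
  wsum F L c (fun w => k *: psi w) = k *: wsum F L c psi.
Proof. by rewrite scaler_sumr; apply: eq_bigr => w _; rewrite !scalerA mulrC. Qed.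

Lemma wsum_sum F L x y (c : hchain x y) I (r : seq I) psi :
  wsum F L c (fun w => \sum_(i <- r) psi i w) =
  \sum_(i <- r) wsum F L c (psi i).
Proof. by rewrite exchange_big; apply: eq_bigr => w _; rewrite scaler_sumr. Qed.

(** Each transformation contributes a letter even on an empty block, and nonempty arguments of a
    functor give at least one block. The length bound serves to discard words containing a strict
    unit. *)
Lemma eq_wsum F L x y (c : hchain x y) psi psi' :
  (forall w, rdeg w = rdeg c + lrdeg L -> (size L <= csize w)%N ->
     ((0 < csize c)%N -> (0 < csize w)%N) -> psi w = psi' w) ->
  wsum F L c psi = wsum F L c psi'.
Proof.
elim: L F x y c psi psi' => [|l L IHL] F x y c psi psi' eqpsi.
  rewrite !wsum_nil; apply: eq_sum_parts => b degb szb; apply: eqpsi => //.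
    by rewrite rdeg_bar degb addr0.
  by rewrite csize_bar szb.
rewrite !wsum_cons; apply: eq_sum_cuts => t degt _; apply: eq_sum_cuts => s degs _.
congr (_ *: _); apply: eq_sum_parts => b degb _; apply: IHL => w degw szw _.
apply: eqpsi; rewrite ?rdeg_cat ?csize_cat ?rdeg_bar /=; lia.
Qed.

Lemma wsum0 F L x y (c : hchain x y) psi :
  (forall w, rdeg w = rdeg c + lrdeg L -> (size L <= csize w)%N ->
     ((0 < csize c)%N -> (0 < csize w)%N) -> psi w = 0) -> wsum F L c psi = 0.
Proof.
by move/eq_wsum->; rewrite /wsum big1 // => w _; rewrite scaler0.
Qed.

(** The recursion defining [words] exposes the first transformation; here an arbitrary one is
    exposed, by reassociating the cuts of the arguments. *)
Lemma wsum_cat F L l L' x y (c : hchain x y) psi :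
  wsum F (L ++ l :: L') c psi =
  \sum_(t <- cuts c) \sum_(s <- cuts (csnd t))
    sgn (lrdeg (l :: L') * rdeg (cfst t) + lrdeg L' * rdeg (cfst s)) *:
    wsum F L (cfst t) (fun u => wsum (lfun l) L' (csnd s)
      (fun v => psi (ccat u (ccons (mhel (ltrans l) (cfst s)) v)))).
Proof.
elim: L F x y c psi => [|k L IHL] F x y c psi.
  rewrite wsum_cons; apply: eq_bigr => t _; apply: eq_bigr => s _.
  by rewrite wsum_nil.
rewrite cat_cons wsum_cons.
transitivity (\sum_(t <- cuts c) \sum_(s <- cuts (csnd t))
  \sum_(t' <- cuts (csnd s)) \sum_(s' <- cuts (csnd t'))
   sgn (lrdeg (k :: L ++ l :: L') * rdeg (cfst t)
       + lrdeg (L ++ l :: L') * rdeg (cfst s)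
       + lrdeg (l :: L') * rdeg (cfst t') + lrdeg L' * rdeg (cfst s')) *:
   \sum_(b <- parts (cfst t)) wsum (lfun k) L (cfst t') (fun u =>
     wsum (lfun l) L' (csnd s') (fun v => psi (ccat (ccat (bar F b)
       (ccons (mhel (ltrans k) (cfst s)) u))
       (ccons (mhel (ltrans l) (cfst s')) v))))).
  apply: eq_bigr => t _; apply: eq_bigr => s _.
  under eq_bigr do rewrite IHL.
  rewrite exchange_big scaler_sumr; apply: eq_bigr => t' _ /=.
  rewrite exchange_big scaler_sumr; apply: eq_bigr => s' _ /=.
  rewrite -scaler_sumr scalerA -sgnD addrA; congr (_ *: _).
  apply: eq_bigr => b _; apply: eq_wsum => u _ _ _; apply: eq_wsum => v _ _ _.
  by rewrite ccatA.
pose phi u1 u2 u3 (a1 : hchain x u1) (a2 : hchain u1 u2) (a3 : hchain u2 u3)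
    (a4 : hchain u3 y) :=
  \sum_(s <- cuts a4)
   sgn (lrdeg (k :: L ++ l :: L') * rdeg a1
       + lrdeg (L ++ l :: L') * rdeg a2
       + lrdeg (l :: L') * rdeg a3 + lrdeg L' * rdeg (cfst s)) *:
   \sum_(b <- parts a1) wsum (lfun k) L a3 (fun u =>
     wsum (lfun l) L' (csnd s) (fun v => psi (ccat (ccat (bar F b)
       (ccons (mhel (ltrans k) a2) u))
       (ccons (mhel (ltrans l) (cfst s)) v)))).
transitivity (\sum_(t <- cuts c) \sum_(t' <- cuts (cfst t)) \sum_(s' <- cuts (csnd t'))
   phi _ _ _ (cfst t') (cfst s') (csnd s') (csnd t)).
  rewrite -(sum_cuts_coassoc c (fun u v a b d => \sum_(s <- cuts b)
     phi _ _ _ a (cfst s) (csnd s) d)).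
  apply: eq_bigr => t _.
  by rewrite -(sum_cuts_coassoc (csnd t) (fun u v a b d => phi _ _ _ (cfst t) a b d)).
apply: eq_bigr => t _.
under eq_bigr do rewrite exchange_big.
rewrite exchange_big; apply: eq_bigr => s _ /=.
rewrite wsum_cons scaler_sumr; apply: eq_sum_cuts => t' degt' _.
rewrite scaler_sumr; apply: eq_sum_cuts => s' degs' _.
rewrite scalerA -sgnD; congr (sgn _ *: _).
by rewrite !lrdeg_cat /= -degt' -degs'; lia.
Qed.

End Sum.
End Words.

Fixpoint splits (T : Type) (L : seq T) : seq (seq T * seq T) :=
  ([::], L) ::
  if L is l :: L' then [seq (l :: M.1, M.2) | M <- splits L'] else [::].

Lemma eq_sum_splits (V : nmodType) (T : Type) (L : seq T)
    (psi psi' : seq T * seq T -> V) :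
  (forall M, M.1 ++ M.2 = L -> psi M = psi' M) ->
  \sum_(M <- splits L) psi M = \sum_(M <- splits L) psi' M.
Proof.
elim: L psi psi' => [|l L IHL] psi psi' eqpsi; first by rewrite /= !big_seq1 eqpsi.
rewrite /= !big_cons !big_map eqpsi //; congr (_ + _).
by apply: IHL => M defL; apply: eqpsi; rewrite /= defL.
Qed.

Section Splitting.
Variables (R : comPzRingType) (A B : quiver R) (o : A -> B) (V : lmodType R).

Lemma sum_cuts_bar (F : multimap o o 1) x y (b : chain (@hchain R A) x y)
    (psi : cut (@helt R B) (o x) (o y) -> V) :
  \sum_(t <- cuts (bar F b)) psi t =
  \sum_(t <- cuts b) psi (Cut (bar F (cfst t)) (bar F (csnd t))).
Proof. exact: sum_cuts_map. Qed.

(** Words form the image of a morphism of tensor coalgebras, so cutting a word amounts to cutting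
    the arguments and the list of transformations. The sign moves the transformations of the second
    half past the arguments of the first. *)
Lemma wsum_split (F : multimap o o 1) (L : seq (layer o)) x y (c : hchain x y)
    (psi : forall z, hchain (o x) z -> hchain z (o y) -> V) :
  wsum F L c (fun w => \sum_(t <- cuts w) psi _ (cfst t) (csnd t)) =
  \sum_(M <- splits L) \sum_(t <- cuts c)
    sgn (lrdeg M.2 * rdeg (cfst t)) *:
    wsum F M.1 (cfst t) (fun u =>
      wsum (llast F M.1) M.2 (csnd t) (fun v => psi _ u v)).
Proof.
elim: L F x y c psi => [|l L IHL] F x y c psi.
  rewrite /= big_seq1 wsum_nil.
  under [LHS]eq_bigr do rewrite sum_cuts_bar /=.
  rewrite (sum_parts_cuts c (fun t => psi _ (bar F (cfst t)) (bar F (csnd t)))) /=.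
  apply: eq_bigr => t _; rewrite mul0r sgn0 scale1r wsum_nil.
  by apply: eq_bigr => b _; rewrite wsum_nil.
rewrite [splits _]/= big_cons big_map wsum_cons.
transitivity (
  \sum_(t <- cuts c) \sum_(s <- cuts (csnd t))
    sgn (lrdeg (l :: L) * rdeg (cfst t) + lrdeg L * rdeg (cfst s)) *:
    (\sum_(t' <- cuts (cfst t))
     \sum_(b1 <- parts (cfst t')) \sum_(b2 <- parts (csnd t'))
     wsum (lfun l) L (csnd s) (fun w => psi _ (bar F b1)
      (ccat (bar F b2) (ccons (mhel (ltrans l) (cfst s)) w)))) +
  \sum_(t <- cuts c) \sum_(s <- cuts (csnd t))
    sgn (lrdeg (l :: L) * rdeg (cfst t) + lrdeg L * rdeg (cfst s)) *:
    \sum_(b <- parts (cfst t)) wsum (lfun l) L (csnd s) (fun w =>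
     \sum_(t' <- cuts w) psi _
       (ccat (bar F b) (ccons (mhel (ltrans l) (cfst s)) (cfst t'))) (csnd t'))).
  rewrite -big_split; apply: eq_bigr => t _ /=.
  rewrite -big_split; apply: eq_bigr => s _ /=.
  rewrite -scalerDr; congr (_ *: _).
  rewrite -(sum_parts_cuts (cfst t) (fun t' => wsum (lfun l) L (csnd s)
    (fun w => psi _ (bar F (cfst t'))
      (ccat (bar F (csnd t')) (ccons (mhel (ltrans l) (cfst s)) w))))).
  rewrite -big_split; apply: eq_bigr => b _ /=.
  under eq_wsum do rewrite sum_cuts_cat1.
  by rewrite wsumD wsum_sum sum_cuts_bar.
congr (_ + _).
  transitivity (\sum_(t <- cuts c) \sum_(s <- cuts (csnd t)) \sum_(t' <- cuts (csnd s))
    sgn (lrdeg (l :: L) * (rdeg (cfst t) + rdeg (cfst s)) + lrdeg L * rdeg (cfst t')) *: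
    (\sum_(b1 <- parts (cfst t)) \sum_(b2 <- parts (cfst s))
     wsum (lfun l) L (csnd t') (fun w => psi _ (bar F b1)
      (ccat (bar F b2) (ccons (mhel (ltrans l) (cfst t')) w))))); last first.
    apply: eq_bigr => t _; rewrite wsum_nil scaler_sumr.
    under [RHS]eq_bigr do rewrite wsum_cons scaler_sumr.
    rewrite exchange_big; apply: eq_bigr => s _ /=.
    under [RHS]eq_bigr do rewrite scaler_sumr.
    rewrite exchange_big; apply: eq_bigr => t' _ /=.
    rewrite scaler_sumr; apply: eq_bigr => b1 _.
    by rewrite scalerA -sgnD mulrDr addrA.
  rewrite (sum_cuts_coassoc c (fun u v a b d => \sum_(t' <- cuts d)
    sgn (lrdeg (l :: L) * (rdeg a + rdeg b) + lrdeg L * rdeg (cfst t')) *: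
    (\sum_(b1 <- parts a) \sum_(b2 <- parts b)
     wsum (lfun l) L (csnd t') (fun w => psi _ (bar F b1)
      (ccat (bar F b2) (ccons (mhel (ltrans l) (cfst t')) w)))))).
  apply: eq_bigr => t _; rewrite exchange_big; apply: eq_bigr => s _ /=.
  rewrite scaler_sumr; apply: eq_sum_cuts => t' degt' _.
  by rewrite degt'.
(* The cut now falls after the first transformation: the induction hypothesis splits the rest of the
   word, and the cuts are reassociated to put the main one outermost. *)
pose phi (M : seq (layer o) * seq (layer o)) u1 u2 u3 (a1 : hchain x u1)
    (a2 : hchain u1 u2) (a3 : hchain u2 u3) (a4 : hchain u3 y) :=
   sgn (lrdeg (l :: L) * rdeg a1 + lrdeg L * rdeg a2 + lrdeg M.2 * rdeg a3) *:
   \sum_(b <- parts a1) wsum (lfun l) M.1 a3 (fun u =>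
     wsum (llast (lfun l) M.1) M.2 a4 (fun v => psi _ (ccat (bar F b)
       (ccons (mhel (ltrans l) a2) u)) v)).
transitivity (\sum_(M <- splits L) \sum_(t <- cuts c) \sum_(s <- cuts (csnd t))
  \sum_(t' <- cuts (csnd s)) phi M _ _ _ (cfst t) (cfst s) (cfst t') (csnd t')).
  rewrite [RHS]exchange_big; apply: eq_bigr => t _ /=.
  rewrite [RHS]exchange_big; apply: eq_bigr => s _ /=.
  under eq_bigr do rewrite (IHL _ _ _ _ (fun z (u : hchain (o _) z) v =>
    psi _ (ccat _ (ccons _ u)) v)).
  rewrite exchange_big scaler_sumr; apply: eq_bigr => M _ /=.
  rewrite exchange_big scaler_sumr; apply: eq_bigr => t' _ /=.
  by rewrite /phi -scaler_sumr scalerA -sgnD.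
apply: eq_sum_splits => M defL.
have degM : lrdeg L = lrdeg M.1 + lrdeg M.2 by rewrite -lrdeg_cat defL.
transitivity (\sum_(t <- cuts c) \sum_(t' <- cuts (cfst t)) \sum_(s' <- cuts (csnd t'))
   phi M _ _ _ (cfst t') (cfst s') (csnd s') (csnd t)).
  rewrite -(sum_cuts_coassoc c (fun u v a b d => \sum_(s <- cuts b)
     phi M _ _ _ a (cfst s) (csnd s) d)).
  apply: eq_bigr => t _.
  by rewrite -(sum_cuts_coassoc (csnd t) (fun u v a b d => phi M _ _ _ (cfst t) a b d)).
apply: eq_bigr => t _.
rewrite wsum_cons scaler_sumr; apply: eq_sum_cuts => t' degt' _.
rewrite scaler_sumr; apply: eq_sum_cuts => s' degs' _.
rewrite scalerA -sgnD; congr (sgn _ *: _).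
by rewrite /= -degt' -degs' degM; lia.
Qed.

End Splitting.

Section MultilinearSums.
Variables (R : comPzRingType) (A : quiver R) (V : lmodType R).

Lemma multilinear_rdeg (s : int -> R) (x y : A) (psi : hchain x y -> V) :
  multilinear psi -> multilinear (fun c => s (rdeg c) *: psi c).
Proof.
move=> lin u v a b d k f f'; rewrite lin scalerDr !scalerA !rdeg_cat /=.
by rewrite [k * _]mulrC.
Qed.

Lemma multilinear_bigsum I (r : seq I) (x y : A) (psi : I -> hchain x y -> V) :
  (forall i, multilinear (psi i)) ->
  multilinear (fun c => \sum_(i <- r) psi i c).
Proof.
move=> lin u v a b d k f f'; rewrite scaler_sumr -big_split.
by apply: eq_bigr => i _; rewrite lin.
Qed.

Lemma multilinear_cuts (x y : A)
    (psi : forall z, hchain x z -> hchain z y -> V) :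
  (forall z b, multilinear (fun a => psi z a b)) ->
  (forall z a, multilinear (psi z a)) ->
  multilinear (fun c => \sum_(t <- cuts c) psi _ (cfst t) (csnd t)).
Proof.
move=> linl linr u v a b d k f f'; rewrite !sum_cuts_cat1 scalerDr addrACA.
congr (_ + _); rewrite scaler_sumr -big_split; apply: eq_bigr => t _ /=.
  by rewrite linr.
by rewrite linl.
Qed.

End MultilinearSums.

Section MultilinearWords.
Variables (R : comPzRingType) (A B : quiver R) (o : A -> B) (V : lmodType R).

Lemma multilinear_wsum_param (C : quiver R) (p q : C) F (L : seq (layer o)) x y
    (c : hchain x y) (psi : hchain p q -> hchain (o x) (o y) -> V) :
  (forall w, multilinear (psi^~ w)) -> multilinear (fun u => wsum F L c (psi u)).
Proof.
move=> lin; apply: multilinear_bigsum => -[k w] /=.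
exact: (multilinear_rdeg (fun=> k)).
Qed.

Lemma multilinear_letter g (T : multimap o o g) x y u v (a : hchain u (o x))
    (b : hchain (o y) v) (psi : hchain u v -> V) :
  multilinear psi ->
  multilinear (fun c : hchain x y => psi (ccat a (ccons (mhel T c) b))).
Proof.
move=> lin x' y' a' b' d k f f'.
by rewrite /mhel !rdeg_cat /= ev_lin lin.
Qed.

Lemma multilinear_parts (F : multimap o o 1) x y (psi : hchain (o x) (o y) -> V) :
  multilinear psi ->
  multilinear (fun c : hchain x y => \sum_(b <- parts c) psi (bar F b)).
Proof.
move=> lin u v a b d k f f'; rewrite !sum_parts_cat1.
rewrite scaler_sumr -big_split; apply: eq_bigr => t _ /=.
rewrite scaler_sumr -big_split; apply: eq_bigr => p _ /=.
rewrite scaler_sumr -big_split; apply: eq_bigr => t' _ /=.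
rewrite scaler_sumr -big_split; apply: eq_bigr => p' _ /=.
by rewrite !bar_cat !bar_cons (multilinear_letter F _ _ lin).
Qed.

Lemma multilinear_wsum F (L : seq (layer o)) x y (psi : hchain (o x) (o y) -> V) :
  multilinear psi -> multilinear (fun c : hchain x y => wsum F L c psi).
Proof.
elim: L F x y psi => [|l L IHL] F x y psi lin.
  move=> u v a b d k f f'; rewrite !wsum_nil; exact: multilinear_parts.
move=> u v a b d k f f'; rewrite !wsum_cons.
apply: (@multilinear_cuts _ _ _ _ _ (fun z a c => \sum_(s <- cuts c)
    sgn (lrdeg (l :: L) * rdeg a + lrdeg L * rdeg (cfst s)) *:
    \sum_(b <- parts a) wsum (lfun l) L (csnd s)
      (fun w => psi (ccat (bar F b) (ccons (mhel (ltrans l) (cfst s)) w))))).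
  move=> z c; apply: multilinear_bigsum => s.
  apply: (multilinear_rdeg (fun d => sgn (lrdeg (l :: L) * d + _))).
  apply: (@multilinear_parts F x z (fun u => wsum (lfun l) L (csnd s)
      (fun w => psi (ccat u (ccons (mhel (ltrans l) (cfst s)) w))))).
  by apply: multilinear_wsum_param => w; apply: multilinear_catr.
move=> z {}a.
apply: (@multilinear_cuts _ _ _ _ _ (fun z' c c' =>
    sgn (lrdeg (l :: L) * rdeg a + lrdeg L * rdeg c) *:
    \sum_(b <- parts a) wsum (lfun l) L c'
      (fun w => psi (ccat (bar F b) (ccons (mhel (ltrans l) c) w))))).
  move=> z' c; apply: (multilinear_rdeg (fun d => sgn (_ + lrdeg L * d))).
  apply: multilinear_bigsum => p.
  by apply: multilinear_wsum_param => w; apply: multilinear_letter.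
move=> z' c; apply: (multilinear_rdeg (fun=> _)); apply: multilinear_bigsum => p.
apply: (IHL (lfun l) _ _ (fun w => psi (ccat _ (ccons _ w)))).
move=> x' y' a' b' d' k' g g'.
by have := lin _ _ (ccat (bar F p) (ccons (mhel (ltrans l) c) a')) b' d' k' g g';
  rewrite !ccatA.
Qed.

End MultilinearWords.

Lemma scaler_swap (R : comPzRingType) (V : lmodType R) (k l : R) (v : V) :
  k *: (l *: v) = l *: (k *: v).
Proof. by rewrite !scalerA mulrC. Qed.

(** * The category of functors *)

Section Insertion.
Variables (R : comPzRingType) (A : quiver R) (D : @multimap R A A id id 2).
Hypothesis D_nil : forall (x : A) e, ev D (cnil x) e = 0.

Let D_size0 (x y : A) (c : hchain x y) e : csize c = 0%N -> ev D c e = 0.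
Proof. by case: c => // z _; rewrite D_nil. Qed.

Definition ins (V : lmodType R) (x y : A) (psi : hchain x y -> V)
    (c : hchain x y) : V :=
  \sum_(t <- cuts c) \sum_(s <- cuts (csnd t)) sgn (rdeg (cfst t)) *:
    psi (ccat (cfst t) (ccons (mhel D (cfst s)) (csnd s))).

Section Values.
Variable V : lmodType R.
Implicit Types x y : A.

Lemma eq_ins x y (psi psi' : hchain x y -> V) c :
  psi =1 psi' -> ins psi c = ins psi' c.
Proof.
by move=> eqpsi; apply: eq_bigr => t _; apply: eq_bigr => s _; rewrite eqpsi.
Qed.

Lemma ins_rdeg (k : int -> R) x y (psi : hchain x y -> V) c :
  ins (fun c' => k (rdeg c') *: psi c') c = k (rdeg c + 1) *: ins psi c.
Proof.
rewrite scaler_sumr; apply: eq_sum_cuts => t degt _.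
rewrite scaler_sumr; apply: eq_sum_cuts => s degs _.
rewrite !scalerA mulrC; congr (k _ * _ *: _).
by rewrite rdeg_cat /= -degt -degs; lia.
Qed.

Lemma ins_sum I (r : seq I) x y (psi : I -> hchain x y -> V) c :
  ins (fun c' => \sum_(i <- r) psi i c') c = \sum_(i <- r) ins (psi i) c.
Proof.
rewrite exchange_big; apply: eq_bigr => t _ /=.
by rewrite exchange_big; apply: eq_bigr => s _ /=; rewrite scaler_sumr.
Qed.

(** The co-Leibniz rule: the inserted letter lies on one side of the cut, and if it lies on the
    right then [D] has moved past the whole left part. *)
Lemma ins_cuts x y (c : hchain x y)
    (psi : forall z, hchain x z -> hchain z y -> V) :
  ins (fun c' => \sum_(t <- cuts c') psi _ (cfst t) (csnd t)) c =
  \sum_(t <- cuts c) (ins (fun a => psi _ a (csnd t)) (cfst t) +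
    sgn (rdeg (cfst t)) *: ins (psi _ (cfst t)) (csnd t)).
Proof.
pose p1 u1 u2 u3 (a1 : hchain x u1) (a2 : hchain u1 u2) (a3 : hchain u2 u3)
    (a4 : hchain u3 y) :=
  sgn (rdeg a1 + rdeg a2) *: psi _ a1 (ccat a2 (ccons (mhel D a3) a4)).
pose p2 u1 u2 u3 (a1 : hchain x u1) (a2 : hchain u1 u2) (a3 : hchain u2 u3)
    (a4 : hchain u3 y) :=
  sgn (rdeg a1) *: psi _ (ccat a1 (ccons (mhel D a2) a3)) a4.
transitivity (
  \sum_(t <- cuts c) \sum_(t' <- cuts (cfst t)) \sum_(s <- cuts (csnd t))
    p1 _ _ _ (cfst t') (csnd t') (cfst s) (csnd s) +
  \sum_(t <- cuts c) \sum_(s <- cuts (csnd t)) \sum_(t' <- cuts (csnd s))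
    p2 _ _ _ (cfst t) (cfst s) (cfst t') (csnd t')).
  rewrite -big_split; apply: eq_bigr => t _ /=.
  rewrite exchange_big -big_split; apply: eq_bigr => s _ /=.
  rewrite sum_cuts_cat1 scalerDr !scaler_sumr; congr (_ + _).
  by apply: eq_sum_cuts => t' degt' _; rewrite /p1 degt'.
rewrite big_split addrC; congr (_ + _).
  transitivity (\sum_(t <- cuts c) \sum_(s <- cuts (csnd t))
      \sum_(t' <- cuts (cfst s)) p2 _ _ _ (cfst t) (cfst t') (csnd t') (csnd s)).
    apply: eq_bigr => t _.
    exact: (sum_cuts_coassoc (csnd t) (fun u v => p2 _ u v (cfst t))).
  exact: (sum_cuts_coassoc c (fun u v a b d =>
     \sum_(t' <- cuts b) p2 _ _ _ a (cfst t') (csnd t') d)).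
rewrite -(sum_cuts_coassoc c (fun u v a b d =>
     \sum_(s <- cuts d) p1 _ _ _ a b (cfst s) (csnd s))).
apply: eq_bigr => t _; rewrite scaler_sumr; apply: eq_bigr => t' _.
rewrite scaler_sumr; apply: eq_bigr => s _.
by rewrite scalerA -sgnD.
Qed.

Lemma multilinear_ins x y (psi : hchain x y -> V) :
  multilinear psi -> multilinear (ins psi).
Proof.
move=> lin.
apply: (@multilinear_cuts _ _ _ _ _ (fun z a c => \sum_(s <- cuts c)
   sgn (rdeg a) *: psi (ccat a (ccons (mhel D (cfst s)) (csnd s))))).
  move=> z c; apply: multilinear_bigsum => s.
  by apply: (multilinear_rdeg sgn); apply: multilinear_catr.
move=> z a.
apply: (@multilinear_cuts _ _ _ _ _ (fun z' b c =>
   sgn (rdeg a) *: psi (ccat a (ccons (mhel D b) c)))).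
  move=> z' c; apply: (multilinear_rdeg (fun=> _)).
  exact: (multilinear_letter D a c lin).
move=> z' b; apply: (multilinear_rdeg (fun=> _)).
move=> x' y' a' b' d' k' g g'.
by have := lin _ _ (ccat a (ccons (mhel D b) a')) b' d' k' g g';
  rewrite !ccatA.
Qed.

Lemma ins_nonempty x y (psi : hchain x y -> V) c : multilinear psi ->
  ins psi c =
  \sum_(t <- cuts c) \sum_(s <- cuts (csnd t) | (0 < csize (cfst s))%N)
    sgn (rdeg (cfst t)) *:
      psi (ccat (cfst t) (ccons (mhel D (cfst s)) (csnd s))).
Proof.
move=> lin; apply: eq_bigr => t _; rewrite [RHS]big_mkcond.
apply: eq_bigr => s _; case: posnP => // sz0.
by rewrite /mhel D_size0 // multilinear0 ?scaler0.
Qed.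

End Values.

Section Composite.
Variables (B : quiver R) (p q : A -> B) (g : int) (T : multimap p q g).

Lemma insertE x y (c : hchain x y) e :
  insert T D c e = ins (fun c' => ev T c' e) c.
Proof. by rewrite ins_nonempty //; apply: ev_multilinear. Qed.

Fact insert_lin w x y z (c : hchain w x) d (a : R) (f f' : A x y d)
    (c' : hchain y z) e :
  insert T D (ccat c (ccons (hel (a *: f + f')) c')) e =
  a *: insert T D (ccat c (ccons (hel f) c')) e +
  insert T D (ccat c (ccons (hel f') c')) e.
Proof. by rewrite !insertE multilinear_ins //; apply: ev_multilinear. Qed.

Fact insert_deg x y (c : hchain x y) e :
  e != rdeg c + (g + 1) -> insert T D c e = 0.
Proof.
move=> ne; rewrite insertE; apply: sum_cuts_eq0 => t degt _.
apply: sum_cuts_eq0 => s degs _; rewrite ev_deg ?scaler0 //.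
by move: ne; rewrite rdeg_cat /= -degt -degs; apply: contra => /eqP->; apply/eqP; lia.
Qed.

Definition minsert : multimap p q (g + 1) := Multimap insert_lin insert_deg.

End Composite.

Section Derivation.
Variables (B : quiver R) (o : A -> B) (V : lmodType R).

Lemma ins_letter g (T : multimap o o g) x y u v (a : hchain u (o x))
    (b : hchain (o y) v) (psi : hchain u v -> V) (c : hchain x y) :
  multilinear psi ->
  ins (fun c' => psi (ccat a (ccons (mhel T c') b))) c =
  psi (ccat a (ccons (mhel (minsert T) c) b)).
Proof.
move=> lin; rewrite [in RHS]/mhel /= insertE multilinear_sum //.
apply: eq_sum_cuts => t degt _; rewrite multilinear_sum //.
apply: eq_sum_cuts => s degs _; rewrite multilinearZ //; congr (_ *: psi (ccat _ (ccons _ _))).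
by rewrite -(@mhelE _ _ _ _ _ _ T _ _ _ (rdeg c + (g + 1))) //
  rdeg_cat /= -degt -degs; lia.
Qed.

(** Exactly one block contains the inserted letter, and this block behaves like a transformation of
    degree 2 from [F] to itself. *)
Lemma ins_parts (F : multimap o o 1) x y (c : hchain x y)
    (psi : hchain (o x) (o y) -> V) :
  multilinear psi ->
  ins (fun c' => \sum_(b <- parts c') psi (bar F b)) c =
  wsum F [:: Layer (minsert F) F] c psi.
Proof.
move=> lin; rewrite wsum_cons.
pose phi u1 u2 u3 u4 (a1 : hchain x u1) (a2 : hchain u1 u2) (a3 : hchain u2 u3)
    (a4 : hchain u3 u4) (a5 : hchain u4 y) :=
  sgn (rdeg a1 + rdeg a2) *: \sum_(b <- parts a1) \sum_(b' <- parts a5)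
    psi (ccat (bar F b) (ccons (mhel F (ccat a2 (ccons (mhel D a3) a4)))
       (bar F b'))).
transitivity (\sum_(t <- cuts c) \sum_(s <- cuts (csnd t))
   \sum_(t' <- cuts (cfst t)) \sum_(s' <- cuts (csnd s))
     phi _ _ _ _ (cfst t') (csnd t') (cfst s) (cfst s') (csnd s')).
  apply: eq_bigr => t _; apply: eq_bigr => s _.
  rewrite sum_parts_cat1 scaler_sumr; apply: eq_sum_cuts => t' degt' _.
  rewrite exchange_big scaler_sumr; apply: eq_bigr => s' _ /=.
  rewrite /phi degt'; congr (_ *: _); apply: eq_bigr => b _; apply: eq_bigr => b' _.
  by rewrite bar_cat bar_cons.
rewrite -(sum_cuts5 c phi); apply: eq_bigr => t _; apply: eq_bigr => s _.
transitivity (sgn (rdeg (cfst t)) *: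
   \sum_(b <- parts (cfst t)) \sum_(b' <- parts (csnd s))
     ins (fun c' => psi (ccat (bar F b) (ccons (mhel F c') (bar F b')))) (cfst s)).
  under [X in _ = _ *: X]eq_bigr do rewrite -ins_sum.
  rewrite -ins_sum scaler_sumr; apply: eq_bigr => t' _.
  rewrite scaler_sumr; apply: eq_bigr => s' _.
  by rewrite scalerA -sgnD.
congr (sgn _ *: _); first by rewrite /=; lia.
apply: eq_bigr => b _; rewrite wsum_nil; apply: eq_bigr => b' _.
exact: ins_letter.
Qed.

Lemma ins_wsum_param F (L : seq (layer o)) x y (c : hchain x y) u v
    (psi : hchain u v -> hchain (o x) (o y) -> V) (a : hchain u v) :
  ins (fun a' => wsum F L c (psi a')) a = wsum F L c (fun w => ins (psi^~ w) a).
Proof.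
rewrite [LHS]ins_sum; apply: eq_bigr => w _.
exact: (ins_rdeg (fun=> w.1)).
Qed.

(* The composition of a sum of words with the coderivation induced by [D]: in
   each term [D] is absorbed either by one of the functors or by one of the
   transformations. *)
Lemma ins_wsum F (L : seq (layer o)) x y (c : hchain x y)
    (psi : hchain (o x) (o y) -> V) :
  multilinear psi ->
  ins (fun c' => wsum F L c' psi) c =
  \sum_(M <- splits L) sgn (lrdeg M.2) *:
    (wsum F (M.1 ++ Layer (minsert (llast F M.1)) (llast F M.1) :: M.2) c psi +
     if M.2 is l :: M' then
       sgn (ldeg l - 1) *:
         wsum F (M.1 ++ Layer (minsert (ltrans l)) (lfun l) :: M') c psi
     else 0).
Proof.
elim: L F x y c psi => [|l L IHL] F x y c psi lin.
  rewrite /= big_seq1 sgn0 scale1r addr0 -ins_parts //.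
  by apply: eq_ins => c'; rewrite wsum_nil.
rewrite [splits _]/= big_cons big_map.
pose phi u1 u2 (a1 : hchain x u1) (a2 : hchain u1 u2) (a3 : hchain u2 y) :=
  sgn (lrdeg (l :: L) * rdeg a1 + lrdeg L * rdeg a2) *:
    \sum_(b <- parts a1) wsum (lfun l) L a3
      (fun w => psi (ccat (bar F b) (ccons (mhel (ltrans l) a2) w))).
transitivity (
  \sum_(t <- cuts c) \sum_(s <- cuts (csnd t))
    (ins (fun a => phi _ _ a (cfst s) (csnd s)) (cfst t) +
     (sgn (rdeg (cfst t)) *: ins (fun a => phi _ _ (cfst t) a (csnd s)) (cfst s) +
      sgn (rdeg (cfst t) + rdeg (cfst s)) *:
        ins (phi _ _ (cfst t) (cfst s)) (csnd s)))).
  transitivity (ins (fun c' => \sum_(t <- cuts c') \sum_(s <- cuts (csnd t))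
      phi _ _ (cfst t) (cfst s) (csnd s)) c).
    by apply: eq_ins => c'; rewrite wsum_cons.
  rewrite (ins_cuts c (fun z a b => \sum_(s <- cuts b) phi _ _ a (cfst s) (csnd s))).
  apply: eq_bigr => t _; rewrite ins_sum big_split; congr (_ + _).
  rewrite (ins_cuts (csnd t) (fun z => phi _ _ (cfst t))) scaler_sumr.
  by apply: eq_bigr => s _; rewrite scalerDr scalerA -sgnD.
have linw u1 u2 v (a : hchain (o x) (o u1)) (a2 : hchain u1 u2)
    (chi : hchain (o x) v -> V) (linc : multilinear chi) :
    multilinear (fun w => chi (ccat a (ccons (mhel (ltrans l) a2) w))).
  move=> x' y' a' b' d' k' g g'.
  by have := linc _ _ (ccat a (ccons (mhel (ltrans l) a2) a')) b' d' k' g g';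
  rewrite !ccatA.
under [LHS]eq_bigr do rewrite big_split /=.
rewrite big_split scalerDr -addrA; congr (_ + _).
  rewrite (wsum_cat F [:: Layer (minsert F) F]) scaler_sumr; apply: eq_bigr => t _.
  rewrite scaler_sumr; apply: eq_bigr => s _.
  rewrite (ins_rdeg (fun d => sgn (lrdeg (l :: L) * d + _))).
  rewrite (ins_parts F (cfst t) (psi := fun u => wsum (lfun l) L (csnd s)
      (fun w => psi (ccat u (ccons (mhel (ltrans l) (cfst s)) w))))); last first.
    by apply: multilinear_wsum_param => w; apply: multilinear_catr.
  by rewrite scalerA -sgnD; congr (sgn _ *: _); rewrite mulrDr mulr1 -addrA addrCA.
under [LHS]eq_bigr do rewrite big_split /=.
rewrite big_split; congr (_ + _).
  rewrite scalerA -sgnD wsum_cons scaler_sumr; apply: eq_bigr => t _.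
  rewrite scaler_sumr; apply: eq_bigr => s _ /=.
  rewrite (ins_rdeg (fun d => sgn (_ + lrdeg L * d))) scalerA -sgnD.
  rewrite ins_sum scalerA -sgnD; congr (_ *: _).
    apply: sgn_eqmod2; exists (1 - ldeg l); rewrite mulr2n /=; lia.
  apply: eq_bigr => b _; rewrite ins_wsum_param; apply: eq_wsum => w _ _ _.
  exact: ins_letter.
(* What remains are the insertions beyond the first transformation, to which the induction
   hypothesis applies under the sums. *)
transitivity (\sum_(t <- cuts c) \sum_(s <- cuts (csnd t))
  sgn ((lrdeg (l :: L) + 1) * rdeg (cfst t) + (lrdeg L + 1) * rdeg (cfst s)) *:
  \sum_(b <- parts (cfst t)) ins (fun c' => wsum (lfun l) L c'
      (fun w => psi (ccat (bar F b) (ccons (mhel (ltrans l) (cfst s)) w)))) (csnd s)).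
  apply: eq_bigr => t _; apply: eq_bigr => s _.
  rewrite (ins_rdeg (fun=> _)) ins_sum scalerA -sgnD; congr (sgn _ *: _); lia.
transitivity (\sum_(M <- splits L) \sum_(t <- cuts c) \sum_(s <- cuts (csnd t))
  sgn ((lrdeg (l :: L) + 1) * rdeg (cfst t) + (lrdeg L + 1) * rdeg (cfst s)) *:
  \sum_(b <- parts (cfst t))
   (let chi w := psi (ccat (bar F b) (ccons (mhel (ltrans l) (cfst s)) w)) in
    sgn (lrdeg M.2) *:
    (wsum (lfun l)
       (M.1 ++ Layer (minsert (llast (lfun l) M.1)) (llast (lfun l) M.1) :: M.2)
       (csnd s) chi +
     if M.2 is l' :: M' then
       sgn (ldeg l' - 1) *:
         wsum (lfun l) (M.1 ++ Layer (minsert (ltrans l')) (lfun l') :: M') (csnd s) chi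
     else 0))).
  rewrite [RHS]exchange_big; apply: eq_bigr => t _ /=.
  rewrite [RHS]exchange_big; apply: eq_bigr => s _ /=.
  rewrite -scaler_sumr; congr (_ *: _); rewrite [RHS]exchange_big.
  by apply: eq_bigr => b _ /=; apply: IHL; apply: linw.
apply: eq_sum_splits => -[L1 L2] /= <-.
rewrite wsum_cons.
case: L2 => [|l' L2].
  rewrite /= sgn0 scale1r addr0; apply: eq_bigr => t _; apply: eq_bigr => s _.
  congr (sgn _ *: _); first by rewrite !lrdeg_cat /=; lia.
  by apply: eq_bigr => b _; rewrite scale1r addr0.
rewrite [in RHS]wsum_cons scaler_sumr -big_split scaler_sumr; apply: eq_bigr => t _.
rewrite scaler_sumr -big_split scaler_sumr; apply: eq_bigr => s _ /=.
rewrite -scaler_sumr [LHS]scaler_swap; congr (_ *: _).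
rewrite big_split scalerDr -scaler_sumr [X in _ + X]scaler_swap /=; congr (_ + _ *: _).
  by congr (sgn _ *: _); rewrite !lrdeg_cat /=; lia.
by congr (sgn _ *: _); rewrite !lrdeg_cat /=; lia.
Qed.

End Derivation.
End Insertion.

Section WordMaps.
Variables (R : comPzRingType) (A B : quiver R) (o : A -> B) (g : int).
Variables (N : @multimap R B B id id g) (F : multimap o o 1) (L : seq (layer o)).

Fact wmap_lin w x y z (c : hchain w x) d (a : R) (f f' : A x y d)
    (c' : hchain y z) e :
  wsum F L (ccat c (ccons (hel (a *: f + f')) c')) (fun u => ev N u e) =
  a *: wsum F L (ccat c (ccons (hel f) c')) (fun u => ev N u e) +
  wsum F L (ccat c (ccons (hel f') c')) (fun u => ev N u e).
Proof. by apply: multilinear_wsum; apply: ev_multilinear. Qed.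

Fact wmap_deg x y (c : hchain x y) e :
  e != rdeg c + (lrdeg L + g) -> wsum F L c (fun u => ev N u e) = 0.
Proof.
by move=> ne; apply: wsum0 => w degw _ _; rewrite ev_deg // degw -addrA.
Qed.

(** For [N] the operations of B this is the operation M^k of the functor category when [L] has k >=
    2 layers. One layer gives the part of M1 computed in B, and no layer gives the left-hand side of
    the functor equation. *)
Definition wmap : multimap o o (lrdeg L + g) := Multimap wmap_lin wmap_deg.

End WordMaps.

Lemma layer_eq (R : comPzRingType) (A B : quiver R) (o : A -> B) g g'
    (T : multimap o o g) (T' : multimap o o g') F :
  g = g' -> (forall x y (c : hchain x y) e, ev T c e = ev T' c e) ->
  Layer T F = Layer T' F.
Proof. by move=> eqg; case: _ / eqg in T' * => /multimap_eq->. Qed.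

(** Degrees computed from lists of layers equal the expected ones only up to a proof. The cast
    changes the degree index alone, so [ev] is the same by computation. *)
Definition mcast (R : comPzRingType) (A B : quiver R) (p q : A -> B) g g'
    (eqg : g = g') (T : multimap p q g) : multimap p q g'.
Proof.
exists (ev T); [exact: ev_lin | by case: _ / eqg; apply: ev_deg].
Defined.

Section LayerSums.
Variables (R : comPzRingType) (A B : quiver R) (o : A -> B) (V : lmodType R).

Lemma wsum_layerD g (X Y Z : multimap o o g) k F' F (L L' : seq (layer o)) x y
    (c : hchain x y) (psi : hchain (o x) (o y) -> V) :
  multilinear psi ->
  (forall x y (c : hchain x y) e, ev X c e = k *: ev Y c e + ev Z c e) ->
  wsum F (L ++ Layer X F' :: L') c psi =
  k *: wsum F (L ++ Layer Y F' :: L') c psi + wsum F (L ++ Layer Z F' :: L') c psi.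
Proof.
move=> lin eqX; rewrite !wsum_cat scaler_sumr -big_split; apply: eq_bigr => t _ /=.
rewrite scaler_sumr -big_split; apply: eq_bigr => s _ /=.
rewrite scaler_swap -scalerDr; congr (_ *: _); rewrite -wsumZ -wsumD.
apply: eq_wsum => u _ _ _; rewrite -wsumZ -wsumD; apply: eq_wsum => v _ _ _.
by rewrite /mhel eqX lin.
Qed.

Lemma wsum_layer0 g (X : multimap o o g) F' F (L L' : seq (layer o)) x y
    (c : hchain x y) (psi : hchain (o x) (o y) -> V) :
  multilinear psi ->
  (forall x y (c : hchain x y) e, ev X c e = 0) ->
  wsum F (L ++ Layer X F' :: L') c psi = 0.
Proof.
move=> lin X0; have := @wsum_layerD _ X X X (-1) F' F L L' _ _ c _ lin.
rewrite scaleN1r addNr; apply=> *; by rewrite X0 scaler0 addr0.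
Qed.

End LayerSums.

Section Relations.
Variables (R : comPzRingType) (A : quiver R) (D : @multimap R A A id id 2).
Hypothesis D_nil : forall (x : A) e, ev D (cnil x) e = 0.
Variables (B : ainf_cat R) (o : A -> B).
Implicit Types (F : multimap o o 1) (L M : seq (layer o)).

Notation mB F L c e := (wsum F L c (fun w => ev (aop B) w e)).
Notation wB F L := (Layer (wmap (aop B) F L) (llast F L)).

Let linB x y e : multilinear (fun w : hchain (o x) (o y) => ev (aop B) w e).
Proof. exact: ev_multilinear. Qed.

(** The relations of B annihilate every word. Two applications of [wsum_split] isolate the subword
    fed to the inner operation; it comes from a run [N.1] of consecutive transformations, which the
    operation fuses into a single one. *)
Lemma wsum_aop_rel F L x y (c : hchain x y) e :
  \sum_(M <- splits L) sgn (lrdeg M.1) *: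
    \sum_(N <- splits M.2) mB F (M.1 ++ wB (llast F M.1) N.1 :: N.2) c e = 0.
Proof.
transitivity (wsum F L c (fun w => insert (aop B) (aop B) w e)); last first.
  by apply: wsum0 => w *; apply: aop_rel.
transitivity (wsum F L c (fun w => ins (aop B) (fun w => ev (aop B) w e) w)); last first.
  by apply: eq_wsum => w _ _ _; rewrite insertE //; apply: aop_nil.
rewrite (wsum_split F L c (fun z u v => \sum_(s <- cuts v) sgn (rdeg u) *:
  ev (aop B) (ccat u (ccons (mhel (aop B) (cfst s)) (csnd s))) e)).
apply: eq_bigr => -[L1 L2] _ /=.
transitivity (\sum_(t <- cuts c) sgn (lrdeg L2 * rdeg (cfst t)) *:
  \sum_(N <- splits L2) \sum_(s <- cuts (csnd t))
    sgn (lrdeg N.2 * rdeg (cfst s)) *: wsum F L1 (cfst t) (fun u =>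
      wsum (llast F L1) N.1 (cfst s) (fun v =>
        wsum (llast (llast F L1) N.1) N.2 (csnd s) (fun v' =>
          sgn (rdeg u) *:
          ev (aop B) (ccat u (ccons (mhel (aop B) v) v')) e)))); last first.
  apply: eq_bigr => t _; congr (_ *: _).
  under [RHS]eq_wsum => u _ _ _ do
    rewrite (wsum_split (llast F L1) L2 (csnd t) (fun z v v' => sgn (rdeg u) *:
      ev (aop B) (ccat u (ccons (mhel (aop B) v) v')) e)).
  rewrite wsum_sum; apply: eq_bigr => N _; rewrite wsum_sum; apply: eq_bigr => s _.
  by rewrite wsumZ.
under [RHS]eq_bigr do rewrite scaler_sumr.
rewrite exchange_big scaler_sumr; apply: eq_sum_splits => -[L2' L3] /= <-.
rewrite wsum_cat scaler_sumr; apply: eq_bigr => t _.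
rewrite !scaler_sumr; apply: eq_bigr => s _.
rewrite !scalerA -!sgnD.
transitivity (sgn (lrdeg (L2' ++ L3) * rdeg (cfst t) + lrdeg L3 * rdeg (cfst s)) *:
  (sgn (rdeg (cfst t) + lrdeg L1) *: wsum F L1 (cfst t) (fun u =>
      wsum (llast F L1) L2' (cfst s) (fun v =>
        wsum (llast (llast F L1) L2') L3 (csnd s) (fun v' =>
          ev (aop B) (ccat u (ccons (mhel (aop B) v) v')) e))))); last first.
  congr (_ *: _); rewrite -wsumZ; apply: eq_wsum => u degu _ _.
  rewrite -wsumZ; apply: eq_wsum => v _ _ _; rewrite -degu.
  by rewrite -wsumZ; apply: eq_wsum.
rewrite scalerA -sgnD; congr (_ *: _).
  by congr sgn; rewrite lrdeg_cat /=; lia.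
apply: eq_wsum => u _ _ _.
transitivity (wsum (llast (llast F L1) L2') L3 (csnd s) (fun v' =>
   wsum (llast F L1) L2' (cfst s) (fun v =>
     ev (aop B) (ccat u (ccons (mhel (aop B) v) v')) e))); last first.
  rewrite /wsum; under eq_bigr do rewrite scaler_sumr.
  rewrite exchange_big; apply: eq_bigr => v _; rewrite scaler_sumr.
  by apply: eq_bigr => v' _; rewrite scaler_swap.
apply: eq_wsum => v' _ _ _; rewrite [in LHS]/mhel /= [in LHS]/wsum.
rewrite (multilinear_sum _ _ (linB e)).
transitivity (wsum (llast F L1) L2' (cfst s) (fun v =>
  ev (aop B) (ccat u (ccons (hel (ev (aop B) v (rdeg (cfst s) + (lrdeg L2' + 2)))) v')) e)).
  by apply: eq_bigr => v _; rewrite (multilinearZ _ _ (linB e)).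
apply: eq_wsum => v degv _ _.
by rewrite (@mhelE _ _ _ _ _ _ (aop B) _ _ v) // degv addrA.
Qed.

Definition is_functor F : Prop := forall x y (c : hchain x y) e,
  \sum_(b <- parts c) ev (aop B) (bar F b) e = insert F D c e.

Fixpoint functors F L : Prop :=
  is_functor F /\ if L is l :: L' then functors (lfun l) L' else True.

Lemma functors_last F L L' : functors F (L ++ L') -> is_functor (llast F L).
Proof.
elim: L F => [|l L IHL] F /=; first by case: L' => [|k L'] [].
by case=> _ /IHL.
Qed.

Section Differential.
Variables (F F' : multimap o o 1) (g : int) (T : multimap o o g).

Let dval x y (c : hchain x y) e : B (o x) (o y) e :=
  mB F [:: Layer T F'] c e - sgn (g - 1) *: insert T D c e.

Fact mdiff_lin w x y z (c : hchain w x) d (a : R) (f f' : A x y d)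
    (c' : hchain y z) e :
  dval (ccat c (ccons (hel (a *: f + f')) c')) e =
  a *: dval (ccat c (ccons (hel f) c')) e + dval (ccat c (ccons (hel f') c')) e.
Proof.
rewrite /dval insert_lin // (wmap_lin (aop B)) scalerBr scalerDr opprD addrACA.
by rewrite scaler_swap.
Qed.

Fact mdiff_deg x y (c : hchain x y) e : e != rdeg c + (g + 1) -> dval c e = 0.
Proof.
move=> ne; rewrite /dval insert_deg // scaler0 subr0; apply: wmap_deg.
by move: ne; apply: contra => /eqP->; apply/eqP; rewrite /=; lia.
Qed.

Definition mdiff : multimap o o (g + 1) := Multimap mdiff_lin mdiff_deg.

Lemma mdiffE x y (c : hchain x y) e :
  ev mdiff c e =
  mB F [:: Layer T F'] c e - sgn (g - 1) *: ins D (fun c => ev T c e) c.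
Proof. by rewrite /= /dval insertE. Qed.

End Differential.

(* The A-infinity relations of the category of functors; the terms with two or
   more transformations absorbed are indexed by the nontrivial [N]. *)
Lemma functor_category_rel F L x y (c : hchain x y) e : functors F L ->
  sgn (lrdeg L) *: ins D (fun c' => mB F L c' e) c +
  \sum_(M <- splits L) sgn (lrdeg M.1) *:
    (if M.2 is l :: M' then
       mB F (M.1 ++ Layer (mdiff (llast F M.1) (lfun l) (ltrans l)) (lfun l) :: M') c e +
       \sum_(N <- behead (splits M'))
         mB F (M.1 ++ wB (llast F M.1) (l :: N.1) :: N.2) c e
     else 0) = 0.
Proof.
move=> funL; rewrite -[RHS](wsum_aop_rel F L c e).
rewrite ins_wsum // scaler_sumr -big_split; apply: eq_sum_splits => -[L1 L2] /= defL.
rewrite scalerA -sgnD -[in sgn _]defL lrdeg_cat.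
rewrite (@sgn_eqmod2 _ _ (lrdeg L1)); last by exists (lrdeg L2); rewrite mulr2n addrA.
rewrite -scalerDr; congr (_ *: _).
(* By the functor equation, absorption of [D] by a functor is the term of [wsum_aop_rel] for the
   empty run. *)
have eqF : Layer (minsert D_nil (llast F L1)) (llast F L1) = wB (llast F L1) [::].
  apply: layer_eq => // {}x {}y {}c {}e.
  by rewrite /= wsum_nil (functors_last (L' := L2)) ?defL.
rewrite eqF -addrA; case: L2 defL => [|l L2] defL; rewrite /= big_cons ?big_nil ?addr0 //.
congr (_ + _); rewrite big_map.
have -> : splits L2 = ([::], L2) :: behead (splits L2) by case: (L2).
rewrite big_cons addrA; congr (_ + _) => /=.
(* The run consisting of [l] alone gives [mdiff] plus an insertion of [D] into [ltrans l], and this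
   insertion cancels the corresponding term of [ins_wsum]. *)
have degl : lrdeg [:: l] + 2 = ldeg l + 1 by rewrite /=; lia.
pose Z := mcast degl (wmap (aop B) (llast F L1) [:: l]).
have -> : wB (llast F L1) [:: l] = Layer Z (lfun l) by apply: layer_eq.
rewrite (@wsum_layerD _ _ _ _ _ _ (mdiff (llast F L1) (lfun l) (ltrans l))
  (minsert D_nil (ltrans l)) Z (- sgn (ldeg l - 1))) //; last first.
  by move=> {}x {}y {}c {}e; rewrite /= scaleNr [RHS]addrC; case: (l).
by rewrite scaleNr addrA subrr add0r.
Qed.

End Relations.

(** * Recursion on the length of chains *)

Section Singles.
Variables (R : comPzRingType) (A : quiver R) (V : lmodType R).

Lemma sum_parts_single (x y : A) (c : hchain x y)
    (psi : chain (@hchain R A) x y -> V) :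
  (0 < csize c)%N -> (forall b, (1 < csize b)%N -> psi b = 0) ->
  \sum_(b <- parts c) psi b = psi (cone c).
Proof.
move=> szc psi0; rewrite sum_parts_first // big_mkcond sum_cuts_last => [|t szt] /=.
  by rewrite szc big_seq1.
case: ifP => // _; apply: sum_parts_eq0 => b _; rewrite szt => szb.
by rewrite psi0.
Qed.

Lemma sum_cuts_ends (x y : A) (c : hchain x y) (psi : cut (@helt R A) x y -> V) :
  (0 < csize c)%N ->
  (forall t, (0 < csize (cfst t))%N -> (0 < csize (csnd t))%N -> psi t = 0) ->
  \sum_(t <- cuts c) psi t = psi (Cut (cnil x) c) + psi (Cut c (cnil y)).
Proof.
case: c psi => [//|{}x z {}y f c] psi _ psi0; rewrite sum_cuts_cons; congr (_ + _).
by rewrite sum_cuts_last // => t szt; rewrite psi0.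
Qed.

End Singles.

Section MultimapConstructions.
Variables (R : comPzRingType) (A B : quiver R) (p q : A -> B) (g : int).

Definition mzero : multimap p q g.
Proof.
by exists (fun _ _ _ _ => 0) => *; rewrite ?scaler0 ?addr0.
Defined.

Definition mlin (k : R) (T T' : multimap p q g) : multimap p q g.
Proof.
exists (fun x y c e => k *: ev T c e + ev T' c e) => [w x y z c d a f f' c' e|x y c e ne].
  by rewrite !ev_lin !scalerDr scaler_swap addrACA.
by rewrite !ev_deg // scaler0 addr0.
Defined.

Definition agree (n : nat) (T T' : multimap p q g) : Prop :=
  forall x y (c : hchain x y) e, (csize c < n)%N -> ev T c e = ev T' c e.

(** Contraction for the filtration by length: the values of [theta T] on chains of length n depend
    only on those of [T] on strictly shorter chains. *)
Definition contracting (theta : multimap p q g -> multimap p q g) : Prop :=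
  forall n T T', agree n T T' -> agree n.+1 (theta T) (theta T').

Section FixedPoint.
Variable theta : multimap p q g -> multimap p q g.
Hypothesis theta_contr : contracting theta.

Let approx n := iter n theta mzero.

Let approx_agree m n : agree m (approx m) (approx (m + n)).
Proof. by elim: m => // m IHm; apply: theta_contr. Qed.

Let approxE m x y (c : hchain x y) e : (csize c < m)%N ->
  ev (approx m) c e = ev (approx (csize c).+1) c e.
Proof. by move=> lt_m; rewrite -(subnKC lt_m) -approx_agree. Qed.

(** On chains of length n the iterates are stationary from stage n + 1 on, and the limit is read off
    there. Multilinearity passes to the limit because it relates chains of equal length, hence
    values of one iterate. *)
Definition mfix : multimap p q g.
Proof.
exists (fun x y c e => ev (approx (csize c).+1) c e) => [w x y z c d a f f' c' e|x y c e].
  by rewrite !csize_cat /= ev_lin.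
exact: ev_deg.
Defined.

Lemma mfixE x y (c : hchain x y) e : ev mfix c e = ev (theta mfix) c e.
Proof.
apply: (theta_contr (n := csize c)) => // x' y' c' e' lt_c.
by rewrite /= approxE.
Qed.

Lemma mfix_unique T T' :
  (forall x y (c : hchain x y) e, ev T c e = ev (theta T) c e) ->
  (forall x y (c : hchain x y) e, ev T' c e = ev (theta T') c e) ->
  forall x y (c : hchain x y) e, ev T c e = ev T' c e.
Proof.
move=> fixT fixT' x y c e; apply: (_ : agree (csize c).+1 T T') => //.
elim: (_.+1) => // n IHn {}x {}y {}c {}e szc.
by rewrite fixT fixT'; apply: (theta_contr IHn).
Qed.

End FixedPoint.
End MultimapConstructions.
Arguments mzero {R A B p q g}.

Section Locality.
Variables (R : comPzRingType) (A B : quiver R) (o : A -> B) (V : lmodType R).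

Lemma wsum_single g (T : multimap o o g) F F' x y (c : hchain x y)
    (psi : hchain (o x) (o y) -> V) :
  (forall w, (1 < csize w)%N -> psi w = 0) ->
  wsum F [:: Layer T F'] c psi = psi (cone (mhel T c)).
Proof.
move=> psi0; rewrite wsum_cons sum_cuts_first => [|t szt].
  rewrite sum_cuts_last => [|s szs].
    rewrite /= sum_parts0 wsum_nil sum_parts0 !mul0r mulr0 addr0 sgn0 scale1r.
    by [].
  rewrite /= sum_parts0 wsum_nil sum_parts_eq0 ?scaler0 // => b _.
  by rewrite szs => szb; rewrite psi0 //= csize_bar.
rewrite sum_cuts_eq0 // => s _ _.
rewrite sum_parts_eq0 ?scaler0 // => b _; rewrite szt => szb.
apply: wsum0 => w _ _ _; rewrite psi0 // csize_cat csize_bar /= addnS ltnS.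
by rewrite (leq_trans szb) ?leq_addr.
Qed.

Lemma eq_wsum_layer g (T T' : multimap o o g) F F' x y (c : hchain x y)
    (psi : hchain (o x) (o y) -> V) :
  agree (csize c).+1 T T' ->
  wsum F [:: Layer T F'] c psi = wsum F [:: Layer T' F'] c psi.
Proof.
move=> eqT; rewrite !wsum_cons; apply: eq_sum_cuts => t _ szt.
apply: eq_sum_cuts => s _ szs; congr (_ *: _); apply: eq_bigr => b _.
by rewrite /mhel /= eqT // ltnS -szt -szs addnCA leq_addr.
Qed.

Variables (g h : int) (T T' : multimap o o g) (H : multimap o o h).
Hypothesis H_nil : forall x e, ev H (cnil x) e = 0.
Variables (F F1 F2 : multimap o o 1).

Let mhel_H0 x y u v (a : hchain u (o x)) (b : hchain (o y) v)
    (psi : hchain u v -> V) (c : hchain x y) :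
  multilinear psi -> csize c = 0%N -> psi (ccat a (ccons (mhel H c) b)) = 0.
Proof.
move=> lin szc; have H0 e : ev H c e = 0 by case: c szc b => // z _ _; apply: H_nil.
by rewrite /mhel H0 multilinear0.
Qed.

(** In a nonzero term the block of [H] is nonempty, so [T] is evaluated on strictly shorter chains.
    This is how the vanishing of H^0 makes the equations for the inverses recursive. *)
Lemma eq_wsum_layerl x y (c : hchain x y) (psi : hchain (o x) (o y) -> V) :
  multilinear psi -> agree (csize c) T T' ->
  wsum F [:: Layer H F1; Layer T F2] c psi =
  wsum F [:: Layer H F1; Layer T' F2] c psi.
Proof.
move=> lin eqT; rewrite !wsum_cons; apply: eq_sum_cuts => t _ szt.
apply: eq_sum_cuts => s _ szs; congr (_ *: _); apply: eq_bigr => b _ /=.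
case: (posnP (csize (cfst s))) => [sz0|sz_gt0].
  by rewrite !wsum0 // => w _ _ _; apply: mhel_H0.
apply: eq_wsum_layer => x' y' c' e' szc'; apply: eqT.
by apply: leq_trans szc' _; rewrite -szt -szs; lia.
Qed.

Lemma eq_wsum_layerr x y (c : hchain x y) (psi : hchain (o x) (o y) -> V) :
  multilinear psi -> agree (csize c) T T' ->
  wsum F [:: Layer T F1; Layer H F2] c psi =
  wsum F [:: Layer T' F1; Layer H F2] c psi.
Proof.
move=> lin eqT; rewrite !wsum_cons; apply: eq_sum_cuts => t _ szt.
apply: eq_sum_cuts => s _ szs; congr (_ *: _); apply: eq_bigr => b _ /=.
case: (posnP (csize (csnd s))) => [sz0|sz_gt0].
  have wsum_H0 k (S : multimap o o k) :
    wsum F1 [:: Layer H F2] (csnd s)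
      (fun w => psi (ccat (bar F b) (ccons (mhel S (cfst s)) w))) = 0.
    rewrite wsum_cons; apply: sum_cuts_eq0 => t' _; rewrite sz0 => szt'.
    apply: sum_cuts_eq0 => s' _ szs'; rewrite big1 ?scaler0 // => b' _.
    apply: wsum0 => w _ _ _.
    have -> : ccat (bar F b) (ccons (mhel S (cfst s)) (ccat (bar F1 b')
       (ccons (mhel H (cfst s')) w))) =
       ccat (ccat (bar F b) (ccons (mhel S (cfst s)) (bar F1 b')))
       (ccons (mhel H (cfst s')) w) by rewrite ccatA.
    by apply: mhel_H0 => //; lia.
  by rewrite !wsum_H0.
apply: eq_wsum => w _ _ _; rewrite /mhel /= eqT //.
by rewrite -szt -szs; lia.
Qed.

End Locality.

(** * Weak equivalence *)

Section Units.
Variables (R : comPzRingType) (A : quiver R) (B : su_cat R) (o : A -> B).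

Definition unit_val (x y : A) (c : hchain x y) (e : int) : B (o x) (o y) e :=
  match c in chain _ x y return B (o x) (o y) e with
  | cnil x => hpart (hel (Defs.one (o x))) e
  | ccons _ _ _ _ _ => 0
  end.

Lemma unit_val0 x y (c : hchain x y) e : (0 < csize c)%N -> unit_val c e = 0.
Proof. by case: c. Qed.

Definition munit : multimap o o 0.
Proof.
exists unit_val => [w x y z c d a f f' c' e|x y c e].
  by rewrite !unit_val0 ?csize_cat /= ?addnS // scaler0 addr0.
by case: c => // z; rewrite add0r eq_sym => ne; apply: hpart_neq.
Defined.

Lemma mhel_unit x : mhel munit (cnil x) = hel (Defs.one (o x)).
Proof. by rewrite /mhel /= hpart_hel. Qed.

Lemma aop_unit u v (x y : A) (a : hchain u (o x)) (b : hchain (o y) v)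
    (c : hchain x y) e :
  (1 < csize a + csize b)%N || (0 < csize c)%N ->
  ev (aop B) (ccat a (ccons (mhel munit c) b)) e = 0.
Proof.
case: (posnP (csize c)) => [szc|szc _]; last by rewrite /mhel /= unit_val0 // ev0.
by rewrite orbF; case: c szc a b => // z _ a b; rewrite mhel_unit; apply: one_n.
Qed.

Variables (F F1 F2 : multimap o o 1).
Hypothesis F_nil : forall x e, ev F (cnil x) e = 0.
Hypothesis F1_nil : forall x e, ev F1 (cnil x) e = 0.
Variables (g : int) (T : multimap o o g).

Notation mB F L c e := (wsum F L c (fun w => ev (aop B) w e)).

Lemma wsum_unitl x y (c : hchain x y) e :
  mB F [:: Layer munit F1; Layer T F2] c e = ev T c e.
Proof.
rewrite wsum_cons sum_cuts_first => [|t szt]; last first.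
  apply: sum_cuts_eq0 => s _ _; rewrite sum_parts_eq0 ?scaler0 // => b _.
  rewrite szt => szb; apply: wsum0 => w _ szw _; apply: aop_unit.
  by rewrite csize_bar (leq_add szb szw).
rewrite sum_cuts_first => [|s szs]; last first.
  rewrite /= sum_parts0 wsum0 ?scaler0 // => w _ _ _.
  by apply: aop_unit; rewrite szs orbT.
rewrite /= sum_parts0 !mulr0 addr0 sgn0 scale1r wsum_single => [|w szw]; last first.
  by apply: aop_unit; rewrite szw.
rewrite /= mhel_unit; have [->|ne] := eqVneq e (rdeg c + g).
  exact: one_r.
rewrite !ev_deg //=; move: ne; apply: contra => /eqP->; apply/eqP; lia.
Qed.

(** The identity, of reduced degree -1, moves past the arguments, and left unitality brings the sign
    of the degree of T(c). The two signs leave only [sgn g]. *)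
Lemma wsum_unitr x y (c : hchain x y) e :
  mB F [:: Layer T F1; Layer munit F2] c e = sgn g *: ev T c e.
Proof.
rewrite (wsum_cat F [:: Layer T F1]) sum_cuts_last => [|t szt]; last first.
  apply: sum_cuts_eq0 => s _ szs; rewrite wsum0 ?scaler0 // => u _ szu _.
  rewrite wsum_nil; apply: sum_parts_eq0 => b _ szb; apply: aop_unit.
  by rewrite csize_bar; move: szu szb szt szs => /=; do 3!case: csize => [|?] //=; lia.
rewrite /= big_seq1 /= wsum_single => [|w szw].
  rewrite wsum_nil sum_parts0 mhel_unit /=.
  have [->|ne] := eqVneq e (rdeg c + g); last first.
    rewrite !ev_deg ?scaler0 //=; move: ne; apply: contra => /eqP->; apply/eqP; lia.
  rewrite -[X in sgn g *: X]one_l scalerA -sgnD; congr (_ *: _).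
  by apply: sgn_eqmod2; exists (- rdeg c - g); rewrite mulr2n; lia.
rewrite wsum_nil sum_parts0; apply: aop_unit.
by rewrite /= addn0 szw.
Qed.

(** On nonempty chains only the words made of the unit and one block survive, with the block after
    or before it, and the unit laws evaluate them with opposite signs. This turns a difference of
    functors into a boundary. *)
Lemma wsum_unit x y (c : hchain x y) e :
  mB F [:: Layer munit F1] c e = ev F1 c e - ev F c e.
Proof.
rewrite wsum_cons; case: (posnP (csize c)) => [|szc].
  case: c => // z _; rewrite F_nil F1_nil subr0 /= !big_seq1 /= ?big_seq1 wsum_nil sum_parts0.
  rewrite !mulr0 addr0 sgn0 scale1r /= mhel_unit.
  have [->|ne] := eqVneq e (0 + 1); last by rewrite ev_deg.
  exact: one_closed.
rewrite sum_cuts_ends // => [|t szt1 szt2]; last first.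
  apply: sum_cuts_eq0 => s _ szs; rewrite sum_parts_eq0 ?scaler0 // => b _.
  rewrite szt1 => szb; rewrite wsum_nil; apply: sum_parts_eq0 => b' _ szb'.
  apply: aop_unit; rewrite !csize_bar.
  by move: szb szb' szt2 szs; do 4!case: csize => [|?] //=; lia.
congr (_ + _).
  rewrite sum_cuts_first => [|s szs]; last first.
    rewrite /= sum_parts0 wsum0 ?scaler0 // => w _ _ _.
    by apply: aop_unit; rewrite szs orbT.
  rewrite /= sum_parts0 !mulr0 addr0 sgn0 scale1r wsum_nil.
  rewrite sum_parts_single // => [|b szb]; last first.
    by apply: aop_unit; rewrite !csize_bar szb.
  rewrite /= mhel_unit; have [->|ne] := eqVneq e (rdeg c + 1); first exact: one_r.
  rewrite !ev_deg //=; move: ne; apply: contra => /eqP->; apply/eqP; lia.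
rewrite /= big_seq1 /= sum_parts_single // => [|b szb]; last first.
  rewrite wsum_nil sum_parts0; apply: aop_unit; by rewrite csize_bar addn0 szb.
rewrite wsum_nil sum_parts0 /= mhel_unit.
have [->|ne] := eqVneq e (rdeg c + 1); last first.
  rewrite !ev_deg ?scaler0 ?oppr0 //=; move: ne; apply: contra => /eqP->; apply/eqP; lia.
rewrite -[X in _ = - X]one_l -scaleN1r scalerA; congr (_ *: _).
have <- : sgn 1 = -1 :> R by rewrite /sgn expr1.
by rewrite -sgnD; apply: sgn_eqmod2; exists (- rdeg c - 1); rewrite mulr2n; lia.
Qed.

End Units.

(** * Leibniz rule and associativity up to homotopy *)

Section LowOrderRelations.
Variables (R : comPzRingType) (A B : ainf_cat R) (o : A -> B).

Notation mB F L c e := (wsum F L c (fun w => ev (aop B) w e)).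
Notation diff F F' T := (mdiff (@aop_nil R A) F F' T).
Notation functor F := (is_functor (aop A) F).

Lemma M1E (F F' : multimap o o 1) g (T : multimap o o g) x y (c : hchain x y) e :
  M1 F F' T c e = ev (diff F F' T) c e.
Proof.
rewrite /= wsum_cons; congr (_ - _); apply: eq_bigr => t _; apply: eq_bigr => s _.
rewrite scaler_sumr; apply: eq_bigr => b _; rewrite wsum_nil scaler_sumr.
by apply: eq_bigr => b' _; rewrite /= addr0 mul0r addr0.
Qed.

Lemma M2E (F G K : multimap o o 1) g1 g2 (T2 : multimap o o g2)
    (T1 : multimap o o g1) x y (c : hchain x y) e :
  M2 F G K T2 T1 c e = mB F [:: Layer T1 G; Layer T2 K] c e.
Proof.
rewrite wsum_cons; apply: eq_bigr => t _; apply: eq_bigr => s _.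
under [X in _ = _ *: X]eq_bigr do rewrite wsum_cons.
rewrite exchange_big scaler_sumr; apply: eq_bigr => t' _ /=.
rewrite exchange_big scaler_sumr; apply: eq_bigr => s' _ /=.
rewrite scaler_sumr; apply: eq_bigr => b _.
rewrite !scaler_sumr; apply: eq_bigr => b' _.
rewrite wsum_nil !scaler_sumr; apply: eq_bigr => b'' _.
by rewrite scalerA -sgnD; congr (sgn _ *: _); lia.
Qed.

Variables (F0 F1 F2 F3 : multimap o o 1).
Hypotheses (fun0 : functor F0) (fun1 : functor F1) (fun2 : functor F2)
  (fun3 : functor F3).
Variables (g1 g2 g3 : int).
Variables (T1 : multimap o o g1) (T2 : multimap o o g2) (T3 : multimap o o g3).

Local Arguments lrdeg : simpl never.

(** These are the two terms of [functor_category_rel] in which the whole of [L] has been absorbed by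
    one operation, so the relation expresses the differential of [P] by the remaining terms. *)
Lemma diff_wmap (L : seq (layer o)) g (P : multimap o o g) x y (c : hchain x y) e :
  g = lrdeg L + 2 ->
  (forall x y (c : hchain x y) e, ev P c e = mB F0 L c e) ->
  ev (diff F0 (llast F0 L) P) c e =
  mB F0 [:: Layer (wmap (aop B) F0 L) (llast F0 L)] c e
  + sgn (lrdeg L) *: ins (aop A) (fun c' => mB F0 L c' e) c.
Proof.
move=> eqg evP; rewrite mdiffE (@layer_eq _ _ _ _ _ _ _ (wmap (aop B) F0 L)) //.
rewrite -scaleNr; congr (_ + _ *: _).
  have -> : sgn (g - 1) = sgn (1 + lrdeg L) :> R by congr sgn; lia.
  by rewrite sgnD /sgn expr1 mulN1r opprK.
by apply: eq_ins => c'; apply: evP.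
Qed.

Lemma diff_comp2 g (P : multimap o o g) x y (c : hchain x y) e :
  g = g1 + g2 ->
  (forall x y (c : hchain x y) e,
     ev P c e = mB F0 [:: Layer T1 F1; Layer T2 F2] c e) ->
  ev (diff F0 F2 P) c e =
  - (mB F0 [:: Layer (diff F0 F1 T1) F1; Layer T2 F2] c e +
     sgn (g1 - 1) *: mB F0 [:: Layer T1 F1; Layer (diff F1 F2 T2) F2] c e).
Proof.
move=> eqg evP; apply/eqP; rewrite -addr_eq0.
pose L := [:: Layer T1 F1; Layer T2 F2].
have funL : functors (aop A) F0 L by [].
have eqgL : g = lrdeg L + 2 by rewrite /lrdeg /=; lia.
rewrite -(functor_category_rel (@aop_nil R A) c e funL).
rewrite (diff_wmap c e eqgL evP) /= !big_cons !big_nil /= !big_cons !big_nil /=.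
rewrite (_ : lrdeg [::] = 0) // (_ : lrdeg [:: Layer T1 F1] = g1 - 1); last exact: addr0.
rewrite !addr0 sgn0 !scale1r scaler0 !addr0 /llast /=.
set x1 := mB F0 _ c e; set x2 := _ *: ins _ _ _.
set x3 := mB F0 _ c e; set x4 := _ *: mB _ _ _ _.
by rewrite [x1 + x2]addrC [x3 + x1]addrC !addrA.
Qed.

(** The relation for three transformations. As these are closed, only the two bracketings of the
    binary composition remain. *)
Lemma diff_comp3 g (P : multimap o o g) x y (c : hchain x y) e :
  g = g1 + g2 + g3 - 1 ->
  (forall x y (c : hchain x y) e,
     ev P c e = mB F0 [:: Layer T1 F1; Layer T2 F2; Layer T3 F3] c e) ->
  (forall x y (c : hchain x y) e, ev (diff F0 F1 T1) c e = 0) ->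
  (forall x y (c : hchain x y) e, ev (diff F1 F2 T2) c e = 0) ->
  (forall x y (c : hchain x y) e, ev (diff F2 F3 T3) c e = 0) ->
  ev (diff F0 F3 P) c e =
  - (mB F0 [:: Layer (wmap (aop B) F0 [:: Layer T1 F1; Layer T2 F2]) F2;
       Layer T3 F3] c e +
     sgn (g1 - 1) *: mB F0 [:: Layer T1 F1;
       Layer (wmap (aop B) F1 [:: Layer T2 F2; Layer T3 F3]) F3] c e).
Proof.
move=> eqg evP d1 d2 d3; apply/eqP; rewrite -addr_eq0.
pose L := [:: Layer T1 F1; Layer T2 F2; Layer T3 F3].
have funL : functors (aop A) F0 L by [].
have eqgL : g = lrdeg L + 2 by rewrite /lrdeg /=; lia.
rewrite -(functor_category_rel (@aop_nil R A) c e funL).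
rewrite (diff_wmap c e eqgL evP) /= !big_cons !big_nil /= !big_cons !big_nil /=.
have lin := ev_multilinear (aop B) (x := o x) (y := o y) e.
rewrite (wsum_layer0 _ _ [::] _ _ lin d1) (wsum_layer0 _ _ [:: Layer T1 F1] _ _ lin d2).
rewrite (wsum_layer0 _ _ [:: Layer T1 F1; Layer T2 F2] _ _ lin d3).
rewrite (_ : lrdeg [::] = 0) // (_ : lrdeg [:: Layer T1 F1] = g1 - 1); last exact: addr0.
rewrite !addr0 !add0r sgn0 !scale1r !scaler0 !addr0.
set x1 := mB F0 _ c e; set x2 := _ *: ins _ _ _.
set x3 := mB F0 _ c e; set x4 := _ *: mB _ _ _ _.
by rewrite [x1 + x2]addrC [x3 + x1]addrC !addrA.
Qed.

End LowOrderRelations.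

Lemma mdiff_linear (R : comPzRingType) (A B : ainf_cat R) (o : A -> B)
    (F F' : multimap o o 1) g (X Y Z : multimap o o g) k :
  (forall x y (c : hchain x y) e, ev X c e = k *: ev Y c e + ev Z c e) ->
  forall x y (c : hchain x y) e,
    ev (mdiff (@aop_nil R A) F F' X) c e =
    k *: ev (mdiff (@aop_nil R A) F F' Y) c e +
    ev (mdiff (@aop_nil R A) F F' Z) c e.
Proof.
move=> eqX x y c e; rewrite !mdiffE.
rewrite (@wsum_layerD _ _ _ _ _ _ X Y Z k _ _ [::] [::]) //; last exact: ev_multilinear.
have -> : ins (aop A) (fun c => ev X c e) c =
    k *: ins (aop A) (fun c => ev Y c e) c + ins (aop A) (fun c => ev Z c e) c.
  rewrite scaler_sumr -big_split; apply: eq_bigr => t _ /=.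
  rewrite scaler_sumr -big_split; apply: eq_bigr => s _ /=.
  by rewrite eqX scalerDr scaler_swap.
by rewrite scalerDr scalerBr opprD addrACA scaler_swap.
Qed.

(** * Cancellation of transformations of the form Id + H *)

Section HomotopyInverse.
Variables (R : comPzRingType) (A : ainf_cat R) (B : su_cat R) (o : A -> B).

Notation mB F L c e := (wsum F L c (fun w => ev (aop B) w e)).
Notation diff F F' T := (mdiff (@aop_nil R A) F F' T).
Notation functor F := (is_functor (aop A) F).
Notation id_o := (@munit R A B o).

Let linB x y e : multilinear (fun w : hchain (o x) (o y) => ev (aop B) w e).
Proof. exact: ev_multilinear. Qed.

Variables (H : multimap o o 0).
Hypothesis H_nil : forall x e, ev H (cnil x) e = 0.

Definition unipotent : multimap o o 0 := mlin 1 H id_o.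

Section Cancellation.
Variables (g : int) (F F1 F2 : multimap o o 1).

Fact deg_comp (X : multimap o o g) (F' F'' : multimap o o 1) :
  lrdeg [:: Layer H F'; Layer X F''] + 2 = g.
Proof. by rewrite /=; lia. Qed.

Fact deg_compr (X : multimap o o g) (F' F'' : multimap o o 1) :
  lrdeg [:: Layer X F'; Layer H F''] + 2 = g.
Proof. by rewrite /=; lia. Qed.

Variable J : multimap o o g.

(** The equation M2(X, Id + H) = J solved for the X in M2(X, Id) = X; its fixed points are the
    solutions. *)
Definition lsolver (X : multimap o o g) : multimap o o g :=
  mlin (-1) (mcast (deg_comp X F1 F2) (wmap (aop B) F _)) J.

(** The factors [sgn g] undo the sign in [wsum_unitr]. *)
Definition rsolver (X : multimap o o g) : multimap o o g :=
  mlin (- sgn g) (mcast (deg_compr X F1 F2) (wmap (aop B) F _))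
    (mlin (sgn g) J mzero).

Lemma lsolver_contracting : contracting lsolver.
Proof.
move=> n X Y eqXY x y c e szc /=; congr (_ *: _ + _).
apply: eq_wsum_layerl => // x' y' c' e' szc'; apply: eqXY.
exact: leq_trans szc' szc.
Qed.

Lemma rsolver_contracting : contracting rsolver.
Proof.
move=> n X Y eqXY x y c e szc /=; congr (_ *: _ + _).
apply: eq_wsum_layerr => // x' y' c' e' szc'; apply: eqXY.
exact: leq_trans szc' szc.
Qed.

Lemma lsolverP (X : multimap o o g) :
  (forall x y (c : hchain x y) e,
     mB F [:: Layer unipotent F1; Layer X F2] c e = ev J c e) <->
  (forall x y (c : hchain x y) e, ev X c e = ev (lsolver X) c e).
Proof.
have E x y (c : hchain x y) e : mB F [:: Layer unipotent F1; Layer X F2] c e =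
    mB F [:: Layer H F1; Layer X F2] c e + ev X c e.
  rewrite (@wsum_layerD _ _ _ _ _ _ unipotent H id_o 1 _ _ [::]) //.
  by rewrite scale1r wsum_unitl.
split=> eqX x y c e; move: (eqX x y c e); rewrite E /= scaleN1r.
  by move=> <-; rewrite addrA addNr add0r.
by move=> ->; rewrite addrA subrr add0r.
Qed.

Lemma rsolverP (X : multimap o o g) :
  (forall x y (c : hchain x y) e,
     mB F [:: Layer X F1; Layer unipotent F2] c e = ev J c e) <->
  (forall x y (c : hchain x y) e, ev X c e = ev (rsolver X) c e).
Proof.
have E x y (c : hchain x y) e : mB F [:: Layer X F1; Layer unipotent F2] c e =
    mB F [:: Layer X F1; Layer H F2] c e + sgn g *: ev X c e.
  rewrite (@wsum_layerD _ _ _ _ _ _ unipotent H id_o 1 _ _ [:: _]) //.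
  by rewrite scale1r wsum_unitr.
have sgnK (v v' : B (o _) (o _) _) : sgn g *: v = v' <-> v = sgn g *: v'.
  by split=> [<-|->]; rewrite scalerA sgn_sqr scale1r.
split=> eqX x y c e; move: (eqX x y c e); rewrite E /= addr0 scaleNr -scalerN -scalerDr.
  by move=> eqJ; apply/sgnK; rewrite -eqJ addrA addNr add0r.
by move/sgnK=> ->; rewrite addrA subrr add0r.
Qed.

End Cancellation.

Variables (g : int) (F F1 F2 : multimap o o 1).

(** [X] and 0 both solve the recursive equation with J = 0, and a contracting map has only one fixed
    point. *)
Lemma unipotent_cancell (X : multimap o o g) :
  (forall x y (c : hchain x y) e,
     mB F [:: Layer unipotent F1; Layer X F2] c e = 0) ->
  forall x y (c : hchain x y) e, ev X c e = 0.
Proof.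
move/(@lsolverP _ _ _ _ mzero) => eqX.
apply: (mfix_unique (@lsolver_contracting _ F F1 F2 mzero) eqX (T' := mzero)).
apply/lsolverP => x y c e.
by apply: (wsum_layer0 _ _ [:: Layer unipotent F1]).
Qed.

Lemma unipotent_cancelr (X : multimap o o g) :
  (forall x y (c : hchain x y) e,
     mB F [:: Layer X F1; Layer unipotent F2] c e = 0) ->
  forall x y (c : hchain x y) e, ev X c e = 0.
Proof.
move/(@rsolverP _ _ _ _ mzero) => eqX.
apply: (mfix_unique (@rsolver_contracting _ F F1 F2 mzero) eqX (T' := mzero)).
apply/rsolverP => x y c e.
by apply: (wsum_layer0 _ _ [::]).
Qed.

End HomotopyInverse.

Section WeakEquivalence.
Variables (R : comPzRingType) (A : ainf_cat R) (B : su_cat R) (o : A -> B).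

Notation mB F L c e := (wsum F L c (fun w => ev (aop B) w e)).
Notation diff F F' T := (mdiff (@aop_nil R A) F F' T).
Notation id_o := (@munit R A B o).

Let linB x y e : multilinear (fun w : hchain (o x) (o y) => ev (aop B) w e).
Proof. exact: ev_multilinear. Qed.

Lemma diff_unit (F F' : multimap o o 1) :
  (forall x e, ev F (cnil x) e = 0) -> (forall x e, ev F' (cnil x) e = 0) ->
  forall x y (c : hchain x y) e,
    ev (diff F F' id_o) c e = ev F' c e - ev F c e.
Proof.
move=> F_nil F'_nil x y c e; rewrite mdiffE wsum_unit //.
rewrite [ins _ _ _]sum_cuts_eq0 ?scaler0 ?subr0 // => t _ _.
apply: sum_cuts_eq0 => s _ _.
by rewrite /= unit_val0 ?scaler0 // csize_cat /= addnS.
Qed.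

Variables (F G : multimap o o 1) (H : multimap o o 0).
Hypotheses (funF : is_functor (aop A) F) (funG : is_functor (aop A) G).
Hypotheses (F_nil : forall x e, ev F (cnil x) e = 0)
  (G_nil : forall x e, ev G (cnil x) e = 0)
  (H_nil : forall x e, ev H (cnil x) e = 0).
Hypothesis homFG : forall x y (c : hchain x y) e,
  ev F c e - ev G c e = M1 F G H c e.

Let T := unipotent H.

(** Seen as a transformation from F to G, the identity has differential G - F, which cancels M1(H) =
    F - G. *)
Lemma unipotent_closed x y (c : hchain x y) e : ev (diff F G T) c e = 0.
Proof.
rewrite (@mdiff_linear _ _ _ _ _ _ _ T H id_o 1) // scale1r -M1E -homFG.
by rewrite diff_unit // addrA subrK subrr.
Qed.

Let Sl : multimap o o 0 := mfix (lsolver H F G F id_o).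
Let Sr : multimap o o 0 := mfix (rsolver H G F G id_o).

Let TSl x y (c : hchain x y) e :
  mB F [:: Layer T G; Layer Sl F] c e = ev id_o c e.
Proof.
move: x y c e; apply/lsolverP => x y c e.
by rewrite [LHS](mfixE (lsolver_contracting H_nil _ _ _ _)).
Qed.

Let SrT x y (c : hchain x y) e :
  mB G [:: Layer Sr F; Layer T G] c e = ev id_o c e.
Proof.
move: x y c e; apply/rsolverP => x y c e.
by rewrite [LHS](mfixE (rsolver_contracting H_nil _ _ _ _)).
Qed.

(** Differentiating M2(Sl, T) = Id leaves M2(M1(Sl), T) = 0, since [T] and the identity of F are
    closed; then [T] is cancelled. *)
Let Sl_closed x y (c : hchain x y) e : ev (diff G F Sl) c e = 0.
Proof.
apply: (unipotent_cancell H_nil (F := F) (F1 := G) (F2 := F)) => {}x {}y {}c {}e.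
have := diff_comp2 funF funG funF (T1 := T) (T2 := Sl) (P := id_o) c e erefl
  (fun x y c e => esym (TSl c e)).
rewrite diff_unit // subrr (wsum_layer0 _ _ [::] _ _ (linB e) unipotent_closed).
rewrite add0r => /esym/eqP; rewrite oppr_eq0 => /eqP E.
by rewrite -[LHS]scale1r -(sgn_sqr R (0 - 1)) -scalerA E scaler0.
Qed.

Let Sr_closed x y (c : hchain x y) e : ev (diff G F Sr) c e = 0.
Proof.
apply: (unipotent_cancelr H_nil (F := G) (F1 := F) (F2 := G)) => {}x {}y {}c {}e.
have := diff_comp2 funG funF funG (T1 := Sr) (T2 := T) (P := id_o) c e erefl
  (fun x y c e => esym (SrT c e)).
rewrite diff_unit // subrr (wsum_layer0 _ _ [:: Layer Sr F] _ _ (linB e) unipotent_closed).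
by rewrite scaler0 addr0 => /esym/eqP; rewrite oppr_eq0 => /eqP.
Qed.

(* The third order operation on Sr, T, Sl is a homotopy between the two
   one-sided inverses of T. *)
Let Y : multimap o o (-1) :=
  @mcast _ _ _ _ _ _ (-1) erefl
    (wmap (aop B) G [:: Layer Sr F; Layer T G; Layer Sl F]).

Let diffY x y (c : hchain x y) e :
  ev (diff G F Y) c e = ev Sr c e - ev Sl c e.
Proof.
rewrite (diff_comp3 funG funF funG funF (T1 := Sr) (T2 := T) (T3 := Sl) c e
  (g := -1) (P := Y)) //; last exact: unipotent_closed.
rewrite (@layer_eq _ _ _ _ _ _ (wmap (aop B) G [:: Layer Sr F; Layer T G]) id_o) //.
rewrite (@layer_eq _ _ _ _ _ _ (wmap (aop B) F [:: Layer T G; Layer Sl F]) id_o) //.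
rewrite wsum_unitl wsum_unitr // sgn0 scale1r opprD addrC.
by congr (_ - _); rewrite /sgn expr1 scaleN1r opprK.
Qed.

(** Composing [Y] with [T] carries the homotopy between [Sr] and [Sl] to one between M2(T, Sr),
    which is the identity, and M2(T, Sl). *)
Let V : multimap o o (-1) :=
  @mcast _ _ _ _ _ _ (-1) erefl (wmap (aop B) G [:: Layer Y F; Layer T G]).

Let diffV x y (c : hchain x y) e :
  ev (diff G G V) c e = mB G [:: Layer Sl F; Layer T G] c e - ev id_o c e.
Proof.
rewrite (diff_comp2 funG funF funG (T1 := Y) (T2 := T) (P := V) c e) //.
rewrite (wsum_layer0 _ _ [:: Layer Y F] _ _ (linB e) unipotent_closed).
rewrite scaler0 addr0 (@wsum_layerD _ _ _ _ _ _ (diff G F Y) Sl Sr (-1) _ _ [::]) //.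
  by rewrite SrT scaleN1r opprD opprK.
by move=> {}x {}y {}c {}e; rewrite diffY scaleN1r addrC.
Qed.

Lemma homotopy_inverse : exists (T S : multimap o o 0) (U V : multimap o o (-1)),
  [/\ forall x y (c : hchain x y) e, M1 F G T c e = 0,
      forall x y (c : hchain x y) e, M1 G F S c e = 0,
      forall x y (c : hchain x y) e,
        M2 F G F S T c e - ev id_o c e = M1 F F U c e
    & forall x y (c : hchain x y) e,
        M2 G F G T S c e - ev id_o c e = M1 G G V c e].
Proof.
(* [Sl] is a strict left inverse, so the homotopy on that side is 0. *)
exists T, Sl, mzero, V; split=> x y c e.
- by rewrite M1E unipotent_closed.
- by rewrite M1E Sl_closed.
- rewrite M2E TSl subrr M1E mdiffE (wsum_layer0 _ _ [::] _ _ (linB e)) //.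
  rewrite /ins big1 ?scaler0 ?subrr // => t _; rewrite big1 // => s _.
  by rewrite scaler0.
- by rewrite M2E M1E diffV.
Qed.

End WeakEquivalence.

Lemma homotopic_weakly_equivalent (R : comPzRingType) (A : ainf_cat R)
    (B : su_cat R) (F G : ainf_functor A B) :
  homotopic F G -> weakly_equivalent F G.
Proof.
case: F G => [o F F_nil F_rel] [o' G G_nil G_rel] [/= E]; subst o' => /= -[H [H_nil homFG]].
have [T [S [U [V [T0 S0 TS ST]]]]] := homotopy_inverse F_rel G_rel F_nil G_nil H_nil homFG.
exists T, S; split=> //; [exists U | exists V] => x y c e.
  by rewrite -TS; case: c.
by rewrite -ST; case: c.
Qed.

Lemma hpart_ev (R : comPzRingType) (A B : quiver R) (p q : A -> B) g
    (T : multimap p q g) x y (c : hchain x y) d e :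
  d = rdeg c + g -> hpart (hel (ev T c d)) e = ev T c e.
Proof.
move=> eqd; have [->|ne] := eqVneq e d; first by rewrite hpart_hel.
by rewrite hpart_neq 1?eq_sym // ev_deg // -eqd.
Qed.

(** * The path category *)

(* The multimaps concentrated on sequences of length 1; [s] is the effect on
   degrees. *)
Section Strict.
Variables (R : comPzRingType) (A B : quiver R) (o : A -> B) (g : int).
Variables (s : int -> int) (f1 : forall x y d, A x y d -> B (o x) (o y) (s d)).
Hypothesis s_deg : forall d, s d = d - 1 + g.
Hypothesis f1_lin : forall x y d k (f f' : A x y d),
  f1 (k *: f + f') = k *: f1 f + f1 f'.

Definition hmap x y (f : helt x y) : helt (o x) (o y) := hel (f1 (projT2 f)).

Definition strict_val x y (c : hchain x y) (e : int) : B (o x) (o y) e :=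
  match c in chain _ x y return B (o x) (o y) e with
  | cnil _ => 0
  | ccons x y z f c' =>
      match c' in chain _ y z return helt x y -> B (o x) (o z) e with
      | cnil _ => fun f => hpart (hmap f) e
      | ccons _ _ _ _ _ => fun _ => 0
      end f
  end.

Lemma strict_val0 x y (c : hchain x y) e : csize c != 1%N -> strict_val c e = 0.
Proof. by case: c => // {}x z {}y f c; case: c f. Qed.

Fact strict_lin w x y z (c : hchain w x) d (a : R) (f f' : A x y d)
    (c' : hchain y z) e :
  strict_val (ccat c (ccons (hel (a *: f + f')) c')) e =
  a *: strict_val (ccat c (ccons (hel f) c')) e +
  strict_val (ccat c (ccons (hel f') c')) e.
Proof.
case: c f f' => [{}x|{}w w' {}x h c] f f'; last first.
  by rewrite !strict_val0 ?scaler0 ?addr0 //= csize_cat /= addnS.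
case: c' f f' => [{}y|{}y y' {}z h c'] f f'; last first.
  by rewrite !strict_val0 ?scaler0 ?addr0.
rewrite /= /hmap /=; have [->|ne] := eqVneq e (s d).
  by rewrite !hpart_hel f1_lin.
by rewrite !hpart_neq 1?eq_sym // scaler0 addr0.
Qed.

Fact strict_deg x y (c : hchain x y) e : e != rdeg c + g -> strict_val c e = 0.
Proof.
case: c => // {}x z {}y f c; case: c f => //= {}z f ne.
by apply: hpart_neq; rewrite /= eq_sym s_deg; move: ne; rewrite addr0.
Qed.

Definition mstrict : multimap o o g := Multimap strict_lin strict_deg.

Lemma mhel_strict x y (f : helt x y) : mhel mstrict (cone f) = hmap f.
Proof. by rewrite /mhel /= hel_hpart //= s_deg addr0. Qed.

Section Sums.
Variables (V : lmodType R) (u v : B) (psi : hchain u v -> V).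
Hypothesis lin : multilinear psi.

Lemma strict_letter0 x y (a : hchain u (o x)) (b : hchain (o y) v)
    (c : hchain x y) :
  csize c != 1%N -> psi (ccat a (ccons (mhel mstrict c) b)) = 0.
Proof. by move=> szc; rewrite /mhel /= strict_val0 // multilinear0. Qed.

End Sums.
End Strict.

Section StrictWords.
Variables (R : comPzRingType) (A B : quiver R) (o : A -> B) (V : lmodType R).
Variables (s : int -> int) (f1 : forall x y d, A x y d -> B (o x) (o y) (s d)).
Hypothesis s_deg : forall d, s d = d - 1 + 1.
Hypothesis f1_lin : forall x y d k (f f' : A x y d),
  f1 (k *: f + f') = k *: f1 f + f1 f'.

(** A strict multimap kills blocks of length other than 1, which leaves only the partition into
    single letters. *)
Lemma sum_parts_strict x y (c : hchain x y) (psi : hchain (o x) (o y) -> V) :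
  multilinear psi ->
  \sum_(b <- parts c) psi (bar (mstrict s_deg f1_lin) b) =
  psi (cmap (fun x y => @hmap _ _ _ _ _ f1 x y) c).
Proof.
elim: c psi => [{}x|{}x y' z f c IHc] psi lin; first by rewrite sum_parts0.
rewrite sum_parts_first // big_mkcond sum_cuts_cons /= add0r.
rewrite sum_cuts_first => [|t szt]; last first.
  rewrite /= big1 // => b _; apply: (strict_letter0 s_deg f1_lin lin (cnil _)).
  by rewrite /= eqSS -lt0n.
transitivity (\sum_(b <- parts c)
    psi (ccons (hmap f1 f) (bar (mstrict s_deg f1_lin) b))).
  by apply: eq_bigr => b _; rewrite bar_cons mhel_strict.
apply: (IHc (fun w => psi (ccons _ w))).
exact: (multilinear_catl (cone _) lin).
Qed.

End StrictWords.

Lemma insert_length1 (R : comPzRingType) (A B : quiver R)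
    (D : @multimap R A A id id 2) (D_nil : forall (x : A) e, ev D (cnil x) e = 0)
    (p q : A -> B) g (T : multimap p q g) x y (c : hchain x y) e :
  (forall x y (c : hchain x y) e, csize c != 1%N -> ev T c e = 0) ->
  insert T D c e = ev T (cone (mhel D c)) e.
Proof.
move=> T0; rewrite (insertE D_nil) /ins sum_cuts_first => [|t szt]; last first.
  rewrite big1 // => s _; rewrite T0 ?scaler0 // csize_cat /= addnS eqSS -lt0n.
  by rewrite addn_gt0 szt.
rewrite sum_cuts_last => [|t szt] /=; first by rewrite sgn0 scale1r.
by rewrite T0 ?scaler0 //= eqSS -lt0n.
Qed.

Section PathCategory.
Variables (R : comPzRingType) (B : ainf_cat R).

(* Morphisms of the tensor product of B with the cochains of an interval: the
   values at the two ends, and the value on the interval. *)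
Definition path_quiver : quiver R :=
  @Quiver R B (fun x y d => (B x y d * B x y d * B x y (d - 1))%type : lmodType R).

Local Notation P := path_quiver.

Lemma path_eq (x y : P) d (f f' : P x y d) :
  f.1.1 = f'.1.1 -> f.1.2 = f'.1.2 -> f.2 = f'.2 -> f = f'.
Proof. by case: f f' => [[a b] h] [[a' b'] h'] /= -> -> ->. Qed.

Let deg1 (d : int) : d = d - 1 + 1. Proof. by rewrite subrK. Qed.
Let deg0 (d : int) : d - 1 = d - 1 + 0. Proof. by rewrite addr0. Qed.
Let o (x : P) : B := x.

Definition path_src : multimap o o 1 :=
  @mstrict R P B o 1 id (fun x y d f => f.1.1) deg1 (fun _ _ _ _ _ _ => erefl).
Definition path_tgt : multimap o o 1 :=
  @mstrict R P B o 1 id (fun x y d f => f.1.2) deg1 (fun _ _ _ _ _ _ => erefl).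
Definition path_htp : multimap o o 0 :=
  @mstrict R P B o 0 (fun d => d - 1) (fun x y d f => f.2) deg0
    (fun _ _ _ _ _ _ => erefl).

Notation mB F L c e := (wsum F L c (fun w => ev (aop B) w e)).

(* The third component is chosen so that [path_htp] is a homotopy from
   [path_src] to [path_tgt]. *)
Definition path_op3 (x y : P) (c : hchain x y) (e : int) : B x y e :=
  ev path_src c e - ev path_tgt c e
  - mB path_src [:: Layer path_htp path_tgt] c e.

Definition path_val (x y : P) (c : hchain x y) (e : int) : P x y e :=
  (mB path_src [::] c e, mB path_tgt [::] c e, path_op3 c (e - 1)).

Fact path_lin (w x y z : P) (c : hchain w x) d (a : R) (f f' : P x y d)
    (c' : hchain y z) e :
  path_val (ccat c (ccons (hel (a *: f + f')) c')) e =
  a *: path_val (ccat c (ccons (hel f) c')) e +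
  path_val (ccat c (ccons (hel f') c')) e.
Proof.
apply: path_eq; [exact: (wmap_lin (aop B))|exact: (wmap_lin (aop B))|].
rewrite /= /path_op3 !ev_lin (wmap_lin (aop B)).
by rewrite !scalerBr !opprD [RHS]addrACA [X in _ = X + _]addrACA.
Qed.

Fact path_deg (x y : P) (c : hchain x y) e : e != rdeg c + 2 -> path_val c e = 0.
Proof.
move=> ne; apply: path_eq; [exact: (wmap_deg (aop B))|exact: (wmap_deg (aop B))|].
have ne' : e - 1 != rdeg c + 1 by move: ne; apply: contra => /eqP ?; apply/eqP; lia.
by rewrite /= /path_op3 !ev_deg // (wmap_deg (aop B)) // !subr0.
Qed.

Definition path_op : @multimap R P P id id 2 := Multimap path_lin path_deg.

Definition src_map := @hmap R P B o id (fun x y d (f : P x y d) => f.1.1).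
Definition tgt_map := @hmap R P B o id (fun x y d (f : P x y d) => f.1.2).

Section Words.
Variable V : lmodType R.

Lemma path_src_words (x y : P) (c : hchain x y) (psi : hchain (o x) (o y) -> V) :
  multilinear psi ->
  wsum path_src [::] c psi = psi (cmap src_map c).
Proof. by move=> lin; rewrite wsum_nil; apply: sum_parts_strict. Qed.

Lemma path_tgt_words (x y : P) (c : hchain x y) (psi : hchain (o x) (o y) -> V) :
  multilinear psi ->
  wsum path_tgt [::] c psi = psi (cmap tgt_map c).
Proof. by move=> lin; rewrite wsum_nil; apply: sum_parts_strict. Qed.

Lemma path_words1 g (T : multimap o o g) (x y : P) (c : hchain x y)
    (psi : hchain (o x) (o y) -> V) :
  multilinear psi ->
  wsum path_src [:: Layer T path_tgt] c psi =
  \sum_(t <- cuts c) \sum_(s <- cuts (csnd t)) sgn ((g - 1) * rdeg (cfst t)) *: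
    psi (ccat (cmap src_map (cfst t)) (ccons (mhel T (cfst s)) (cmap tgt_map (csnd s)))).
Proof.
move=> lin; rewrite wsum_cons; apply: eq_bigr => t _; apply: eq_bigr => s _.
rewrite /= addr0 mul0r addr0; congr (_ *: _).
rewrite (@sum_parts_strict _ _ _ _ _ _ _ deg1 (fun _ _ _ _ _ _ => erefl) _ _ _ (fun u =>
   wsum path_tgt [::] (csnd s) (fun w => psi (ccat u (ccons (mhel T (cfst s)) w))))).
  rewrite path_tgt_words // => x' y' a b d k f f'.
  have := lin _ _ (ccat (cmap src_map (cfst t)) (ccons (mhel T (cfst s)) a)) b d k f f'.
  by rewrite !ccatA.
by apply: multilinear_wsum_param => w; apply: multilinear_catr.
Qed.

(** Letters before the distinguished one are evaluated at the source and letters after it at the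
    target, so consecutive terms cancel; there are no signs because [T] has reduced degree 0. The
    degree is written [0 + 1] to match the differential of [path_htp]. *)
Lemma path_words_telescope (T : multimap o o (0 + 1)) (x y : P) (c : hchain x y)
    (psi : hchain (o x) (o y) -> V) :
  multilinear psi ->
  (forall x y (c : hchain x y) e,
     ev T c e = ev path_src c e - ev path_tgt c e) ->
  wsum path_src [:: Layer T path_tgt] c psi =
  wsum path_src [::] c psi - wsum path_tgt [::] c psi.
Proof.
move=> lin eqT; rewrite path_words1 // path_src_words // path_tgt_words //.
have T0 (x' y' : P) u v (a : hchain u (o x')) (b : hchain (o y') v)
    (chi : hchain u v -> V) (c' : hchain x' y') :
    multilinear chi -> csize c' != 1%N -> chi (ccat a (ccons (mhel T c') b)) = 0.
  by move=> linc szc; rewrite /mhel eqT /= !strict_val0 // subrr multilinear0.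
have T1 (x' y' : P) u v (a : hchain u (o x')) (b : hchain (o y') v)
    (chi : hchain u v -> V) (f : helt x' y') :
    multilinear chi -> chi (ccat a (ccons (mhel T (cone f)) b)) =
    chi (ccat a (ccons (src_map f) b)) - chi (ccat a (ccons (tgt_map f) b)).
  case: f => d f linc; rewrite -(@mhelE _ _ _ _ _ _ T _ _ _ d); last by rewrite /=; lia.
  rewrite eqT /= !hpart_hel -scaleN1r addrC linc.
  by rewrite scaleN1r addrC.
elim: c psi lin => [{}x|{}x z {}y f c IHc] psi lin.
  by rewrite /= !big_seq1 (T0 _ _ _ _ (cnil _) (cnil _)) // scaler0 subrr.
rewrite sum_cuts_cons; set psi' := fun w => psi (ccons (src_map f) w).
have lin' : multilinear psi' := multilinear_catl (cone _) lin.
have -> : \sum_(s <- cuts (csnd (Cut (cnil x) (ccons f c))))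
    sgn ((0 + 1 - 1) * rdeg (cfst (Cut (cnil x) (ccons f c)))) *:
    psi (ccat (cmap src_map (cfst (Cut (cnil x) (ccons f c))))
      (ccons (mhel T (cfst s)) (cmap tgt_map (csnd s)))) =
    psi' (cmap tgt_map c) - psi (ccons (tgt_map f) (cmap tgt_map c)).
  rewrite /= big_cons big_map (T0 _ _ _ _ (cnil _)) // scaler0 add0r.
  rewrite sum_cuts_first => [|s szs]; last first.
    by rewrite (T0 _ _ _ _ (cnil _)) ?scaler0 //= eqSS -lt0n.
  by rewrite /= mulr0 sgn0 scale1r (T1 _ _ _ _ (cnil _)).
have -> : \sum_(t <- cuts c) \sum_(s <- cuts (csnd (Cut (ccons f (cfst t)) (csnd t))))
    sgn ((0 + 1 - 1) * rdeg (cfst (Cut (ccons f (cfst t)) (csnd t)))) *: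
    psi (ccat (cmap src_map (cfst (Cut (ccons f (cfst t)) (csnd t))))
      (ccons (mhel T (cfst s)) (cmap tgt_map (csnd s)))) =
    psi' (cmap src_map c) - psi' (cmap tgt_map c).
  rewrite -(IHc _ lin'); apply: eq_bigr => t _; apply: eq_bigr => s _.
  by congr (sgn _ *: _); rewrite /= add0r subrr !mul0r.
by rewrite addrC addrA subrK.
Qed.
End Words.

Lemma path_op_nil (x : P) e : ev path_op (cnil x) e = 0.
Proof.
have nil0 e' : ev (aop B) (cnil (o x)) e' = 0 := aop_nil _ _.
apply: path_eq; rewrite /= ?path_src_words ?path_tgt_words //=; try exact: ev_multilinear.
rewrite /path_op3 subrr sub0r path_words1; last exact: ev_multilinear.
rewrite /= !big_seq1 /= ?big_seq1.
rewrite (strict_letter0 _ _ (ev_multilinear (aop B) (e - 1)) (cnil _)) //.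
by rewrite scaler0 oppr0.
Qed.

Lemma path_src_functor : is_functor path_op path_src.
Proof.
move=> x y c e; rewrite insert_length1;
  [|exact: path_op_nil|by move=> *; rewrite /= strict_val0].
rewrite -(wsum_nil path_src c (fun w => ev (aop B) w e)) /=.
by rewrite (hpart_ev (wmap (aop B) path_src [::])).
Qed.

Lemma path_tgt_functor : is_functor path_op path_tgt.
Proof.
move=> x y c e; rewrite insert_length1;
  [|exact: path_op_nil|by move=> *; rewrite /= strict_val0].
rewrite -(wsum_nil path_tgt c (fun w => ev (aop B) w e)) /=.
by rewrite (hpart_ev (wmap (aop B) path_tgt [::])).
Qed.

Lemma path_op3_deg (x y : P) (c : hchain x y) d e :
  d = rdeg c + 1 -> hpart (hel (path_op3 c d)) e = path_op3 c e.
Proof.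
move=> eqd; have [->|ne] := eqVneq e d; first by rewrite hpart_hel.
rewrite hpart_neq 1?eq_sym // /path_op3 !ev_deg -?eqd // (wmap_deg (aop B)) ?subr0 //.
by rewrite eqd /= in ne *; move: ne; apply: contra => /eqP->; apply/eqP; lia.
Qed.

Lemma path_htp_insert (x y : P) (c : hchain x y) e :
  insert path_htp path_op c e = path_op3 c e.
Proof.
rewrite insert_length1;
  [|exact: path_op_nil|by move=> *; rewrite /= strict_val0].
by rewrite /= /hmap /= path_op3_deg // -addrA.
Qed.

Lemma path_htp_diff (x y : P) (c : hchain x y) e :
  ev (mdiff path_op_nil path_src path_tgt path_htp) c e =
  ev path_src c e - ev path_tgt c e.
Proof.
rewrite [LHS]/= path_htp_insert /path_op3.
rewrite (_ : sgn (0 - 1) = -1) ?/sgn ?expr1 // scaleN1r opprK.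
by rewrite addrC subrK.
Qed.

(** Each component is an instance of [functor_category_rel] over [path_op]: without transformations
    for the two ends, with the single transformation [path_htp] for the interval. There the
    differential of [path_htp] telescopes to the difference of the ends, which the functor equations
    of the ends produce as well. *)
Lemma path_rel (x y : P) (c : hchain x y) e : insert path_op path_op c e = 0.
Proof.
have lin e' := ev_multilinear (aop B) (x := o x) (y := o y) e'.
have rel0 F : is_functor path_op F -> ins path_op (fun c' => mB F [::] c' e) c = 0.
  move=> funF; have := functor_category_rel path_op_nil (F := F) (L := [::]) c e
    (conj funF I).
  by rewrite /= big_seq1 scaler0 addr0 sgn0 scale1r.
have relh e' : ins path_op (fun c' => mB path_src [:: Layer path_htp path_tgt] c' e') c =
    mB path_src [::] c e' - mB path_tgt [::] c e'.
  rewrite -(path_words_telescope c (lin e') path_htp_diff).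
  have := functor_category_rel path_op_nil (F := path_src)
    (L := [:: Layer path_htp path_tgt]) c e'
    (conj path_src_functor (conj path_tgt_functor I)).
  rewrite /= !big_cons !big_nil /= !big_nil !addr0 scaler0 addr0 sgn0 scale1r.
  rewrite (_ : sgn (0 - 1) = -1) ?/sgn ?expr1 // scaleN1r addrC.
  by move/eqP; rewrite subr_eq0 => /eqP.
have relF F e' : is_functor path_op F -> ins path_op (fun c' => ev F c' e') c = mB F [::] c e'.
  by move=> funF; rewrite -(insertE path_op_nil) -funF wsum_nil.
rewrite (insertE path_op_nil); apply: path_eq.
- transitivity (ins path_op (fun c' => mB path_src [::] c' e) c); last exact/rel0/path_src_functor.
  rewrite /ins (big_morph (fun f : P x y e => f.1.1) (id1 := 0) (op1 := +%R)) //.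
  apply: eq_bigr => t _.
  by rewrite (big_morph (fun f : P x y e => f.1.1) (id1 := 0) (op1 := +%R)).
- transitivity (ins path_op (fun c' => mB path_tgt [::] c' e) c); last exact/rel0/path_tgt_functor.
  rewrite /ins (big_morph (fun f : P x y e => f.1.2) (id1 := 0) (op1 := +%R)) //.
  apply: eq_bigr => t _.
  by rewrite (big_morph (fun f : P x y e => f.1.2) (id1 := 0) (op1 := +%R)).
transitivity (ins path_op (fun c' => path_op3 c' (e - 1)) c).
  rewrite /ins (big_morph (fun f : P x y e => f.2) (id1 := 0) (op1 := +%R)) //.
  apply: eq_bigr => t _.
  by rewrite (big_morph (fun f : P x y e => f.2) (id1 := 0) (op1 := +%R)).
have insB (psi psi' : hchain x y -> B x y (e - 1)) :
    ins path_op (fun c' => psi c' - psi' c') c = ins path_op psi c - ins path_op psi' c.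
  rewrite /ins -sumrB; apply: eq_bigr => t _; rewrite -sumrB; apply: eq_bigr => s _.
  by rewrite scalerBr.
rewrite !insB relh !relF; [|exact: path_tgt_functor|exact: path_src_functor].
by rewrite subrr.
Qed.

Definition path_cat : ainf_cat R := AInfCat path_op_nil path_rel.

Fact path_src_nil (x : P) e : ev path_src (cnil x) e = 0. Proof. by []. Qed.
Fact path_tgt_nil (x : P) e : ev path_tgt (cnil x) e = 0. Proof. by []. Qed.

Definition path_srcF : ainf_functor path_cat B :=
  @AInfFunctor R path_cat B o path_src path_src_nil path_src_functor.
Definition path_tgtF : ainf_functor path_cat B :=
  @AInfFunctor R path_cat B o path_tgt path_tgt_nil path_tgt_functor.

End PathCategory.

Lemma mhel_htp0 (R : comPzRingType) (B : ainf_cat R) (x y : path_cat B)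
    (c : hchain x y) : csize c != 1%N ->
  mhel (path_htp B) c = @hel _ B x y (rdeg c + 0) 0.
Proof. by move=> szc; rewrite /mhel /= strict_val0. Qed.

(** * Constant paths *)

Section ConstantPaths.
Variables (R : comPzRingType) (B : ainf_cat R).

Notation P := (path_cat B).
Notation mB F L c e := (wsum F L c (fun w => ev (aop B) w e)).

Let deg1 (d : int) : d = d - 1 + 1. Proof. by rewrite subrK. Qed.
Let j (x : B) : P := x.

Definition cst (x y : B) d (f : B x y d) : P (j x) (j y) d := (f, f, 0).

Fact cst_lin (x y : B) d k (f f' : B x y d) :
  cst (k *: f + f') = k *: cst f + cst f'.
Proof. by apply: path_eq => //=; rewrite scaler0 addr0. Qed.

Definition path_cst : multimap j j 1 := mstrict deg1 cst_lin.

Notation cst_map := (@hmap R B P j id cst).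

Let src_cst (x y : B) (c : hchain x y) : cmap (@src_map R B) (cmap cst_map c) = c.
Proof. by elim: c => //= {}x z {}y [d f] c ->. Qed.

Let tgt_cst (x y : B) (c : hchain x y) : cmap (@tgt_map R B) (cmap cst_map c) = c.
Proof. by elim: c => //= {}x z {}y [d f] c ->. Qed.

Fact path_cst_nil (x : B) e : ev path_cst (cnil x) e = 0. Proof. by []. Qed.

(** On constant paths the two ends agree and [path_htp] vanishes, hence so does the third component
    of [path_op]. *)
Fact path_cst_rel (x y : B) (c : hchain x y) e :
  \sum_(b <- parts c) ev (aop P) (bar path_cst b) e = insert path_cst (aop B) c e.
Proof.
rewrite insert_length1; [|exact: aop_nil|by move=> *; rewrite /= strict_val0].
rewrite (sum_parts_strict deg1 cst_lin c (ev_multilinear (aop P) e)).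
have -> : ev path_cst (cone (mhel (aop B) c)) e = cst (ev (aop B) c e).
  rewrite /= /hmap /=; have [->|ne] := eqVneq e (rdeg c + 2); first by rewrite hpart_hel.
  rewrite hpart_neq 1?eq_sym // ev_deg //.
apply: path_eq.
- by rewrite /= path_src_words ?src_cst //; apply: ev_multilinear.
- by rewrite /= path_tgt_words ?tgt_cst //; apply: ev_multilinear.
rewrite /= /path_op3.
have -> : ev (path_src B) (cmap cst_map c) (e - 1) = ev (path_tgt B) (cmap cst_map c) (e - 1).
  by case: c => // {}x z {}y f c; case: c f.
rewrite subrr sub0r path_words1; last exact: ev_multilinear.
rewrite sum_cuts_map big1 ?oppr0 // => t _; rewrite /= sum_cuts_map big1 // => s _ /=.
have h0 d : ev (path_htp B) (cmap cst_map (cfst s)) d = 0.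
  case: (cfst s) => // x' z y' f c'; case: c' f => //= z' [d' f].
  have [->|ne] := eqVneq d (d' - 1); first by rewrite hpart_hel.
  by rewrite hpart_neq //= eq_sym.
by rewrite /mhel h0 (multilinear0 _ _ (ev_multilinear (aop B) (e - 1))) scaler0.
Qed.

Definition path_cstF : ainf_functor B P :=
  @AInfFunctor R B P j path_cst path_cst_nil path_cst_rel.

Lemma path_src_cst : fcomp (path_srcF B) path_cstF = fid B.
Proof.
apply: ainf_functor_eq => x y c e; rewrite mcompE.
rewrite (sum_parts_strict deg1 cst_lin c (ev_multilinear (path_src B) e)).
by case: c => // {}x z {}y [d f] c; case: c f.
Qed.

Lemma path_tgt_cst : fcomp (path_tgtF B) path_cstF = fid B.
Proof.
apply: ainf_functor_eq => x y c e; rewrite mcompE.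
rewrite (sum_parts_strict deg1 cst_lin c (ev_multilinear (path_tgt B) e)).
by case: c => // {}x z {}y [d f] c; case: c f.
Qed.

End ConstantPaths.

(** * Homotopies as functors to the path category *)

Section HomotopyFunctor.
Variables (R : comPzRingType) (A B : ainf_cat R) (o : A -> B).
Variables (F G : multimap o o 1) (H : multimap o o 0).
Hypotheses (funF : is_functor (aop A) F) (funG : is_functor (aop A) G).
Hypotheses (F_nil : forall x e, ev F (cnil x) e = 0)
  (G_nil : forall x e, ev G (cnil x) e = 0)
  (H_nil : forall x e, ev H (cnil x) e = 0).
Hypothesis homFG : forall x y (c : hchain x y) e,
  ev F c e - ev G c e = M1 F G H c e.

Notation P := (path_cat B).
Notation mB F L c e := (wsum F L c (fun w => ev (aop B) w e)).
Let oP (x : A) : P := o x.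

Definition hfun : multimap oP oP 1.
Proof.
exists (fun x y c e => (ev F c e, ev G c e, ev H c (e - 1)) : P (oP x) (oP y) e)
  => [w x y z c d a f f' c' e|x y c e ne].
  by apply: path_eq; apply: ev_lin.
by apply: path_eq; apply: ev_deg => //; move: ne; apply: contra => /eqP ?; apply/eqP; lia.
Defined.

Let src_bar x y (b : chain (@hchain R A) x y) : cmap (@src_map R B) (bar hfun b) = bar F b.
Proof. by elim: b => //= {}x z {}y c b ->. Qed.

Let tgt_bar x y (b : chain (@hchain R A) x y) : cmap (@tgt_map R B) (bar hfun b) = bar G b.
Proof. by elim: b => //= {}x z {}y c b ->. Qed.

Fact hfun_nil (x : A) e : ev hfun (cnil x) e = 0.
Proof. by apply: path_eq; rewrite /= ?F_nil ?G_nil ?H_nil. Qed.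

Let nil_size0 g (T : multimap o o g) x y (c : hchain x y) e :
  (forall x e, ev T (cnil x) e = 0) -> csize c = 0%N -> ev T c e = 0.
Proof. by move=> T_nil; case: c. Qed.

Let sum_src x y (c : hchain x y) e :
  \sum_(b <- parts c) ev (path_src B) (bar hfun b) e = ev F c e.
Proof.
case: (posnP (csize c)) => [szc|szc].
  by case: c szc => // z _; rewrite sum_parts0 /= F_nil.
rewrite sum_parts_single // => [|b szb]; first by rewrite /= (hpart_ev F).
by rewrite /= strict_val0 // csize_bar; case: csize szb => [|[]].
Qed.

Let sum_tgt x y (c : hchain x y) e :
  \sum_(b <- parts c) ev (path_tgt B) (bar hfun b) e = ev G c e.
Proof.
case: (posnP (csize c)) => [szc|szc].
  by case: c szc => // z _; rewrite sum_parts0 /= G_nil.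
rewrite sum_parts_single // => [|b szb]; first by rewrite /= (hpart_ev G).
by rewrite /= strict_val0 // csize_bar; case: csize szb => [|[]].
Qed.

(** As [path_htp] is strict, only a single block can reach it, and on that block it reads off [H];
    the blocks before and after it contribute their ends [F] and [G]. *)
Let sum_htp x y (c : hchain x y) e :
  \sum_(b <- parts c)
    mB (path_src B) [:: Layer (path_htp B) (path_tgt B)] (bar hfun b) e =
  mB F [:: Layer H G] c e.
Proof.
have lin u v := ev_multilinear (aop B) (x := u) (y := v) e.
pose phi (u1 u2 : A) (b1 : chain (@hchain R A) x u1) (b2 : chain (@hchain R A) u1 u2)
    (b3 : chain (@hchain R A) u2 y) :=
  sgn ((0 - 1) * rdeg (bar hfun b1)) *: ev (aop B) (ccat (bar F b1)
    (ccons (mhel (path_htp B) (bar hfun b2)) (bar G b3))) e.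
transitivity (\sum_(b <- parts c) \sum_(t <- cuts b) \sum_(s <- cuts (csnd t))
   phi _ _ (cfst t) (cfst s) (csnd s)).
  apply: eq_bigr => b _; rewrite path_words1 // sum_cuts_map.
  apply: eq_bigr => t _; rewrite sum_cuts_bar.
  by apply: eq_bigr => s _; rewrite /phi /= src_bar tgt_bar.
rewrite (sum_parts_cuts c (fun t => \sum_(s <- cuts (csnd t))
   phi _ _ (cfst t) (cfst s) (csnd s))) /= wsum_cons.
apply: eq_bigr => t _.
under eq_bigr => b1 _ do
  rewrite (sum_parts_cuts (csnd t) (fun s => phi _ _ b1 (cfst s) (csnd s))).
rewrite exchange_big; apply: eq_bigr => s _ /=.
rewrite addr0 mul0r addr0 scaler_sumr; apply: eq_sum_parts => b1 degb1 _.
rewrite exchange_big wsum_nil scaler_sumr; apply: eq_bigr => b3 _ /=.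
transitivity (\sum_(b2 <- parts (cfst s)) sgn ((0 - 1) * rdeg (cfst t)) *:
    ev (aop B) (ccat (bar F b1)
    (ccons (mhel (path_htp B) (bar hfun b2)) (bar G b3))) e).
  by apply: eq_bigr => b2 _; rewrite /phi rdeg_bar degb1.
rewrite -scaler_sumr; congr (_ *: _).
case: (posnP (csize (cfst s))) => [szs|szs].
  rewrite [RHS](_ : _ = 0); last by rewrite /mhel nil_size0 // ev0.
  apply: sum_parts_eq0 => b2 _; rewrite szs => szb2.
  by rewrite mhel_htp0 ?ev0 // csize_bar; case: csize szb2.
rewrite sum_parts_single // => [|b2 szb2].
  rewrite -(@mhelE _ _ _ _ _ _ (path_htp B) _ _ _ (rdeg (cfst s) + 0));
    last by rewrite /=; lia.
  by rewrite /= (hpart_ev H) // addrK addr0.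
by rewrite mhel_htp0 ?ev0 // csize_bar; case: csize szb2 => [|[]].
Qed.

(** The ends are the functor equations of [F] and [G]. In the third component [path_op3] produces F
    - G minus the part of M1(H) computed in B, so the homotopy equation leaves the insertions into
    [H]. *)
Fact hfun_rel (x y : A) (c : hchain x y) e :
  \sum_(b <- parts c) ev (aop P) (bar hfun b) e = insert hfun (aop A) c e.
Proof.
apply: path_eq.
- transitivity (insert F (aop A) c e); last first.
    rewrite /insert (big_morph (fun f : P _ _ e => f.1.1) (id1 := 0) (op1 := +%R)) //.
    apply: eq_bigr => t _.
    by rewrite (big_morph (fun f : P _ _ e => f.1.1) (id1 := 0) (op1 := +%R)).
  rewrite (big_morph (fun f : P _ _ e => f.1.1) (id1 := 0) (op1 := +%R)) // -funF.
  apply: eq_bigr => b _; rewrite /= path_src_words ?src_bar //; exact: ev_multilinear.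
- transitivity (insert G (aop A) c e); last first.
    rewrite /insert (big_morph (fun f : P _ _ e => f.1.2) (id1 := 0) (op1 := +%R)) //.
    apply: eq_bigr => t _.
    by rewrite (big_morph (fun f : P _ _ e => f.1.2) (id1 := 0) (op1 := +%R)).
  rewrite (big_morph (fun f : P _ _ e => f.1.2) (id1 := 0) (op1 := +%R)) // -funG.
  apply: eq_bigr => b _; rewrite /= path_tgt_words ?tgt_bar //; exact: ev_multilinear.
transitivity (insert H (aop A) c (e - 1)); last first.
  rewrite /insert (big_morph (fun f : P _ _ e => f.2) (id1 := 0) (op1 := +%R)) //.
  apply: eq_bigr => t _.
    by rewrite (big_morph (fun f : P _ _ e => f.2) (id1 := 0) (op1 := +%R)).
rewrite (big_morph (fun f : P _ _ e => f.2) (id1 := 0) (op1 := +%R)) //.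
transitivity (\sum_(b <- parts c) path_op3 (bar hfun b) (e - 1)); first by [].
rewrite /path_op3 !sumrB sum_src sum_tgt sum_htp homFG M1E /=.
rewrite (_ : sgn (0 - 1) = -1) ?/sgn ?expr1 // scaleN1r opprK.
by rewrite addrAC subrr add0r.
Qed.

Definition hfunF : ainf_functor A P := @AInfFunctor R A P oP hfun hfun_nil hfun_rel.

Lemma path_src_hfun : fcomp (path_srcF B) hfunF = AInfFunctor F_nil funF.
Proof. by apply: ainf_functor_eq => x y c e; rewrite mcompE sum_src. Qed.

Lemma path_tgt_hfun : fcomp (path_tgtF B) hfunF = AInfFunctor G_nil funG.
Proof. by apply: ainf_functor_eq => x y c e; rewrite mcompE sum_tgt. Qed.

End HomotopyFunctor.

Lemma ev_coneB (R : comPzRingType) (A B : quiver R) (p q : A -> B) g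
    (T : multimap p q g) x y d (f f' : A x y d) e :
  ev T (cone (hel (f - f'))) e = ev T (cone (hel f)) e - ev T (cone (hel f')) e.
Proof.
by rewrite -scaleN1r (evD T (cnil x) _ _ (cnil y)) (evZ T (cnil x) _ _ (cnil y)) scaleN1r.
Qed.

(** Cohomological units are unique up to boundaries, which functors preserve, so it is enough to
    test one unit of each object. *)
Lemma fmap1_cunit (R : comPzRingType) (A B : ainf_cat R) (F : ainf_functor A B)
    (x : A) (u v : A x x 0) :
  is_cunit u -> is_cunit (fmap1 F u) -> is_cunit v -> is_cunit (fmap1 F v).
Proof.
move=> cu cFu cv; apply: is_cunit_cohomologous cFu.
by rewrite /cohomologous -fmap1B; apply/fmap1_exact/is_cunit_unique.
Qed.

Lemma fmap1_closed (R : comPzRingType) (A B : ainf_cat R) (F : ainf_functor A B)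
    (x y : A) d (f : A x y d) : Defs.closed f -> Defs.closed (fmap1 F f).
Proof.
move=> clf; have := fmap_rel F (cone (hel f)) (d + 1).
rewrite insert1 /= !big_seq1 /= => E.
rewrite /Defs.closed /fmap1 (@mhelE _ _ _ _ _ _ (fmap F)) /=; last by lia.
rewrite [LHS]E -(@mhelE _ _ _ _ _ _ (aop A) _ _ _ (d + 1)) /=; last by lia.
by rewrite clf; apply: (ev0 (fmap F) (cnil _) _ (cnil _)).
Qed.

(** * Units and cohomology of the path category *)

Section PathUnits.
Variables (R : comPzRingType) (B : su_cat R).

Notation P := (path_cat B).
Notation mB F L c e := (wsum F L c (fun w => ev (aop B) w e)).

Let linB (x y : B) e : multilinear (fun w : hchain x y => ev (aop B) w e).
Proof. exact: ev_multilinear. Qed.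

Let htp_map (x y : P) (f : helt x y) : @helt R B x y := hel (projT2 f).2.

Let mhel_htp1 (x y : P) (f : helt x y) : mhel (path_htp B) (cone f) = htp_map f.
Proof. exact: mhel_strict. Qed.

Lemma path_words_cone (x y : P) (f : helt x y) e :
  mB (path_src B) [:: Layer (path_htp B) (path_tgt B)] (cone f) e =
  ev (aop B) (cone (htp_map f)) e.
Proof.
rewrite path_words1 //= !(big_cons, big_nil) /= -!/(cone f) mhel_htp1 !mhel_htp0 //.
rewrite (ev0 (aop B) (cnil _) _ (cone _)) (ev0 (aop B) (cone _) _ (cnil _)).
by rewrite !scaler0 mulr0 sgn0 scale1r !addr0 add0r.
Qed.

(** The minus sign comes from moving [path_htp], of reduced degree -1, past [f]. *)
Lemma path_words_pair (x y z : P) (f : helt x y) (h : helt y z) e :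
  mB (path_src B) [:: Layer (path_htp B) (path_tgt B)] (ccons f (cone h)) e =
  ev (aop B) (ccons (htp_map f) (cone (tgt_map h))) e
  - sgn (tag f) *: ev (aop B) (ccons (src_map f) (cone (htp_map h))) e.
Proof.
rewrite path_words1 //= !(big_cons, big_nil) /= -!/(cone h) -!/(cone f).
rewrite !mhel_htp1 !mhel_htp0 //.
rewrite (ev0 (aop B) (cnil _) _ (ccons _ (cone _))) (ev0 (aop B) (cnil _) _ (cnil _)).
rewrite (ev0 (aop B) (cone _) _ (cone _)) (ev0 (aop B) (ccons _ (cone _)) _ (cnil _)).
rewrite !scaler0 !(addr0, add0r) mulr0 sgn0 scale1r -scaleNr; congr (_ + _ *: _).
have -> : - sgn (tag f) = sgn 1 * sgn (tag f) :> R by rewrite /sgn expr1 mulN1r.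
rewrite -sgnD; apply: sgn_eqmod2; exists (- tag f).
by move: (tag f) => t; rewrite mulr2n mulN1r; lia.
Qed.

Definition path_one (x : P) : P x x 0 := (@Defs.one R B x, @Defs.one R B x, 0).

Lemma path_one_r (x y : P) d (f : P x y d) :
  ev (aop P) (ccons (hel (path_one x)) (cone (hel f))) d = f.
Proof.
apply: path_eq; rewrite /= ?path_src_words ?path_tgt_words //; try exact: one_r.
rewrite /path_op3 subrr sub0r path_words_pair (ev0 (aop B) (cnil _) _ (cone _)).
by rewrite sgn0 scale1r sub0r opprK; apply: one_r.
Qed.

Lemma path_one_l (x y : P) d (f : P x y d) :
  sgn d *: ev (aop P) (ccons (hel f) (cone (hel (path_one y)))) d = f.
Proof.
apply: path_eq; rewrite /= ?path_src_words ?path_tgt_words //; try exact: one_l.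
rewrite /path_op3 subrr sub0r path_words_pair (ev0 (aop B) (cone _) _ (cnil _)).
rewrite scaler0 subr0 scalerN -scaleNr -[RHS]one_l; congr (_ *: _).
have -> : - sgn d = sgn 1 * sgn d :> R by rewrite /sgn expr1 mulN1r.
by rewrite -sgnD; apply: sgn_eqmod2; exists 1; rewrite mulr2n; lia.
Qed.

Lemma path_aop1 (x y : P) d (f : P x y d) e :
  ev (aop P) (cone (hel f)) e =
  (ev (aop B) (cone (hel f.1.1)) e, ev (aop B) (cone (hel f.1.2)) e,
   hpart (hel f.1.1) (e - 1) - hpart (hel f.1.2) (e - 1)
   - ev (aop B) (cone (hel f.2)) (e - 1)).
Proof.
apply: path_eq; rewrite /= ?path_src_words ?path_tgt_words //.
by rewrite /path_op3 path_words_cone.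
Qed.

Lemma path_one_cunit (x : P) : is_cunit (path_one x).
Proof.
split=> [|y d f _|y d f _].
- rewrite /Defs.closed path_aop1; apply: path_eq; [exact: one_closed|exact: one_closed|].
  by rewrite /= (ev0 (aop B) (cnil _) _ (cnil _)) subr0; apply: subrr.
- by rewrite /hcomp sgn0 scale1r path_one_r; apply: cohomologous_refl.
- by rewrite /hcomp path_one_l; apply: cohomologous_refl.
Qed.

Lemma path_cu : cohomologically_unital P.
Proof. by move=> x; exists (path_one x); apply: path_one_cunit. Qed.

Lemma path_closedP (x y : P) d (f : P x y d) :
  Defs.closed f -> [/\ Defs.closed (f.1.1 : B x y d), Defs.closed (f.1.2 : B x y d) &
    f.1.1 - f.1.2 = ev (aop B) (cone (hel f.2)) d].
Proof.
rewrite /Defs.closed path_aop1 => clf; split.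
- exact: (congr1 (fun f : P x y (d + 1) => f.1.1) clf).
- exact: (congr1 (fun f : P x y (d + 1) => f.1.2) clf).
have /= := congr1 (fun f : P x y (d + 1) => f.2) clf.
(* The third component lives in degree [d + 1 - 1]; generalizing this degree allows it to be
   replaced by [d]. *)
have := addrK 1 d; move: (d + 1 - 1) => d' eqd; case: _ / (esym eqd).
by rewrite !hpart_hel => /eqP; rewrite subr_eq0 => /eqP.
Qed.

(* [path_src] is injective on cohomology. *)
Lemma path_exact (x y : P) d (f : P x y d) :
  Defs.closed f -> Defs.exact (f.1.1 : B x y d) -> Defs.exact f.
Proof.
(* The primitive [z] at the source is carried along the path: subtracting [f.2] corrects its
   boundary to the target end, and the difference of the two ends of the new path is then [f.2],
   with no interval term needed. *)
move=> /path_closedP[_ _ df] [z fz]; exists (z, z - f.2, 0).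
rewrite path_aop1 /= !hpart_hel; apply: path_eq => //=.
  by rewrite ev_coneB -df -fz opprB addrCA subrr addr0.
by rewrite (ev0 (aop B) (cnil _) _ (cnil _)) subr0 opprB addrCA subrr addr0.
Qed.

End PathUnits.

Section PathFunctors.
Variables (R : comPzRingType) (B : su_cat R).
Notation P := (path_cat B).

Lemma path_srcF1 (x y : P) d (f : P x y d) : fmap1 (path_srcF B) f = f.1.1.
Proof. exact: hpart_hel. Qed.

Lemma path_tgtF1 (x y : P) d (f : P x y d) : fmap1 (path_tgtF B) f = f.1.2.
Proof. exact: hpart_hel. Qed.

Lemma path_cstF1 (x y : B) d (f : B x y d) : fmap1 (path_cstF B) f = cst f.
Proof. exact: hpart_hel. Qed.

Lemma path_srcF_cu : cu_functor (path_srcF B).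
Proof.
move=> x u; apply: fmap1_cunit (path_one_cunit x) _.
by rewrite path_srcF1; apply: one_cunit.
Qed.

Lemma path_tgtF_cu : cu_functor (path_tgtF B).
Proof.
move=> x u; apply: fmap1_cunit (path_one_cunit x) _.
by rewrite path_tgtF1; apply: one_cunit.
Qed.

Lemma path_cstF_cu : cu_functor (path_cstF B).
Proof.
move=> x u; apply: fmap1_cunit (one_cunit x) _.
by rewrite path_cstF1; apply: path_one_cunit.
Qed.

Lemma path_cstF_qe : quasi_equivalence (path_cstF B).
Proof.
split=> [x y d|x].
  split=> [f f' clf clf' /(fmap1_exact (path_srcF B))|f clf].
    by rewrite fmap1B !path_srcF1 !path_cstF1.
  (* A closed path is cohomologous to the constant path at its source, because their difference is
     closed with source 0. *)
  have [cla clb eqf] := path_closedP clf; exists f.1.1 => //.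
  rewrite path_cstF1; apply: path_exact; last by rewrite /= subrr; apply: exact0.
  have := fmap1_closed (path_cstF B) cla; rewrite path_cstF1 => clc.
  by rewrite /Defs.closed ev_coneB clf clc subrr.
exists x; exists (path_one x), (path_one x).
have [cl1 _ _] := path_one_cunit x.
by split=> //; rewrite /hcomp sgn0 scale1r path_one_r; apply: path_one_cunit.
Qed.

(** The image of a unit differs from [path_one] by a closed path whose source is exact, and
    [path_exact] applies: unitality is detected at the source end. *)
Lemma path_lift_cu (A : ainf_cat R) (K : ainf_functor A P) :
  cu_functor (fcomp (path_srcF B) K) -> cu_functor K.
Proof.
move=> cuK x u cu; apply: is_cunit_cohomologous (path_one_cunit _).
have [clu _ _] := cu.
have [cl1 _ _] := path_one_cunit (K x).
apply: path_exact.
  by rewrite /Defs.closed ev_coneB cl1 subr0; apply: fmap1_closed.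
rewrite -path_srcF1 fmap1B -fmap1_comp [X in _ - X]path_srcF1.
by apply: is_cunit_unique; [apply: cuK | apply: one_cunit].
Qed.

End PathFunctors.

(** * Localization *)

(** After inverting w, every r equals (r w) w^-1 and is determined by r w. *)
Lemma zeq_retractions (C : category) (W : forall a b : C, C a b -> Prop) (a b : C)
    (w : C a b) (p q : C b a) : W _ _ w -> ccomp p w = ccomp q w ->
  zeq (zarr W p) (zarr W q).
Proof.
move=> Ww eqpq; suff E (r : C b a) : zeq (zarr W r) (zcomp (zarr W (ccomp r w)) (zinv Ww)).
  by apply: ztrans (E p) _; rewrite eqpq; apply/zsym/E.
apply: ztrans (zsym (zunitr (zarr W r))) _.
apply: ztrans (zcongr (zrefl _) (zsym (zinvr Ww))) _.
apply: ztrans (zsym (zassoc _ _ _)) _.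
exact: zcongr (zfunct _ _ _) (zrefl _).
Qed.

Lemma homotopic_Ho_cu_class (R : comPzRingType) (A B : su_cat R)
    (F G : ainf_functor A B) (cuF : cu_functor F) (cuG : cu_functor G) :
  homotopic F G -> Ho_cu_class cuF = Ho_cu_class cuG.
Proof.
case: F G cuF cuG => [o F F_nil F_rel] [o' G G_nil G_rel] cuF cuG [/= E].
subst o' => /= -[H [H_nil homFG]].
pose K := hfunF F_rel G_rel F_nil G_nil H_nil homFG.
have srcK := path_src_hfun F_rel G_rel F_nil G_nil H_nil homFG.
have tgtK := path_tgt_hfun F_rel G_rel F_nil G_nil H_nil homFG.
have cuK : cu_functor K by apply: path_lift_cu; rewrite srcK.
(* [K] is unital only on cohomology, as F and G are, so the comparison takes place in
   [AInfCat_cu]. *)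
pose PB : AInfCat_cu R := CUCat (@path_cu R B).
pose k : AInfCat_cu R (su_to_cu A) PB := exist _ K cuK.
pose src : AInfCat_cu R PB (su_to_cu B) := exist _ _ (@path_srcF_cu R B).
pose tgt : AInfCat_cu R PB (su_to_cu B) := exist _ _ (@path_tgtF_cu R B).
pose i : AInfCat_cu R (su_to_cu B) PB := exist _ _ (@path_cstF_cu R B).
apply/loccls_eq.
have -> : exist _ _ cuF = ccomp src k by apply: sval_eq; rewrite /= srcK.
have -> : exist _ _ cuG = ccomp tgt k by apply: sval_eq; rewrite /= tgtK.
apply: ztrans (zsym (zfunct _ _ _)) _; apply: ztrans _ (zfunct _ _ _).
apply: zcongr (zrefl _).
apply: (zeq_retractions (w := i)); first exact: path_cstF_qe.
by apply: sval_eq; rewrite /= path_src_cst path_tgt_cst.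
Qed.

Theorem lemma2p6 (R : comPzRingType) (A B : su_cat R) (F G : ainf_functor A B)
    (cuF : cu_functor F) (cuG : cu_functor G) :
  homotopic F G ->
  [/\ weakly_equivalent F G,
      Ho_cu_class cuF = Ho_cu_class cuG
    & forall E : equivalence (Ho_incl R),
        Ho_su_class E cuF = Ho_su_class E cuG].
Proof.
move=> homFG; have eqFG := homotopic_Ho_cu_class cuF cuG homFG.
split=> // [|E]; first exact: homotopic_weakly_equivalent.
(* A class in [Ho_su] is the only preimage of the class in [Ho_cu], so equality of the latter
   suffices. *)
by apply/Ho_su_classP; rewrite -eqFG; apply/Ho_su_classP.
Qed.
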